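(* Let $\mathcal T=\{A,B\}$ consist of two rectangular tiles in $\mathbb R^2$, with widths $w_A,w_B$ and heights $h_A,h_B$, such that $w_A/w_B$ and $h_A/h_B$ are irrational, and such that $w_A=h_B$ and $w_B=h_A$. Then there exists a mixing probability measure preserving system $(X,\mathcal B,\mu,(T_{\vec v})_{\vec v\in\mathbb R^2})$ that is $\mathcal T$-tileable.
   Context: Tiles are axis-parallel rectangles. A $\mathcal T$-tiling of $\mathbb R^2$ is a covering of $\mathbb R^2$ by translates of tiles from $\mathcal T$ that overlap only on boundaries. $Y_{\mathcal T}$ denotes the set of all $\mathcal T$-tilings, with the natural Borel structure (generated by the positions and types of the tiles), and $S_{\vec v}y$ is the tiling $y$ translated by $-\vec v$. A measure preserving action $(X,\mu,\{T_{\vec v}\}_{\vec v\in\mathbb R^2})$ is $\mathcal T$-tileable if there is a factor map $\phi\colon (X,\mu,\{T_{\vec v}\})\to (Y_{\mathcal T},\phi(\mu),\{S_{\vec v}\})$, i.e. a measurable map, defined almost everywhere, with $\phi\circ T_{\vec v}=S_{\vec v}\circ\phi$ for all $\vec v$ almost everywhere. The action is mixing if $\int f\cdot (g\circ T_{\vec v})\,d\mu\to\int f\,d\mu\int g\,d\mu$ as $\|\vec v\|\to\infty$ for all $f,g\in L^2(\mu)$. *)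

(* Defs.v *)
From HB Require Import structures.
From mathcomp Require Import all_boot all_order all_algebra.
From mathcomp Require Import all_classical all_reals all_analysis.

Set Implicit Arguments.
Unset Strict Implicit.
Unset Printing Implicit Defensive.

Import Order.TTheory GRing.Theory Num.Theory.
Import numFieldNormedType.Exports.

Local Open Scope classical_set_scope.
Local Open Scope ring_scope.

Record tile (R : realType) := Tile {
  width : R;
  height : R;
  width_gt0 : 0 < width;
  height_gt0 : 0 < height }.

(* A tile together with the position of its lower-left corner. *)
Definition placed_tile (R : realType) := (tile R * (R * R))%type.

(* The closed rectangle of the plane covered by a placed tile. *)
Definition region (R : realType) (p : placed_tile R) : set (R * R) :=
  [set q | p.2.1 <= q.1 <= p.2.1 + width p.1 /\
           p.2.2 <= q.2 <= p.2.2 + height p.1].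

Definition boundary (U : topologicalType) (E : set U) : set U :=
  closure E `\` E°.

(* The Effros sigma-algebra on sets of placed tiles, with discrete tile types:
   it is generated by the events "some tile of type t has its position in U".
   On tilings, which are locally finite, it is the sigma-algebra generated by
   the positions and types of the tiles. *)
Definition hitting_events (R : realType) : set (set (set (placed_tile R))) :=
  [set E | exists (t : tile R) (U : set (R * R)), open U /\
           E = [set y | exists2 c, U c & y (t, c)]].

(* Measurable types being pointed, the sigma-algebra is put on all sets of
   placed tiles, and the tilings are singled out as a subset of this type. *)
Definition configuration (R : realType) :=
  g_sigma_algebraType (@hitting_events R).

Definition tiling_space (R : realType) (Ts : set (tile R)) :
    set (configuration R) :=
  [set y | [/\ forall p, y p -> Ts p.1,
               \bigcup_(p in y) region p = [set: R * R] &
               forall p q, y p -> y q -> p <> q ->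
                 region p `&` region q `<=`
                 boundary (region p) `&` boundary (region q)]].

Definition shift (R : realType) (v : R * R) (y : configuration R) :
    configuration R :=
  [set (p.1, p.2 - v) | p in y].

(* The norm is the sup norm on R * R, which tends to infinity along the same
   filter as the Euclidean norm. *)
Definition plane_infty (R : realType) : set_system (R * R) :=
  filter_from [set: R] (fun M => [set v | M < `|v|]).
Arguments plane_infty : clear implicits.

Global Instance plane_infty_filter (R : realType) :
  ProperFilter (plane_infty R).
Proof.
apply: filter_from_proper.
  apply: filter_fromT_filter; first by exists 0.
  move=> M N; exists (Num.max M N) => v /=.
  by rewrite gt_max => /andP[].
move=> M _; exists (`|M| + 1, 0) => /=.
rewrite prod_normE/= normr0 lt_max; apply/orP; left.
by rewrite ger0_norm ?addr_ge0// (le_lt_trans (ler_norm M))// ltrDl.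
Qed.

Section Actions.
Context {R : realType} {d : measure_display} {X : measurableType d}.
Variables (mu : probability X R) (T : R * R -> X -> X).

Definition measure_preserving_action : Prop :=
  [/\ forall x, T 0 x = x,
      forall v w x, T (v + w) x = T v (T w x),
      measurable_fun [set: (R * R) * X] (fun p => T p.1 p.2) &
      forall v (E : set X), measurable E -> mu (T v @^-1` E) = mu E].

Definition mixing : Prop :=
  forall f g : X -> R, f \in Lfun mu 2%:E -> g \in Lfun mu 2%:E ->
    (\int[mu]_x (f x * g (T v x))) @[v --> plane_infty R] -->
      (\int[mu]_x f x) * (\int[mu]_x g x).

(* The values of phi outside D, a set of full measure, are irrelevant. *)
Definition factor_map_to_tilings (Ts : set (tile R)) (D : set X)
    (phi : X -> configuration R) : Prop :=
  [/\ measurable D, mu (~` D) = 0%E, measurable_fun D phi,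
      forall x, D x -> tiling_space Ts (phi x) &
      {ae mu, forall x, forall v,
        D (T v x) /\ phi (T v x) = shift v (phi x)}].

Definition tileable (Ts : set (tile R)) : Prop :=
  exists (D : set X) (phi : X -> configuration R),
    factor_map_to_tilings Ts D phi.

End Actions.

(* Main.v *)
(** Put [a = width A = height B] and [b = height A = width B].  Two bi-infinite
    sequences of bits, with partial sums [L] and [K], determine a tiling: the
    tile A number [(i, j)] has its corner at [(i a - K_j b, j b + L_i a)], and a
    tile B fills the hole at its upper right corner when the [i]-th bit of the
    first sequence and the [j]-th bit of the second one are both set.  The bits
    are tossed fairly and the origin is chosen with Lebesgue measure; translations
    then commute with the measure preserving action of [Z^2] that renumbers the
    tiles, and they act on the quotient, where one tile contains the origin.

    Mixing: let [F] be an invariant event depending on the bits with index at most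
    [M] of the tile containing the origin.  For a large vector [v], the tile
    containing [v] has, by anticoncentration of the walks, both indices large with
    high probability, so exchanging two bits with indices of the same sign does not
    change the configuration near [v], up to renumbering.  Averaging over many
    exchanges, the flow preimage of [F] under [v] decorrelates from each fixed bit.
    Renumbering by one tile moves the origin by [(a, a e)] or [(- b e, b)], where
    [e] is a single bit; decorrelation makes both values of [e] admissible, so the
    distribution of the origin conditioned on the preimage of [F] is asymptotically
    invariant under [(Z a + Z b)^2], which is dense, hence asymptotically uniform. *)

Require Import Defs.
From mathcomp Require Import all_boot all_order all_algebra.
From mathcomp Require Import all_classical all_reals all_analysis.
From mathcomp Require Import measurable_realfun.
From mathcomp Require Import ring lra zify.
From HB Require Import structures.

Set Implicit Arguments.
Unset Strict Implicit.
Unset Printing Implicit Defensive.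

Import Order.TTheory GRing.Theory Num.Theory.
Import numFieldNormedType.Exports.

Local Open Scope classical_set_scope.
Local Open Scope ring_scope.

(** * Fair coin tossing *)

(** The obstacle is that the configuration near [v] depends, through the walks, on all the bits
    between the origin and [v], so that no fixed bit is independent of the flow preimage of [F]. But
    these bits enter only through their sums. Exchanging one bit with [n ^ 2] fresh ones in turn
    replaces it by an average of pairwise independent coins, and such an average has correlation of
    order [1 / n] with any event whatever, by a second moment bound; nothing else about the preimage
    has to be known. The limiting density of the preimage is not computed directly. For every set
    [E] of finite mass, the mass of the part of [E] sent into [F] is shown to be asymptotically
    [mass E] times the corresponding mass for a unit box. For the fundamental domain that mass does
    not depend on [v] at all, because [F] and the measure are invariant; comparing [E] with the
    domain eliminates the unknown factor. *)

Definition coordinate_events (I : Type) : set (set (I -> bool)) :=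
  [set E | exists p, E = [set w : I -> bool | w p]].

Definition bits (I : Type) := g_sigma_algebraType (@coordinate_events I).

Definition cylinder (I : eqType) (W : seq I) (e : I -> bool) : set (bits I) :=
  [set w : I -> bool | {in W, w =1 e}].

Section BitsMeasurable.
Context {I : eqType}.

Lemma measurable_coordinate (p : I) (c : bool) :
  measurable ([set w | w p = c] : set (bits I)).
Proof.
have mt : measurable ([set w | w p = true] : set (bits I)).
  by apply: sub_sigma_algebra; exists p.
case: c => //; rewrite (_ : [set w | _] = ~` [set w : bits I | w p = true]).
  exact: measurableC.
by apply/seteqP; split=> w /=; case: (w p).
Qed.

Lemma measurable_cylinder (W : seq I) e : measurable (cylinder W e).
Proof.
elim: W => [|p W IH].
  by rewrite (_ : cylinder _ _ = setT)//; apply/seteqP; split.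
rewrite (_ : cylinder _ _ = [set w : bits I | w p = e p] `&` cylinder W e).
  by apply: measurableI => //; exact: measurable_coordinate.
apply/seteqP; split=> w /=.
  by move=> h; split=> [|q qW]; apply: h; rewrite inE ?eqxx ?qW ?orbT.
by move=> [h1 h2] q; rewrite inE => /orP[/eqP->//|]; exact: h2.
Qed.

Lemma measurable_fun_bits d (T : measurableType d) (D : set T)
    (f : T -> bits I) :
  (forall p, measurable (D `&` [set x | f x p])) -> measurable_fun D f.
Proof.
move=> mf; apply: (measurability (@coordinate_events I : set (set (bits I)))) => //.
by move=> _ [_ [p ->] <-]; exact: mf.
Qed.

(** The empty set is adjoined because two cylinders with conflicting values do not meet; the family
    is then a pi-system. *)
Definition cylinders : set (set (bits I)) :=
  [set E | E = set0 \/ exists W e, uniq W /\ E = cylinder W e].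

Lemma cylinders_setI : setI_closed cylinders.
Proof.
move=> A B [->|[W [e [uW ->]]]]; first by rewrite set0I; left.
move=> [->|[W' [e' [uW' ->]]]]; first by rewrite setI0; left.
have [h|h] := pselect ({in W & W', forall p q, p = q -> e p = e' q}); last first.
  left; apply/seteqP; split=> // w [/= h1 h2]; apply: h => p q pW qW pq.
  by rewrite -h1// pq h2.
right; exists (undup (W ++ W')), (fun p => if p \in W then e p else e' p).
split; first exact: undup_uniq.
apply/seteqP; split=> w /=.
  move=> [h1 h2] p; rewrite mem_undup mem_cat; case: ifPn => [pW _|_ /= pW'].
    exact: h1.
  exact: h2.
move=> hw; split=> p pW.
  by rewrite hw ?mem_undup ?mem_cat ?pW.
rewrite hw ?mem_undup ?mem_cat ?pW ?orbT//; case: ifPn => // pW1.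
exact: h.
Qed.

Lemma measurable_cylinders : @measurable _ (bits I) = <<s cylinders >>.
Proof.
apply/seteqP; split.
  apply: smallest_sub; first exact: smallest_sigma_algebra.
  move=> _ [p ->]; apply: sub_sigma_algebra; right.
  exists [:: p], (fun=> true); split=> //; apply/seteqP; split=> w /=.
    by move=> wp q; rewrite inE => /eqP ->.
  by move=> ->//; rewrite inE.
apply: smallest_sub; first exact: sigma_algebra_measurable.
by move=> _ [->|[W [e [_ ->]]]] //; exact: measurable_cylinder.
Qed.

End BitsMeasurable.

(** * Binary digits of a uniform point as independent fair coins *)

Section BinaryDigits.
Context {R : realType}.

(** For [x] in [0, 1) this is the binary digit of weight [2 ^- n.+1]. Negative reals are truncated
    to 0, so all their digits are false. *)
Definition digit (n : nat) (x : R) : bool := odd (Num.truncn (x * 2 ^+ n.+1)).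

Lemma measurable_digit n : measurable [set x | digit n x].
Proof.
rewrite (_ : [set x | _] =
  \bigcup_(k in [set k | odd k])
     `[k%:R / 2 ^+ n.+1, k.+1%:R / 2 ^+ n.+1[%classic).
  by apply: bigcup_measurable => k _; exact: measurable_itv.
have p0 : 0 < 2 ^+ n.+1 :> R by rewrite exprn_gt0.
apply/seteqP; split=> x /=.
  rewrite /digit => ox.
  have x0 : 0 <= x * 2 ^+ n.+1.
    case: (leP 0 (x * 2 ^+ n.+1)) => // xn; move: ox.
    by have [->] : Num.truncn (x * 2 ^+ n.+1) = 0%N by apply/truncn0Pn; rewrite -ltNge (lt_trans xn).
  exists (Num.truncn (x * 2 ^+ n.+1)) => //=.
  have /andP[h1 h2] := truncn_itv x0.
  by rewrite in_itv/= ler_pdivrMr// h1 /= ltr_pdivlMr.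
move=> [k /= ok]; rewrite in_itv/= ler_pdivrMr// ltr_pdivlMr// => h.
by rewrite /digit (truncn_def h).
Qed.

(** The rank, among the dyadic intervals of length [2 ^- n], of the one on which the first [n]
    digits are those of [e], the most significant first. *)
Fixpoint prefix_value (e : nat -> bool) (n : nat) : nat :=
  if n is n'.+1 then (prefix_value e n' * 2 + e n')%N else 0.

Lemma prefix_value_lt e n : (prefix_value e n < 2 ^ n)%N.
Proof. by elim: n => // n IH; rewrite /= expnSr; case: (e n); lia. Qed.

(** One more digit doubles the truncation and adds that digit, so prescribing a prefix amounts to
    choosing a dyadic interval. *)
Lemma digit_prefixP (e : nat -> bool) N (x : R) : 0 <= x < 1 ->
  (forall n, (n < N)%N -> digit n x = e n) <->
  Num.truncn (x * 2 ^+ N) = prefix_value e N.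
Proof.
move=> /andP[x0 x1]; elim: N => [|N IH].
  split=> // _; rewrite /= expr0 mulr1; apply: truncn_def.
  by rewrite x0 x1.
set t := Num.truncn (x * 2 ^+ N); set t' := Num.truncn (x * 2 ^+ N.+1).
have y0 : 0 <= x * 2 ^+ N by rewrite mulr_ge0// exprn_ge0.
have y0' : 0 <= x * 2 ^+ N.+1 by rewrite mulr_ge0// exprn_ge0.
have /andP[t1 t2] := truncn_itv y0.
have /andP[t1' t2'] := truncn_itv y0'.
rewrite -/t -/t' in t1 t2 t1' t2'.
have E : x * 2 ^+ N.+1 = (x * 2 ^+ N) * 2 by rewrite exprSr mulrA.
have a1 : (t * 2 <= t')%N.
  rewrite -ltnS -(ltr_nat R); apply: le_lt_trans t2'.
  by rewrite E natrM ler_wpM2r.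
have a2 : (t' < t.+1 * 2)%N.
  rewrite -(ltr_nat R); apply: le_lt_trans t1' _.
  by rewrite E natrM ltr_pM2r.
have tt' : t' = (t * 2 + digit N x)%N.
  rewrite /digit -/t'; have [->|->] : t' = (t * 2)%N \/ t' = (t * 2).+1 by lia.
    by rewrite oddM andbF addn0.
  by rewrite /= oddM andbF /= addn1.
rewrite tt' /=; split.
  move=> h; rewrite h//; congr (_ * _ + _)%N.
  by apply/IH => n nN; apply: h; rewrite ltnS ltnW.
move=> h.
have [h1 h2] : t = prefix_value e N /\ digit N x = e N.
  by move: h; case: (digit N x); case: (e N) => /=; lia.
by move=> n; rewrite ltnS leq_eqVlt => /orP[/eqP->//|]; exact: (IH.2 h1).
Qed.

(** Induction on the number of digits below [N] left free. With none free the set is a dyadic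
    interval; otherwise a free digit splits it into two sets with one more constraint each. *)
Lemma digit_cylinder_measure (e : nat -> bool) (S : seq nat) : uniq S ->
  lebesgue_measure (`[0, 1[%classic `&` [set x | {in S, forall n, digit n x = e n}])
  = ((2^-1) ^+ size S)%:E :> \bar R.
Proof.
pose N := (\max_(n <- S) n).+1.
have : {in S, forall n, (n < N)%N}.
  by move=> n nS; rewrite ltnS; exact: leq_bigmax_seq.
move: N => N; have [k] := ubnP (N - size S)%N.
elim: k => // k IH in e S *; rewrite ltnS => Sk SN uS.
have sub : {subset S <= iota 0 N} by move=> n /SN; rewrite mem_iota.
have sS : (size S <= N)%N by rewrite -[leqRHS](size_iota 0 N) uniq_leq_size.
have mcyl e' (S' : seq nat) :
    measurable (`[0, 1[%classic `&`
      [set x : R | {in S', forall n, digit n x = e' n}]).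
  apply: measurableI; first exact: measurable_itv.
  rewrite (_ : [set x | _] =
    \bigcap_(n in [set n | n \in S']) [set x | digit n x = e' n]).
    apply: bigcap_measurableType => n _; case: (e' n).
      exact: measurable_digit.
    rewrite (_ : mkset _ = ~` [set x : R | digit n x]).
      by apply: measurableC; exact: measurable_digit.
    by apply/seteqP; split=> x /=; case: digit.
  by apply/seteqP; split=> x /= h n; exact: h.
have [full|nfull] := eqVneq (size S) N.
  have eqS : S =i iota 0 N.
    by apply: (uniq_min_size uS sub _).2; rewrite size_iota full.
  have p0 : 0 < 2 ^+ N :> R by rewrite exprn_gt0.
  set k0 := prefix_value e N.
  have kN : (k0 < 2 ^ N)%N := prefix_value_lt e N.
  rewrite full (_ : _ `&` _ =
      `[k0%:R / 2 ^+ N, k0.+1%:R / 2 ^+ N[%classic); last first.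
    apply/seteqP; split=> x /=; rewrite !in_itv/=.
      move=> [x01 h]; have /digit_prefixP -/(_ e N)[h1 _] := x01.
      have /eqP : Num.truncn (x * 2 ^+ N) = k0.
        by apply: h1 => n nN; apply: h; rewrite eqS mem_iota.
      rewrite truncn_eq ?mulr_ge0 ?exprn_ge0//; last by case/andP: x01.
      by rewrite ler_pdivrMr// ltr_pdivlMr.
    rewrite ler_pdivrMr// ltr_pdivlMr// => h.
    have x01 : 0 <= x < 1.
      case/andP: h => h1 h2; apply/andP; split.
        by rewrite -(pmulr_lge0 _ p0) (le_trans _ h1).
      rewrite -(ltr_pM2r p0) mul1r (lt_le_trans h2)//.
      by rewrite -natrX ler_nat.
    split=> // n; rewrite eqS mem_iota /= => nN.
    by move: n nN; apply/(digit_prefixP _ _ x01); exact: truncn_def.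
  rewrite lebesgue_measure_itv/= lte_fin ltr_pM2r ?invr_gt0// ltr_nat leqnn.
  by rewrite -EFinB -mulrBl -natrB// subSnn mul1r exprVn.
have {sS nfull}sN : (size S < N)%N by rewrite ltn_neqAle nfull.
have [n nN nS] : exists2 n, (n < N)%N & n \notin S.
  apply: contrapT => h; move: sN; rewrite ltnNge => /negP; apply.
  rewrite -[leqLHS](size_iota 0 N) uniq_leq_size ?iota_uniq// => n.
  rewrite mem_iota /= => nN; apply: contrapT => nS; apply: h; exists n => //.
  exact/negP.
pose e' c m := if m == n then c else e m.
have key c : lebesgue_measure (`[0, 1[%classic `&`
    [set x | {in n :: S, forall m, digit m x = e' c m}])
    = ((2^-1) ^+ (size S).+1)%:E :> \bar R.
  rewrite (IH (e' c) (n :: S))//=; first lia.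
    by move=> m; rewrite inE => /orP[/eqP->//|]; exact: SN.
  by rewrite nS.
rewrite (_ : _ `&` _ =
  (`[0, 1[ `&` [set x | {in n :: S, forall m, digit m x = e' true m}]) `|`
  (`[0, 1[ `&` [set x | {in n :: S, forall m, digit m x = e' false m}])); last first.
  rewrite -setIUr; congr (_ `&` _); apply/seteqP; split=> x /=.
    move=> h; case dn : (digit n x); [left|right] => m; rewrite inE /e';
      case: eqVneq => [->//|_ /= mS]; exact: h.
  move=> [] h m mS; rewrite h ?inE ?mS ?orbT// /e'; case: eqVneq => // mn;
    by rewrite -mn mS in nS.
rewrite measureU; [|exact: mcyl|exact: mcyl|]; last first.
  rewrite setIACA setIid; apply/seteqP; split=> // x [_ [/= h1 h2]].
  by have := h1 n (mem_head _ _); rewrite h2 ?mem_head// /e' eqxx.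
transitivity (((2^-1) ^+ (size S).+1)%:E + ((2^-1) ^+ (size S).+1)%:E : \bar R)%E.
  by congr (_ + _)%E; exact: key.
by rewrite -EFinD exprS; congr EFin; lra.
Qed.

End BinaryDigits.

(** * The product measure of fair coins and its symmetries *)

Section CoinMeasure.
Context (R : realType) (I : countType).

Definition digits (x : R) : bits I := fun p => digit (pickle p) x.

Lemma measurable_digits : measurable_fun [set: R] digits.
Proof.
by apply: measurable_fun_bits => p; rewrite setTI; exact: measurable_digit.
Qed.

Let mI01 : measurable (`[0, 1[%classic : set R).
Proof. exact: measurable_itv. Qed.

(** The countable product of fair coins, realised as the law of the binary digits of a uniform
    point, with indices numbered by [pickle]. *)
Definition coin : set (bits I) -> \bar R :=
  pushforward (mrestr (@lebesgue_measure R) mI01) digits.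

Let coin0 : coin set0 = 0%E.
Proof. by rewrite /coin /pushforward preimage_set0 measure0. Qed.

Let coin_ge0 A : (0 <= coin A)%E.
Proof. by rewrite /coin /pushforward measure_ge0. Qed.

Let coin_sigma_additive : semi_sigma_additive coin.
Proof.
move=> F mF tF mUF.
have := @measure_semi_sigma_additive _ _ _
  (measure_function_pushforward__canonical__measure_function_Measure
    (mrestr (@lebesgue_measure R) mI01) measurable_digits) F mF tF mUF.
exact.
Qed.

HB.instance Definition _ :=
  isMeasure.Build _ _ _ coin coin0 coin_ge0 coin_sigma_additive.

Let coin_setT : coin setT = 1%E.
Proof.
rewrite /coin /pushforward /mrestr preimage_setT setTI.
by rewrite lebesgue_measure_itv/= lte_fin ltr01 -EFinB subr0.
Qed.

HB.instance Definition _ := Measure_isProbability.Build _ _ _ coin coin_setT.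

Lemma coin_fin_num (A : set (bits I)) : measurable A -> coin A \is a fin_num.
Proof. by move=> mA; exact: fin_num_measure. Qed.

Lemma coin_cylinder (W : seq I) e : uniq W ->
  coin (cylinder W e) = ((2^-1) ^+ size W)%:E.
Proof.
move=> uW; rewrite /coin /pushforward /mrestr.
rewrite -(size_map pickle W) -(digit_cylinder_measure
  (fun n => if unpickle n is Some p then e p else false)).
  congr lebesgue_measure; apply/seteqP; split=> x /=; rewrite in_itv/=.
    by move=> [h x01]; split=> // _ /mapP[p pW ->]; rewrite pickleK; exact: h.
  by move=> [x01 h]; split=> // p pW; rewrite /digits h ?map_f// pickleK.
by rewrite map_inj_uniq//; exact: (pcan_inj pickleK).
Qed.

Lemma coin_unique (m : {measure set (bits I) -> \bar R}) :
  (forall W e, uniq W -> m (cylinder W e) = ((2^-1) ^+ size W)%:E) ->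
  forall A, measurable A -> coin A = m A.
Proof.
move=> mE; apply: (@measure_unique _ _ _ cylinders (fun=> setT)).
- exact: measurable_cylinders.
- exact: cylinders_setI.
- move=> _; right; exists [::], (fun=> true); split=> //.
  by apply/seteqP; split.
- by apply/seteqP; split=> // x _; exists 0%N.
- move=> A [->|[W [e [uW ->]]]]; first by rewrite !measure0.
  by rewrite mE//; exact: coin_cylinder.
- by move=> _; rewrite [ltLHS]coin_setT ltry.
Qed.

(** One map for every symmetry in use: [f] moves the coordinates (translations, exchanges) and [c]
    marks those that are flipped. *)
Definition relabel (f : I -> I) (c : I -> bool) (w : bits I) : bits I :=
  fun p => w (f p) (+) c p.

Lemma measurable_relabel f c : measurable_fun [set: bits I] (relabel f c).
Proof.
apply: measurable_fun_bits => p; rewrite setTI.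
rewrite (_ : [set x | _] = [set w : bits I | w (f p) = ~~ c p]).
  exact: measurable_coordinate.
by apply/seteqP; split=> w /=; rewrite /relabel; case: (w _); case: (c p).
Qed.

Lemma coin_relabel f c (A : set (bits I)) : injective f -> measurable A ->
  coin (relabel f c @^-1` A) = coin A.
Proof.
move=> fI mA; have mr := measurable_relabel f c.
rewrite [RHS](@coin_unique
  (measure_function_pushforward__canonical__measure_function_Measure
     coin mr))// => W e uW.
(* The preimage of a cylinder over [W] is a cylinder over the image of [W]; injectivity of [f] makes
   its pattern well defined and keeps its size. *)
pose e' q := `[< exists p, f p = q /\ e p (+) c p >].
have e'E p : e' (f p) = e p (+) c p.
  apply/asboolP/idP => [[q [/fI -> //]]|h]; by exists p.
rewrite /= /pushforward -(size_map f W) -(coin_cylinder e'); last first.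
  by rewrite map_inj_uniq.
congr coin; apply/seteqP; split=> w /= h.
  by move=> _ /mapP[p pW ->]; rewrite e'E -h// /relabel -addbA addbb addbF.
by move=> p pW; rewrite /relabel h ?map_f// e'E -addbA addbb addbF.
Qed.

End CoinMeasure.

(** * Size of the largest binomial coefficient *)

Section Binomials.

Lemma leq_bin_central m k : ('C(m.*2, k) <= 'C(m.*2, m))%N.
Proof.
have mono d : (d <= m)%N -> ('C(m.*2, m - d) <= 'C(m.*2, m))%N.
  elim: d => [|d IH] dm; first by rewrite subn0.
  apply: leq_trans (IH (ltnW dm)).
  have := mul_bin_left m.*2 (m - d.+1).
  rewrite (_ : (m - d.+1).+1 = m - d)%N; last by lia.
  move=> E; rewrite -(@leq_pmul2l (m - d)) ?subn_gt0// E leq_mul2r.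
  by apply/orP; right; lia.
have [km|mk] := leqP k m; first by rewrite -(subKn km) mono// leq_subr.
have [k2|k2] := leqP k m.*2; last by rewrite bin_small.
by rewrite -bin_sub// (_ : m.*2 - k = m - (k - m))%N ?mono//; lia.
Qed.

(** Anticoncentration of the binomial law, squared so as to stay in [nat]. The central bound passes
    from [m] to [m.+1] because [(2m+3)(2m+1) <= 4(m+1)^2]; an odd row follows from the even row
    above it by Pascal's rule. *)
Lemma leq_bin_sqr n k : (n * 'C(n, k) ^ 2 <= 4 ^ n)%N.
Proof.
have cent m : (m.*2.+1 * 'C(m.*2, m) ^ 2 <= 16 ^ m)%N.
  elim: m => // m IH.
  have E : (m.+1 * 'C(m.+1.*2, m.+1) = 2 * m.*2.+1 * 'C(m.*2, m))%N.
    have := mul_bin_down m.*2.+1 m; have := mul_bin_diag m.*2.+2 m.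
    rewrite doubleS /= (_ : m.*2.+1 - m = m.+1)%N; last lia.
    nia.
  have : (m.+1 ^ 2 * (m.+1.*2.+1 * 'C(m.+1.*2, m.+1) ^ 2) =
         m.+1.*2.+1 * (2 * m.*2.+1 * 'C(m.*2, m)) ^ 2)%N.
    by rewrite -E expnMn; lia.
  move=> E2; rewrite -(@leq_pmul2l (m.+1 ^ 2)) ?expn_gt0// E2 (expnS 16).
  set c := 'C(m.*2, m) in IH *; set p := (16 ^ m)%N in IH *.
  have h : (m.+1.*2.+1 * (2 * m.*2.+1 * c) ^ 2 =
    (4 * (m.+1.*2.+1 * m.*2.+1)) * (m.*2.+1 * c ^ 2))%N by lia.
  rewrite h; apply: (@leq_trans (4 * (m.+1.*2.+1 * m.*2.+1) * p)%N).
    by rewrite leq_mul2l IH orbT.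
  rewrite [leqRHS]mulnA leq_mul2r; apply/orP; right; rewrite -!muln2; lia.
rewrite -(odd_double_half n); set m := n./2; case: (odd n) => /=.
  rewrite add1n; case: k => [|k].
    rewrite bin0 exp1n expnS; have : (m.*2 < 4 ^ m.*2)%N by apply: ltn_expl.
    lia.
  rewrite binS; have h1 := leq_bin_central m k; have h2 := leq_bin_central m k.+1.
  apply: (@leq_trans (m.*2.+1 * (2 * 'C(m.*2, m)) ^ 2)%N).
    by rewrite leq_mul2l leq_sqr; lia.
  have := cent m; rewrite (_ : 4 ^ m.*2.+1 = 4 * 16 ^ m)%N; last by rewrite expnS -mul2n (expnM 4).
  rewrite expnMn; nia.
rewrite add0n (leq_trans _ (leq_trans (cent m) _))//; last first.
  by rewrite -mul2n expnM.
by rewrite leq_mul// leq_sqr leq_bin_central.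
Qed.

End Binomials.

(** * Number of bits set in a finite window *)

Section CoinCounts.
Context (R : realType) (I : countType).
Local Notation coin := (@coin R I).

Definition flip (p : I) : bits I -> bits I := relabel id (pred1 p).

(** Flipping bit [p] preserves [coin] and exchanges the two halves of an event that does not see
    [p]. *)
Lemma coin_half (p : I) (c : bool) (E : set (bits I)) : measurable E ->
  (forall w, E (flip p w) <-> E w) ->
  coin (E `&` [set w | w p = c]) = ((2^-1)%:E * coin E)%E.
Proof.
move=> mE EF.
have mc c' : measurable (E `&` [set w | w p = c']).
  by apply: measurableI => //; exact: measurable_coordinate.
have sym : coin (E `&` [set w | w p = c]) = coin (E `&` [set w | w p = ~~ c]).
  rewrite -(@coin_relabel R I id (pred1 p) (E `&` [set w | w p = ~~ c]))//.
  congr coin; apply/seteqP; split=> w /= [Ew wp]; split.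
  - exact/EF.
  - by rewrite /relabel wp /= eqxx addbT.
  - exact/EF.
  - by move: wp; rewrite /relabel /= eqxx addbT; case: (w p); case: (c).
have EE : coin E = (coin (E `&` [set w | w p = c]) +
                    coin (E `&` [set w | w p = ~~ c]))%E.
  rewrite -measureU//; last first.
    by rewrite setIACA setIid; apply/seteqP; split=> // w [_ [/= -> /esym]]; case: (c).
  congr coin; rewrite -setIUr; apply/seteqP; split=> [w Ew|w []//].
  by split=> //=; case: (w p) (c) => -[]; [left|right|right|left].
rewrite EE -sym; have := coin_fin_num R (mc c).
case: (coin _) => // r _.
by rewrite -EFinD -EFinM; congr EFin; lra.
Qed.

Definition ones (W : seq I) (w : bits I) : nat := count (fun p => w p) W.

Lemma measurable_ones W k : measurable [set w | ones W w = k].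
Proof.
elim: W k => [|p W IH] k.
  rewrite /ones /=; have [->|k0] := eqVneq k 0%N.
    by rewrite (_ : mkset _ = setT)//; apply/seteqP; split.
  rewrite (_ : mkset _ = set0)//; apply/seteqP; split=> // w /= k0'.
  by rewrite -k0' in k0.
rewrite (_ : mkset _ =
  ([set w | ones W w = k] `&` [set w : bits I | w p = false]) `|`
  ([set w | (ones W w).+1 = k] `&` [set w : bits I | w p = true])).
  apply: measurableU; apply: measurableI; try exact: measurable_coordinate.
    exact: IH.
  case: k => [|k].
    by rewrite (_ : mkset _ = set0)//; apply/seteqP; split.
  by rewrite (_ : mkset _ = [set w | ones W w = k])//; apply/seteqP;
    split => w /= [->].
apply/seteqP; split=> w /=; rewrite /ones /=.
  by case wp : (w p) => /= <-; [right|left].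
by case=> -[<- ->].
Qed.

Lemma ones_flip W p w : p \notin W -> ones W (flip p w) = ones W w.
Proof.
move=> pW; apply: eq_in_count => q qW.
by rewrite /flip /relabel /= (_ : (q == p) = false) ?addbF//;
  apply: contraNF pW => /eqP <-.
Qed.

Lemma coin_ones W k : uniq W ->
  coin [set w | ones W w = k] = (('C(size W, k))%:R / 2 ^+ size W)%:E.
Proof.
elim: W k => [|p W IH] k /=.
  move=> _; rewrite /ones /= bin0n; have [->|k0] := eqVneq k 0%N.
    rewrite (_ : mkset _ = setT); last by apply/seteqP; split.
    by rewrite probability_setT divr1.
  rewrite (_ : mkset _ = set0) ?measure0 ?mul0r//.
  by apply/seteqP; split=> // w /= k0'; rewrite -k0' in k0.
move=> /andP[pW uW].
have half k' c : coin ([set w | ones W w = k'] `&` [set w | w p = c]) =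
    (('C(size W, k'))%:R / 2 ^+ (size W).+1)%:E.
  rewrite coin_half//; last 2 first.
    exact: measurable_ones.
    by move=> w /=; rewrite ones_flip.
  by rewrite IH// -EFinM exprS; congr EFin; field; rewrite expf_neq0.
have mh k' c : measurable ([set w | ones W w = k'] `&` [set w | w p = c]).
  apply: measurableI; first exact: measurable_ones.
  exact: measurable_coordinate.
case: k => [|k].
  have -> : 'C((size W).+1, 0) = 'C(size W, 0) by rewrite !bin0.
  rewrite -(half 0%N false); congr coin.
  apply/seteqP; split=> w /=; rewrite /ones /=; first by case: (w p).
  by move=> [-> ->].
rewrite binS natrD mulrDl EFinD -(half k.+1 false) -(half k true) -measureU//.
  congr coin; apply/seteqP; split=> w /=; rewrite /ones /=.
    by case: (w p) => /=; [right; split=> //; lia|left].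
  by case=> -[-> ->].
by rewrite setIACA; apply/seteqP; split=> // w [_ [/= ->]].
Qed.

Lemma coin_ones_small (eps : R) : 0 < eps -> exists N, forall (W : seq I) k,
  uniq W -> (N <= size W)%N -> (coin [set w | ones W w = k] <= eps%:E)%E.
Proof.
(* By [leq_bin_sqr] every binomial weight is at most the inverse square root of [size W], hence the
   threshold [eps ^- 2]. *)
move=> e0; exists (Num.truncn (eps ^- 2)).+1 => W k uW NW.
have n0 : 0 < (size W)%:R :> R by rewrite ltr0n; lia.
rewrite coin_ones// lee_fin ler_pdivrMr ?exprn_gt0//.
suff : 'C(size W, k)%:R ^+ 2 <= (eps * 2 ^+ size W) ^+ 2.
  by rewrite ler_pXn2r// nnegrE ?mulr_ge0 ?exprn_ge0// ltW.
have := leq_bin_sqr (size W) k.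
rewrite -(ler_nat R) natrM !natrX => h.
have en : 1 <= (size W)%:R * eps ^+ 2.
  rewrite -ler_pdivrMr ?exprn_gt0// div1r ltW// (lt_le_trans (truncnS_gt _))//.
  by rewrite ler_nat.
rewrite -(ler_pM2l n0) (le_trans h)// exprMn mulrA -exprM mulnC exprM.
rewrite (_ : 2 ^+ 2 = 4 :> R); last by rewrite expr2; lra.
by rewrite ler_peMl// exprn_ge0.
Qed.

End CoinCounts.

(** * The two random walks *)

Definition index := (bool * int)%type.

Definition translate (n : int * int) : bits index -> bits index :=
  relabel (fun p : index => (p.1, p.2 + (if p.1 then n.1 else n.2))) (fun=> false).

Definition swap_bits (p q : index) : bits index -> bits index :=
  relabel (fun r : index => if r == p then q else if r == q then p else r)
    (fun=> false).

(** Two-sided partial sums vanishing at 0: for negative [i] the value is minus the number of bits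
    set from [i] to -1, as [Negz n] stands for [- n.+1]. In this form the increment from [i] to
    [i + 1] is bit [i] for every integer [i]. *)
Definition walk (t : bool) (i : int) (w : bits index) : int :=
  match i with
  | Posz n => Posz (ones [seq (t, Posz r) | r <- iota 0 n] w)
  | Negz n => - Posz (ones [seq (t, Negz r) | r <- iota 0 n.+1] w)
  end.

Arguments walk : simpl never.

Section Walks.
Implicit Types (t : bool) (w : bits index) (i j k : int).

Lemma walk0 t w : walk t 0 w = 0.
Proof. by []. Qed.

Lemma walkS t i w : walk t (i + 1) w = walk t i w + (w (t, i) : nat)%:Z.
Proof.
case: i => n.
  rewrite -PoszD addn1 /walk -addn1 iotaD map_cat /ones count_cat /= addn0.
  by rewrite PoszD.
rewrite (_ : Negz n + 1 = - n%:Z); last by rewrite NegzE; lia.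
have -> : walk t (- n%:Z) w = - (ones [seq (t, Negz r) | r <- iota 0 n] w)%:Z.
  by case: n => // n; rewrite -NegzE.
rewrite /walk -[n.+1]addn1 iotaD map_cat /ones count_cat /= addn0 add0n.
lia.
Qed.

Lemma eq_int_walk (f g : int -> int) : f 0 = g 0 ->
  (forall i, f (i + 1) - f i = g (i + 1) - g i) -> f =1 g.
Proof.
move=> fg0 fg; elim/int_ind => // n IH.
  by have := fg n; rewrite -PoszD addn1 => /eqP; rewrite IH; lia.
have := fg (- n.+1%:Z); rewrite (_ : - n.+1%:Z + 1 = - n%:Z); last lia.
by rewrite IH; lia.
Qed.

Lemma walk_translate t i (n : int * int) w :
  walk t ((if t then n.1 else n.2) + i) w =
  walk t (if t then n.1 else n.2) w + walk t i (translate n w).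
Proof.
set m := if t then _ else _; move: i; apply: eq_int_walk.
  by rewrite addr0 walk0 addr0.
move=> i; have E : translate n w (t, i) = w (t, m + i).
  by rewrite /translate /relabel /= addbF addrC.
by rewrite (addrA m i 1) !walkS E; ring.
Qed.

Lemma walk_le t i j w : i <= j -> walk t i w <= walk t j w.
Proof.
move=> ij; have -> : j = i + `|j - i|%N by lia.
elim: `|j - i|%N => [|n IH]; first by rewrite addr0.
rewrite -addn1 PoszD addrA walkS; move: IH.
by move: (walk t i w) (walk t (i + n) w) => x y; case: (w _) => /=; lia.
Qed.

Lemma walk_lipschitz t i j w : i <= j -> walk t j w - walk t i w <= j - i.
Proof.
move=> ij; have -> : j = i + `|j - i|%N by lia.
elim: `|j - i|%N => [|n IH]; first by rewrite addr0 !subrr.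
rewrite -addn1 PoszD addrA walkS; move: IH.
by move: (walk t i w) (walk t (i + n) w) => x y; case: (w _) => /=; lia.
Qed.

Lemma walk_norm t i w : `|walk t i w| <= `|i|.
Proof.
have [i0|i0] := leP 0 i.
  have := walk_le t w i0; have := walk_lipschitz t w i0; rewrite walk0; lia.
have := walk_le t w (ltW i0); have := walk_lipschitz t w (ltW i0).
rewrite walk0; lia.
Qed.

Lemma uniq_walk_support t n :
  uniq [seq (t, Posz r) | r <- iota 0 n] /\ uniq [seq (t, Negz r) | r <- iota 0 n].
Proof.
by split; rewrite map_inj_uniq ?iota_uniq// => x y [].
Qed.

Lemma measurable_walk t i k : measurable [set w | walk t i w = k].
Proof.
case: i => n.
  rewrite (_ : mkset _ =
    [set w | ones [seq (t, Posz r) | r <- iota 0 n] w = `|k|%N] `&`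
      [set _ | 0 <= k]).
    apply: measurableI; first exact: measurable_ones.
    by case: (0 <= k); [rewrite (_ : mkset _ = setT)|rewrite (_ : mkset _ = set0)];
      rewrite //; apply/seteqP; split.
  by apply/seteqP; split=> w; rewrite /mkset /walk /setI /mkset; lia.
rewrite (_ : mkset _ =
  [set w | ones [seq (t, Negz r) | r <- iota 0 n.+1] w = `|k|%N] `&`
    [set _ | k <= 0]).
  apply: measurableI; first exact: measurable_ones.
  by case: (k <= 0); [rewrite (_ : mkset _ = setT)|rewrite (_ : mkset _ = set0)];
    rewrite //; apply/seteqP; split.
by apply/seteqP; split=> w; rewrite /mkset /walk /setI /mkset; lia.
Qed.

Lemma coin_walk_small (R : realType) (eps : R) : 0 < eps ->
  exists N : nat, forall t i k, N%:Z <= `|i| ->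
    (coin R [set w | walk t i w = k] <= eps%:E)%E.
Proof.
move=> /(coin_ones_small index)[N HN]; exists N => t [] n k Nn.
  apply: le_trans (HN [seq (t, Posz r) | r <- iota 0 n] `|k|%N _ _).
  - apply: le_measure; rewrite ?inE; [exact: measurable_walk|exact: measurable_ones|].
    by move=> w <-.
  - exact: (uniq_walk_support t n).1.
  - by rewrite size_map size_iota; lia.
apply: le_trans (HN [seq (t, Negz r) | r <- iota 0 n.+1] `|k|%N _ _).
- apply: le_measure; rewrite ?inE; [exact: measurable_walk|exact: measurable_ones|].
  by move=> w <-; rewrite /= /walk abszN.
- exact: (uniq_walk_support t n.+1).2.
- by rewrite size_map size_iota; lia.
Qed.

End Walks.

(** * Cells indexed by pairs of integers *)

Section Geometry.
Context {R : realType} (a b : R).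
Implicit Types (w : bits index) (i j : int) (n k : int * int) (kind : bool).

Definition corner n w : R * R :=
  (n.1%:~R * a - (walk false n.2 w)%:~R * b,
   n.2%:~R * b + (walk true n.1 w)%:~R * a).

(* [kind] is [false] for a tile A, [true] for a tile B.  The tiles A are indexed
   by all of [int * int]; the tile B with index [n] fills the hole at the upper
   right corner of the tile A with index [n], present when both bits are set. *)
Definition tile_corner kind n w : R * R :=
  if kind then
    ((n.1 + 1)%:~R * a - (walk false (n.2 + 1) w)%:~R * b,
     (n.2 + 1)%:~R * b + (walk true n.1 w)%:~R * a)
  else corner n w.

Definition tile_width kind := if kind then b else a.
Definition tile_height kind := if kind then a else b.

Definition present kind n w : bool :=
  kind ==> (w (true, n.1) && w (false, n.2)).

Definition half_open kind (c : R * R) : set (R * R) :=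
  [set s | c.1 <= s.1 < c.1 + tile_width kind /\
           c.2 <= s.2 < c.2 + tile_height kind].

(** Unlike the tiles, the cells (a tile A with the tile B in its hole, if any) are indexed by all
    pairs of integers, so that renumbering only shifts the indices. Half-open tiles make them an
    exact partition of the plane, without exceptional points. *)
Definition cell n w : set (R * R) :=
  [set s | exists kind, present kind n w /\ half_open kind (tile_corner kind n w) s].

Lemma corner0 w : corner 0 w = 0.
Proof. by rewrite /corner /= !mulr0z !mul0r subrr addr0. Qed.

Lemma walk_translate_true i n w :
  walk true (n.1 + i) w = walk true n.1 w + walk true i (translate n w).
Proof. exact: (walk_translate true). Qed.

Lemma walk_translate_false i n w :
  walk false (n.2 + i) w = walk false n.2 w + walk false i (translate n w).
Proof. exact: (walk_translate false). Qed.

(** Together with [translate_add], this cocycle identity makes [reindex] an action. *)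
Lemma corner_add n k w : corner (n + k) w = corner n w + corner k (translate n w).
Proof.
rewrite /corner /= walk_translate_true walk_translate_false.
by congr (_, _) => /=; rewrite !intrD; ring.
Qed.

Lemma tile_corner_add kind n k w :
  tile_corner kind (n + k) w = corner n w + tile_corner kind k (translate n w).
Proof.
case: kind; last exact: corner_add.
rewrite /tile_corner /corner /= -(addrA n.2) (walk_translate_false (k.2 + 1) n).
rewrite (walk_translate_true k.1 n).
by congr (_, _) => /=; rewrite !intrD; ring.
Qed.

Lemma present_add kind n k w :
  present kind (n + k) w = present kind k (translate n w).
Proof.
by case: kind => //=; rewrite /present /translate /relabel /= !addbF !(addrC n.1)
  !(addrC n.2).
Qed.

Lemma translate0 w : translate 0 w = w.
Proof.
by apply/funext => -[[] x]; rewrite /translate /relabel /= addbF addr0.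
Qed.

Lemma translate_add n k w : translate (n + k) w = translate k (translate n w).
Proof.
apply/funext => -[[] x]; rewrite /translate /relabel /= !addbF.
  by rewrite -addrA (addrC k.1).
by rewrite -addrA (addrC k.2).
Qed.

Lemma cell_add n k w s :
  cell (n + k) w s <-> cell k (translate n w) (s - corner n w).
Proof.
suff E kind : half_open kind (tile_corner kind (n + k) w) s <->
    half_open kind (tile_corner kind k (translate n w)) (s - corner n w).
  by split=> -[kind [p h]]; exists kind; split; rewrite ?present_add// -?present_add//;
    apply/E.
rewrite tile_corner_add; case: (corner n w) => c1 c2.
case: (tile_corner kind k _) => d1 d2; case: s => s1 s2; rewrite /half_open /=.
by split=> -[/andP[? ?] /andP[? ?]]; split; apply/andP; split; lra.
Qed.

(** A discrete intermediate value property that does not ask [g] to be monotone: the first index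
    where [g] exceeds [t] is preceded by a crossing. *)
Lemma int_crossing (g : int -> R) i j (t : R) : i <= j -> g i <= t < g j ->
  exists l, [/\ i <= l, l < j & g l <= t < g (l + 1)].
Proof.
move=> ij /andP[git tgj]; have jE : j = i + `|j - i|%N by lia.
have ex : exists n : nat, t < g (i + n%:Z) by exists `|j - i|%N; rewrite -jE.
case: (ex_minnP ex) => -[|n] tn nmin.
  by move: tn; rewrite addr0 => /(le_lt_trans git); rewrite ltxx.
exists (i + n%:Z); split; first lia.
  by have := nmin `|j - i|%N; rewrite -jE => /(_ tgj); lia.
rewrite -addrA -PoszD addn1 tn andbT leNgt; apply/negP => /nmin; lia.
Qed.

Hypotheses (a0 : 0 < a) (b0 : 0 < b).

Lemma walk_stepR t i w :
  (walk t (i + 1) w)%:~R = (walk t i w)%:~R + (w (t, i))%:R :> R.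
Proof. by rewrite walkS intrD. Qed.

Lemma walk_leR t i j w (c : R) : 0 <= c -> i <= j ->
  (walk t i w)%:~R * c <= (walk t j w)%:~R * c.
Proof. by move=> c0 ij; rewrite ler_wpM2r// ler_int walk_le. Qed.

(** On the vertical line through [s], each row [j] has exactly one tile A, and their lower edges
    increase with [j]. A point between two consecutive edges lies in the lower tile or above it; in
    the latter case the rows are shifted relative to each other, so bit [j] is set, and the first
    walk jumps at some column [l] past the height of [s], so bit [l] is set and the tile B number
    [(l, j)] contains [s]. *)
Lemma cell_cover w s : exists n, cell n w s.
Proof.
pose i_ j := Num.floor ((s.1 + (walk false j w)%:~R * b) / a).
have i_P j : (i_ j)%:~R * a - (walk false j w)%:~R * b <= s.1 <
    (i_ j + 1)%:~R * a - (walk false j w)%:~R * b.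
  have /andP[h1 h2] := floor_itv ((s.1 + (walk false j w)%:~R * b) / a).
  rewrite -/(i_ j) ler_pdivlMr// in h1; rewrite -/(i_ j) ltr_pdivrMr// in h2.
  by apply/andP; split; lra.
have i_le j : i_ j <= i_ (j + 1).
  rewrite le_floor// ler_pM2r ?invr_gt0// lerD2l walk_leR ?ltW//; lia.
(* [i_ j] is the column of the tile A of row [j] met by the vertical line through [s], and [y j] is
   the height of its lower edge. *)
pose y j := j%:~R * b + (walk true (i_ j) w)%:~R * a.
have yS j : y j + b <= y (j + 1).
  have := walk_leR true w (ltW a0) (i_le j); rewrite /y intrD; lra.
have yn j (n : nat) : y j + n%:R * b <= y (j + n%:Z).
  elim: n => [|n IH]; first by rewrite mul0r !addr0.
  have := yS (j + n%:Z); rewrite -(addrA j n%:Z 1) -PoszD addn1 -natr1; lra.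
have [N1 hN1] : exists N1 : nat, y (- N1%:Z) <= s.2.
  exists (Num.truncn ((y 0 - s.2) / b)).+1; set N := _.+1.
  have := yn (- N%:Z) N; rewrite addNr => h.
  suff : (y 0 - s.2) / b < N%:R by rewrite ltr_pdivrMr//; lra.
  exact: truncnS_gt.
have [N2 hN2] : exists N2 : nat, s.2 < y N2%:Z.
  exists (Num.truncn ((s.2 - y 0) / b)).+1; set N := _.+1.
  have := yn 0 N; rewrite add0r => h.
  suff : (s.2 - y 0) / b < N%:R by rewrite ltr_pdivrMr//; lra.
  exact: truncnS_gt.
have [j [_ _ /andP[yj1 yj2]]] : exists j, [/\ - N1%:Z <= j, j < N2 & y j <= s.2 < y (j + 1)].
  by apply: int_crossing; [lia|rewrite hN1 hN2].
have /andP[x1 x2] := i_P j; have /andP[x1' x2'] := i_P (j + 1).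
have [sA|sB] := ltP s.2 (y j + b).
  exists (i_ j, j), false; split=> //; rewrite /half_open /= /y in yj1 sA *.
  by rewrite intrD in x2; split; apply/andP; split; lra.
have [l [il li /andP[l1 l2]]] : exists l, [/\ i_ j <= l, l < i_ (j + 1) &
    (walk true l w)%:~R * a <= s.2 - (j + 1)%:~R * b < (walk true (l + 1) w)%:~R * a].
  apply: int_crossing; first exact: i_le.
  by rewrite /y in yj2 sB; apply/andP; split; rewrite ?intrD; rewrite ?intrD in yj2; lra.
have wl : w (true, l).
  apply: contraLR isT => /negbTE wl; move: l2.
  by rewrite walk_stepR wl addr0 => /(le_lt_trans l1); rewrite ltxx.
(* Without this bit the two rows would be aligned and no column would lie between [i_ j] and
   [i_ (j + 1)]. *)
have wj : w (false, j).
  apply: contraLR isT => /negbTE wj; move: li.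
  rewrite /i_ walk_stepR wj addr0 -/(i_ j) => /(le_lt_trans il); by rewrite ltxx.
exists (l, j), true; split; first by rewrite /present /= wl wj.
rewrite /half_open /tile_width /tile_height /= walk_stepR wj /=.
rewrite walk_stepR wl /= in l2.
have lj : (l + 1)%:~R * a <= (i_ (j + 1))%:~R * a.
  by rewrite ler_pM2r// ler_int lezD1.
have ij : (i_ j + 1)%:~R * a <= (l + 1)%:~R * a.
  by rewrite ler_pM2r// ler_int lerD2r.
rewrite walk_stepR wj /= in x1'.
by split; apply/andP; split; lra.
Qed.

Definition separated kind (c : R * R) kind' (c' : R * R) : Prop :=
  c.1 + tile_width kind <= c'.1 \/ c'.1 + tile_width kind' <= c.1 \/
  c.2 + tile_height kind <= c'.2 \/ c'.2 + tile_height kind' <= c.2.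

(** If both indices increase strictly from one tile to the other, monotonicity of the first walk
    puts the second tile above; if they vary strictly in opposite senses, the second walk separates
    the tiles horizontally. The bits required by a tile B provide the unit jumps of the walks that
    make room for it. Ties are settled case by case. *)
Lemma tiles_separated kind n kind' n' w :
  present kind n w -> present kind' n' w -> (kind, n) <> (kind', n') ->
  separated kind (tile_corner kind n w) kind' (tile_corner kind' n' w).
Proof.
move: n n' => [i j] [i' j'].
have facts t (c c' : R) (x x' : int) : 0 < c -> 0 < c' -> x + 1 <= x' ->
    [/\ x%:~R * c + c <= x'%:~R * c,
      (walk t x w)%:~R * c' <= (walk t x' w)%:~R * c',
      ((walk t x w)%:~R + (w (t, x))%:R) * c' <= (walk t x' w)%:~R * c' &
      (walk t x' w)%:~R * c' <= ((walk t x' w)%:~R + (w (t, x'))%:R) * c'].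
  move=> c0 c'0 xx'; split.
  - have -> : x%:~R * c + c = (x + 1)%:~R * c by rewrite intrD mulrDl mul1r.
    by rewrite ler_pM2r// ler_int.
  - by apply: walk_leR; [exact: ltW|rewrite (le_trans _ xx')// lerDl].
  - by rewrite -walk_stepR; apply: walk_leR => //; exact: ltW.
  - by rewrite ler_pM2r// lerDl.
have one (c : bool) : c -> (c : nat)%:R * a = a /\ (c : nat)%:R * b = b.
  by move=> ->; rewrite !mul1r.
have tri (x x' : int) : [\/ x = x', x + 1 <= x' | x' + 1 <= x].
  by case: (ltgtP x x') => h; [constructor 2|constructor 3|constructor 1];
    rewrite ?lezD1.
rewrite /separated /tile_corner /tile_width /tile_height /present /corner.
case: (tri i i') => [<-|hi|hi]; case: (tri j j') => [<-|hj|hj];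
  try (have [? ? ? ?] := facts true _ _ _ _ a0 a0 hi);
  try (have [? ? ? ?] := facts false _ _ _ _ b0 b0 hj);
  case: kind; case: kind' => //=; rewrite ?walk_stepR;
  move=> p p' neq;
  try (case/andP: p => /one[? ?] /one[? ?]);
  try (case/andP: p' => /one[? ?] /one[? ?]); rewrite ?intrD ?mulr1z;
  first [by left; lra|by right; left; lra|by right; right; left; lra
        |by right; right; right; lra|by case: neq].
Qed.

Lemma cell_unique n n' w s : cell n w s -> cell n' w s -> n = n'.
Proof.
move=> [k [pk [/andP[h1 h2] /andP[h3 h4]]]] [k' [pk' [/andP[g1 g2] /andP[g3 g4]]]].
apply: contrapT => nn'.
have : (k, n) <> (k', n') by case.
move=> /(tiles_separated pk pk'); rewrite /separated.
by case=> [|[|[|]]] h; lra.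
Qed.

End Geometry.

(** * The invariant measure *)

Section LebesgueTranslation.
Context {R : realType}.

(* [lebesgue_measure] lives on the alias [measurableTypeR R], whose display
   differs from that of [R]. *)
Definition line_measure : set R -> \bar R := lebesgue_measure.

Let line_measure0 : line_measure set0 = 0%E.
Proof. exact: (@measure0 _ _ _ (@lebesgue_measure R)). Qed.

Let line_measure_ge0 A : (0 <= line_measure A)%E.
Proof. exact: (@measure_ge0 _ _ _ (@lebesgue_measure R)). Qed.

Let line_measure_sigma_additive : semi_sigma_additive line_measure.
Proof. exact: (@measure_semi_sigma_additive _ _ _ (@lebesgue_measure R)). Qed.

HB.instance Definition _ := isMeasure.Build _ _ _ line_measure
  line_measure0 line_measure_ge0 line_measure_sigma_additive.

Let line_measure_sigma_finite : sigma_finite setT line_measure.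
Proof. exact: (@sigma_finiteT _ _ _ (@lebesgue_measure R)). Qed.

HB.instance Definition _ := Measure_isSigmaFinite.Build _ _ _ line_measure
  line_measure_sigma_finite.

Lemma line_measure_translate (c : R) (A : set R) : measurable A ->
  line_measure ((fun x => x + c) @^-1` A) = line_measure A.
Proof.
move=> mA; have mf : measurable_fun [set: measurableTypeR R]
    (fun x => x + c : measurableTypeR R).
  exact: measurable_funD.
apply/esym/(@lebesgue_measure_unique _
  (measure_function_pushforward__canonical__measure_function_Measure
    lebesgue_measure mf)) => //.
move=> _ [[x y]] _ <-; rewrite /= /pushforward.
rewrite (_ : _ @^-1` _ = `]x - c, y - c]%classic); last first.
  by apply/seteqP; split=> z /=; rewrite !in_itv/= ltrBlDr lerBrDr.
by rewrite !lebesgue_measure_itv/= !lte_fin ltrD2r -!EFinB; case: ifP => // _;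
  congr EFin; lra.
Qed.

Definition plane_measure := (line_measure \x line_measure)%E.

HB.instance Definition _ := Measure.on plane_measure.

Definition rectangle (x y u v : R) : set (R * R) :=
  `[x, x + u[%classic `*` `[y, y + v[%classic.

Lemma measurable_rectangle x y u v : measurable (rectangle x y u v).
Proof. by apply: measurableX; exact: measurable_itv. Qed.

Lemma plane_measure_rectangle x y u v : 0 <= u -> 0 <= v ->
  plane_measure (rectangle x y u v) = (u * v)%:E.
Proof.
move=> u0 v0; rewrite [LHS]product_measure1E; try exact: measurable_itv.
have E z t : 0 <= t -> line_measure `[z, z + t[%classic = t%:E.
  move=> t0; rewrite /line_measure lebesgue_measure_itv/= lte_fin ltrDl.
  case: ifPn => [_|]; first by rewrite -EFinB; congr EFin; lra.
  by rewrite -leNgt => t0'; congr EFin; lra.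
by rewrite EFinM; congr (_ * _)%E; exact: E.
Qed.

Let plane_measure_sigma_finite : sigma_finite setT plane_measure.
Proof.
exists (fun n : nat => rectangle (- n%:R) (- n%:R) (n%:R + n%:R) (n%:R + n%:R)).
  apply/seteqP; split=> // -[x y] _.
  exists (Num.truncn (`|x| + `|y|)).+1 => //.
  have h := truncnS_gt (`|x| + `|y|).
  rewrite /rectangle /= !in_itv/=.
  have := ler_norm x; have := ler_norm y; have := ler_norm (- x).
  have := ler_norm (- y); have := normr_ge0 x; have := normr_ge0 y.
  rewrite !normrN => *; split; apply/andP; split; lra.
move=> n; split; first exact: measurable_rectangle.
by rewrite plane_measure_rectangle ?ltry// addr_ge0.
Qed.

HB.instance Definition _ := Measure_isSigmaFinite.Build _ _ _ plane_measure
  plane_measure_sigma_finite.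

Lemma measurable_translation (v : R * R) :
  measurable_fun [set: R * R] (fun s : R * R => s + v).
Proof.
apply: measurable_fun_pair.
  by apply: measurable_funD => //; exact: measurable_fst.
by apply: measurable_funD => //; exact: measurable_snd.
Qed.

Lemma plane_measure_translate (v : R * R) (A : set (R * R)) : measurable A ->
  plane_measure ((fun s => s + v) @^-1` A) = plane_measure A.
Proof.
move=> mA; apply/esym.
apply: (@product_measure_unique _ _ _ _ _ line_measure line_measure
  (measure_function_pushforward__canonical__measure_function_Measure
     plane_measure (measurable_translation v))) => // B C mB mC.
rewrite /= /pushforward.
rewrite (_ : _ @^-1` _ =
  ((fun x => x + v.1) @^-1` B) `*` ((fun x => x + v.2) @^-1` C))//.
have mtr (c : R) (A' : set R) : measurable A' ->
    measurable ((fun x => x + c) @^-1` A').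
  move=> mA'; rewrite -[X in measurable X]setTI.
  have mf : measurable_fun [set: R] (fun x : R => x + c) by exact: measurable_funD.
  exact: mf.
rewrite [LHS]product_measure1E; try exact: mtr.
by congr (_ * _)%E; exact: line_measure_translate.
Qed.

End LebesgueTranslation.
Arguments plane_measure : clear implicits.

(** * States and skew products *)

Section StateSpace.
Context {R : realType}.

Definition state := (bits index * (R * R))%type.

Definition state_measure := (@coin R index \x plane_measure R)%E.

HB.instance Definition _ := Measure.on state_measure.

Lemma state_measure_box (C : set (bits index)) (S : set (R * R)) :
  measurable C -> measurable S ->
  state_measure (C `*` S) = (@coin R index C * plane_measure R S)%E.
Proof. exact: product_measure1E. Qed.

Lemma state_measure_rectangle (C : set (bits index)) x y u v :
  measurable C -> 0 <= u -> 0 <= v ->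
  state_measure (C `*` rectangle x y u v) = (@coin R index C * (u * v)%:E)%E.
Proof.
move=> mC u0 v0; rewrite state_measure_box ?plane_measure_rectangle//.
exact: measurable_rectangle.
Qed.

(** Renumberings, translations and exchanges all act on the bits and move the origin by a vector
    depending on the bits alone, so one Fubini argument shows that they preserve the measure. *)
Definition skew (f : bits index -> bits index) (c : bits index -> R * R)
  (z : state) : state := (f z.1, z.2 + c z.1).

Lemma measurable_skew f c : measurable_fun setT f -> measurable_fun setT c ->
  measurable_fun setT (skew f c).
Proof.
move=> mf mc; apply: measurable_fun_pair; first exact: measurableT_comp.
have mc1 : measurable_fun setT (c \o fst : state -> R * R).
  exact: measurableT_comp.
apply: measurable_fun_pair; apply: measurable_funD;
  do ?[exact: (measurableT_comp measurable_fst)|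
       exact: (measurableT_comp measurable_snd)].
Qed.

Lemma state_measure_skew f c (E : set state) :
  measurable_fun setT f -> measurable_fun setT c ->
  (forall A, measurable A -> @coin R index (f @^-1` A) = @coin R index A) ->
  measurable E -> state_measure (skew f c @^-1` E) = state_measure E.
Proof.
move=> mf mc fP mE; rewrite /state_measure /product_measure1.
transitivity (\int[@coin R index]_w
  ((plane_measure R \o xsection E) \o f) w)%E.
  apply: eq_integral => w _ /=.
  rewrite -(@plane_measure_translate _ (c w) (xsection E (f w))); last first.
    exact: measurable_xsection.
  by congr plane_measure; apply/seteqP; split=> s; rewrite /xsection /= !inE => h;
    exact: h.
have mx : measurable_fun setT (plane_measure R \o xsection E).
  exact: measurable_fun_xsection.
have <- := @ge0_integral_pushforward _ _ _ _ _ _ mf (@coin R index) setT _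
  measurableT mx (fun w _ => measure_ge0 _ _).
apply: eq_measure_integral => A mA _; exact: fP.
Qed.

End StateSpace.
Arguments state : clear implicits.
Arguments state_measure : clear implicits.

(** * The quotient by the lattice of tile indices *)

(** This serves to compare two fundamental domains piece by piece. The families are extended by
    empty sets along [pickle_inv] to reduce to indices in [nat]. *)
Lemma measure_bigcup_eq d (T : measurableType d) (R : realType)
    (m : {measure set T -> \bar R}) (I : countType) (A B : I -> set T) :
  (forall i, measurable (A i)) -> (forall i, measurable (B i)) ->
  trivIset setT A -> trivIset setT B -> (forall i, m (A i) = m (B i)) ->
  m (\bigcup_i A i) = m (\bigcup_i B i).
Proof.
move=> mA mB tA tB AB.
pose ext (C : I -> set T) k := if pickle_inv k is Some i then C i else set0.
have extU C : \bigcup_i C i = \bigcup_k ext C k.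
  apply/seteqP; split=> x [i _ Cx].
    by exists (pickle i) => //; rewrite /ext pickleK_inv.
  by move: Cx; rewrite /ext; case: (pickle_inv i) => // j Cx; exists j.
have extT C : trivIset setT C -> trivIset setT (ext C).
  move=> tC k l _ _ [x []]; rewrite /ext.
  case ek : (pickle_inv k) => [i|//]; case el : (pickle_inv l) => [j|//] Ci Cj.
  have ij : i = j by apply: tC => //; exists x.
  have := @pickle_invK I k; have := @pickle_invK I l.
  by rewrite ek el ij /= => -> ->.
have extM C : (forall i, measurable (C i)) -> forall k, measurable (ext C k).
  by move=> mC k; rewrite /ext; case: (pickle_inv k).
rewrite !extU !measure_bigcup; try (exact: extT); try (by move=> k _; exact: extM).
by apply: eq_eseriesr => k _; rewrite /ext; case: (pickle_inv k).
Qed.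

Section Action.
Context {R : realType} (a b : R).
Local Notation state := (state R).
Local Notation state_measure := (state_measure R).
Local Notation corner := (corner a b).
Local Notation cell := (cell a b).

(** The second component of a state is the position of the origin relative to the corner of the tile
    A number 0. Giving number 0 to the tile [n] therefore subtracts [corner n]. *)
Definition reindex (n : int * int) : state -> state :=
  skew (translate n) (fun w => - corner n w).

Definition flow (v : R * R) : state -> state := skew id (cst v).

Definition swap_state (p q : index) : state -> state := skew (swap_bits p q) (cst 0).

Lemma measurable_walkR t i : measurable_fun setT (fun w => (walk t i w)%:~R : R).
Proof.
move=> _ Y mY; rewrite setTI.
rewrite (_ : _ @^-1` Y = \bigcup_(k : int) ([set w | walk t i w = k] `&`
    [set _ | k%:~R \in Y])).
  apply: countable_bigcupT_measurable => // k.
  apply: measurableI; first exact: measurable_walk.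
  by case: (k%:~R \in Y); [rewrite (_ : mkset _ = setT)|rewrite (_ : mkset _ = set0)];
    rewrite //; apply/seteqP; split.
apply/seteqP; split=> w /=; first by exists (walk t i w) => //; split=> //=; rewrite inE.
by move=> [k _ [/= -> /[!inE]]].
Qed.

Lemma measurable_corner n : measurable_fun setT (corner n).
Proof.
have mM t i (c : R) : measurable_fun setT (fun w => (walk t i w)%:~R * c : R).
  by apply: measurable_funM => //; exact: measurable_walkR.
apply: measurable_fun_pair; last by apply: measurable_funD.
by apply: measurable_funB.
Qed.

Lemma measurable_tile_corner kind n : measurable_fun setT (tile_corner a b kind n).
Proof.
case: kind; last exact: measurable_corner.
have mM t i (c : R) : measurable_fun setT (fun w => (walk t i w)%:~R * c : R).
  by apply: measurable_funM => //; exact: measurable_walkR.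
apply: measurable_fun_pair; last by apply: measurable_funD.
by apply: measurable_funB.
Qed.

Lemma measurable_present kind n : measurable [set w : bits index | present kind n w].
Proof.
rewrite /present; case: kind => /=; last first.
  by rewrite (_ : mkset _ = setT)//; apply/seteqP; split.
rewrite (_ : mkset _ = [set w : bits index | w (true, n.1) = true] `&`
   [set w : bits index | w (false, n.2) = true]).
  by apply: measurableI; exact: measurable_coordinate.
by apply/seteqP; split=> w /= => [/andP[]|[-> ->]].
Qed.

Lemma measurable_oppR2 (c : bits index -> R * R) :
  measurable_fun setT c -> measurable_fun setT (fun w => - c w).
Proof.
move=> mc; apply: measurable_fun_pair; apply: measurableT_comp => //.
  exact: (measurableT_comp measurable_fst).
exact: (measurableT_comp measurable_snd).
Qed.

Lemma measurable_relative_position (c : bits index -> R * R) (U : set (R * R)) :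
  measurable_fun setT c -> measurable U ->
  measurable [set z : state | U (z.2 - c z.1)].
Proof.
move=> mc mU.
have := @measurable_skew _ id _ (@measurable_id _ _ _) (measurable_oppR2 mc).
by move=> /(_ measurableT (setT `*` U) (measurableX measurableT mU));
  rewrite setTI; congr measurable; apply/seteqP; split=> z //= [].
Qed.

Lemma measurable_translate n : measurable_fun setT (translate n).
Proof. exact: measurable_relabel. Qed.

Lemma coin_translate n (A : set (bits index)) : measurable A ->
  coin R (translate n @^-1` A) = coin R A.
Proof.
by move=> mA; apply: coin_relabel => // -[[] x] [[] y] [] // /addIr ->.
Qed.

Lemma coin_swap p q (A : set (bits index)) : measurable A ->
  coin R (swap_bits p q @^-1` A) = coin R A.
Proof.
move=> mA; apply: coin_relabel => // x y.
case: (eqVneq x p) => [->|xp]; case: (eqVneq y p) => [->|yp] //.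
- by case: (eqVneq y q) => [->//|yq] E; rewrite E eqxx in yq.
- by case: (eqVneq x q) => [->//|xq] E; rewrite E eqxx in xq.
case: (eqVneq x q) => [->|xq]; case: (eqVneq y q) => [->|yq] // E.
- by rewrite E eqxx in yp.
- by rewrite E eqxx in xp.
Qed.

Lemma measurable_reindex n : measurable_fun setT (reindex n).
Proof.
apply: measurable_skew; first exact: measurable_translate.
by apply: measurable_oppR2; exact: measurable_corner.
Qed.

Lemma measurable_flow v : measurable_fun setT (flow v).
Proof. exact: measurable_skew. Qed.

Lemma measurable_swap_state p q : measurable_fun setT (swap_state p q).
Proof. by apply: measurable_skew => //; exact: measurable_relabel. Qed.

Lemma preimage_measurable (f : state -> state) E :
  measurable_fun setT f -> measurable E -> measurable (f @^-1` E).
Proof. by move=> mf mE; rewrite -[X in measurable X]setTI; exact: mf. Qed.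

Lemma state_measure_reindex n E : measurable E ->
  state_measure (reindex n @^-1` E) = state_measure E.
Proof.
move=> mE; apply: state_measure_skew => //.
- exact: measurable_translate.
- by apply: measurable_oppR2; exact: measurable_corner.
- by move=> A mA; exact: coin_translate.
Qed.

Lemma state_measure_flow v E : measurable E ->
  state_measure (flow v @^-1` E) = state_measure E.
Proof. by move=> mE; apply: state_measure_skew. Qed.

Lemma state_measure_swap p q E : measurable E ->
  state_measure (swap_state p q @^-1` E) = state_measure E.
Proof.
move=> mE; apply: state_measure_skew => //; first exact: measurable_relabel.
by move=> A mA; exact: coin_swap.
Qed.

Lemma reindex_flow n v z : reindex n (flow v z) = flow v (reindex n z).
Proof. by rewrite /reindex /flow /skew /= addrAC. Qed.

Lemma reindex_add n k z : reindex (n + k) z = reindex k (reindex n z).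
Proof.
by rewrite /reindex /skew /= translate_add corner_add opprD addrA.
Qed.

Lemma reindex0 z : reindex 0 z = z.
Proof. by case: z => w s; rewrite /reindex /skew /= translate0 corner0 subr0. Qed.

Definition fundamental_domain : set state := [set z | cell 0 z.1 z.2].
Local Notation Delta := fundamental_domain.

Lemma reindex_domain n z : Delta (reindex n z) <-> cell n z.1 z.2.
Proof. by rewrite -[X in cell X](addr0 n) cell_add. Qed.

Lemma measurable_domain : measurable Delta.
Proof.
rewrite (_ : Delta = \bigcup_kind ([set w | present kind 0 w] `*` setT `&`
  [set z : state | rectangle 0 0 (tile_width a b kind) (tile_height a b kind)
     (z.2 - tile_corner a b kind 0 z.1)])).
  apply: countable_bigcupT_measurable => // kind; apply: measurableI.
    by apply: measurableX => //; exact: measurable_present.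
  apply: measurable_relative_position; first exact: measurable_tile_corner.
  exact: measurable_rectangle.
apply/seteqP; split=> -[w [x y]] [kind]; rewrite /half_open /=.
  move=> [pk h]; exists kind => //; split=> //; move: h.
  rewrite /rectangle /= !in_itv/=; move: (tile_corner _ _ _ _ _) => [u v] /=.
  by move=> [/andP[? ?] /andP[? ?]]; split; apply/andP; split; lra.
move=> _ [[/= pk _] h]; exists kind; split=> //; move: h.
rewrite /rectangle /half_open /= !in_itv/=.
move: (tile_corner _ _ _ _ _) => [u v] /=.
by move=> [/andP[? ?] /andP[? ?]]; split; apply/andP; split; lra.
Qed.

Hypotheses (a0 : 0 < a) (b0 : 0 < b).

Lemma domain_bound z : Delta z -> - b <= z.2.1 <= a + b /\ 0 <= z.2.2 <= a + b.
Proof.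
move=> [kind [pk]]; rewrite /half_open /tile_corner /tile_width /tile_height.
have l1 : (walk false 1 z.1)%:~R <= 1 :> R.
  have := walk_lipschitz false z.1 (ler01 : 0 <= 1 :> int).
  by rewrite walk0 !subr0 -(ler_int R).
have l0 : 0 <= (walk false 1 z.1)%:~R :> R.
  by rewrite ler0z -(walk0 false z.1) walk_le.
have lb : 0 <= (walk false 1 z.1)%:~R * b <= b.
  by apply/andP; split; [rewrite mulr_ge0// ltW|rewrite ler_piMl// ltW].
case: kind {pk}; rewrite ?corner0 /= ?walk0 ?add0r ?mulr0z ?mul0r ?mulr1z ?mul1r.
  by case/andP: lb => ? ? [/andP[? ?] /andP[? ?]]; split; apply/andP; split; lra.
by move=> [/andP[? ?] /andP[? ?]]; split; apply/andP; split; lra.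
Qed.

Lemma domain_measure_gt0 : (0 < state_measure Delta)%E.
Proof.
apply: (@lt_le_trans _ _ (a * b)%:E); first by rewrite lte_fin mulr_gt0.
rewrite -[leLHS]mul1e -(@probability_setT _ _ _ (@coin R index)).
rewrite -(state_measure_rectangle 0 0 measurableT (ltW a0) (ltW b0)).
apply: le_measure; rewrite ?inE.
- by apply: measurableX => //; exact: measurable_rectangle.
- exact: measurable_domain.
move=> -[w [x y]] [_]; rewrite /rectangle /= !in_itv/= !add0r => -[h1 h2].
exists false; split=> //; rewrite /half_open /tile_corner corner0 /=.
by rewrite !add0r.
Qed.

Lemma domain_measure_fin : state_measure Delta \is a fin_num.
Proof.
rewrite ge0_fin_numE//.
have l0 : 0 <= a + b + b + 1 by rewrite !addr_ge0// ltW.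
have l1 : 0 <= a + b + 1 by rewrite !addr_ge0// ltW.
apply: (@le_lt_trans _ _
    (state_measure (setT `*` rectangle (- b) 0 (a + b + b + 1) (a + b + 1)))).
  apply: le_measure; rewrite ?inE; first exact: measurable_domain.
    by apply: measurableX => //; exact: measurable_rectangle.
  move=> -[w [x y]] /domain_bound /= [/andP[h1 h2] /andP[h3 h4]]; split=> //.
  by rewrite /rectangle /= !in_itv/=; split; apply/andP; split; lra.
rewrite state_measure_rectangle// probability_setT mul1e ltry//.
Qed.

Lemma domain_cover z : exists n, Delta (reindex n z).
Proof. by have [n cn] := cell_cover a0 b0 z.1 z.2; exists n; apply/reindex_domain. Qed.

Lemma domain_unique n k z : Delta (reindex n z) -> Delta (reindex k z) -> n = k.
Proof. by move=> /reindex_domain hn /reindex_domain; exact: cell_unique. Qed.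

Definition invariant_events : set (set state) :=
  [set E | measurable E /\ forall n, reindex n @^-1` E = E].

Lemma invariant_events_sigma_algebra : sigma_algebra setT invariant_events.
Proof.
split.
- by split.
- move=> A [mA iA]; split=> [|n]; rewrite setTD; first exact: measurableC.
  by rewrite -preimage_setC iA.
- move=> F mF; split; first by apply: bigcup_measurable => k _; exact: (mF k).1.
  by move=> n; rewrite preimage_bigcup; apply: eq_bigcup => // k _; exact: (mF k).2.
Qed.

(* The quotient of [state] by the action [reindex], presented as [state] itself
   with the sigma-algebra of invariant events. *)
Definition tiling_system := g_sigma_algebraType invariant_events.

Lemma measurable_systemP (E : set tiling_system) :
  measurable E <-> invariant_events E.
Proof.
split=> [|iE]; last exact: sub_sigma_algebra.
apply: smallest_sub => //; exact: invariant_events_sigma_algebra.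
Qed.

(** Every orbit of [reindex] meets [Delta] exactly once, and cutting [B] down to [Delta] beforehand
    makes saturation commute with complements, intersections and countable unions. This is what
    allows a Dynkin induction on [B]. *)
Definition saturation (B : set state) : set state :=
  \bigcup_n (reindex n @^-1` (B `&` Delta)).

Lemma saturation_invariant B : measurable B -> invariant_events (saturation B).
Proof.
move=> mB; split.
  apply: countable_bigcupT_measurable => // n.
  apply: preimage_measurable; first exact: measurable_reindex.
  by apply: measurableI => //; exact: measurable_domain.
move=> k; apply/seteqP; split=> z [n _ /= h].
  by exists (k + n) => //=; rewrite reindex_add.
by exists (n - k) => //=; rewrite -reindex_add addrC subrK.
Qed.

Lemma saturation_id E : (forall n, reindex n @^-1` E = E) -> saturation E = E.
Proof.
move=> iE; apply/seteqP; split=> z; first by move=> [n _ [Ez _]]; rewrite -(iE n).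
move=> Ez; have [n Dn] := domain_cover z; exists n => //; split=> //.
by rewrite -[_ (reindex n z)]/((reindex n @^-1` E) z) iE.
Qed.

Lemma saturationI B C : saturation (B `&` C) = saturation B `&` saturation C.
Proof.
apply/seteqP; split=> z.
  by move=> [n _ [[Bn Cn] Dn]]; split; exists n.
move=> [[n _ [Bn Dn]] [k _ [Ck Dk]]].
by exists n => //; split=> //; split=> //; rewrite (domain_unique Dn Dk).
Qed.

Lemma saturationC B : saturation (~` B) = ~` saturation B.
Proof.
apply/seteqP; split=> z.
  move=> [n _ [/= Bn Dn]] [k _ [Bk Dk]]; apply: Bn.
  by rewrite (domain_unique Dn Dk).
have [n Dn] := domain_cover z => nB; exists n => //; split=> // Bn; apply: nB.
by exists n.
Qed.

Lemma saturation_bigcup (F : (set state)^nat) :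
  saturation (\bigcup_k F k) = \bigcup_k saturation (F k).
Proof.
apply/seteqP; split=> z; first by move=> [n _ [[k _ Fk] Dn]]; exists k => //; exists n.
by move=> [k _ [n _ [Fk Dn]]]; exists n => //; split=> //; exists k.
Qed.

(** [Delta] and its translate are two fundamental domains of the same action: the piece of one whose
    points need the renumbering [n] to enter the other is carried there by [reindex n], which
    preserves both [E] and the measure. *)
Lemma invariant_measure_translate E v : invariant_events E ->
  state_measure (E `&` flow v @^-1` Delta) = state_measure (E `&` Delta).
Proof.
move=> [mE iE].
have mD := measurable_domain.
have mDv : measurable (flow v @^-1` Delta).
  by apply: preimage_measurable => //; exact: measurable_flow.
pose A n := E `&` flow v @^-1` Delta `&` reindex n @^-1` Delta.
pose B n := E `&` Delta `&` flow v @^-1` (reindex (- n) @^-1` Delta).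
have mA n : measurable (A n).
  apply: measurableI; first exact: measurableI.
  by apply: preimage_measurable => //; exact: measurable_reindex.
have mB n : measurable (B n).
  apply: measurableI; first exact: measurableI.
  apply: preimage_measurable; first exact: measurable_flow.
  by apply: preimage_measurable => //; exact: measurable_reindex.
rewrite (_ : E `&` flow v @^-1` Delta = \bigcup_n A n); last first.
  apply/seteqP; split=> z; last by move=> [n _ []].
  by move=> h; have [n Dn] := domain_cover z; exists n.
rewrite (_ : E `&` Delta = \bigcup_n B n); last first.
  apply/seteqP; split=> z; last by move=> [n _ []].
  move=> h; have [n Dn] := domain_cover (flow v z); exists (- n) => //; split=> //.
  by rewrite /= opprK.
apply: (@measure_bigcup_eq _ _ _ state_measure _ A B mA mB).
- by move=> n k _ _ [z [[_ Dn] [_ Dk]]]; exact: (domain_unique Dn Dk).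
- move=> n k _ _ [z [[_ Dn] [_ Dk]]].
  by apply: oppr_inj; exact: (domain_unique Dn Dk).
move=> n; apply: etrans (esym (state_measure_reindex (- n) (mA n))) _.
suff -> : reindex (- n) @^-1` A n = B n by [].
apply/seteqP; split=> z.
  move=> [[/= En Dvn] Dn]; split; last by rewrite /= reindex_flow.
  split; first by rewrite -(iE (- n)).
  by move: Dn; rewrite /= -reindex_add addNr reindex0.
move=> [[/= Ez Dz]]; rewrite /= reindex_flow => Dvn; split; last first.
  by rewrite /= -reindex_add addNr reindex0.
by split=> //; rewrite -[E _]/((reindex (- n) @^-1` E) z) iE.
Qed.

End Action.

(** * Locality and escape of mass *)

Definition same_side (p q : index) : Prop :=
  p.1 = q.1 /\ (0 <= p.2) = (0 <= q.2).

(** Either both positions are among the summands of [walk t i] or neither is, so the exchange only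
    permutes the summands. *)
Lemma walk_swap t i p q w : same_side p q ->
  (`|p.2| < `|i|)%N -> (`|q.2| < `|i|)%N ->
  walk t i (swap_bits p q w) = walk t i w.
Proof.
move=> [pq1 pq2] pi qi.
pose f (r : index) := if r == p then q else if r == q then p else r.
have fK : involutive f.
  move=> r; rewrite /f; case: (eqVneq r p) => [->|rp].
    by case: (eqVneq q p) => [->//|]; rewrite eqxx.
  case: (eqVneq r q) => [->|rq]; first by rewrite eqxx.
  by rewrite (negbTE rp) (negbTE rq).
have onesf (W : seq index) : uniq W -> (p \in W) = (q \in W) ->
    ones W (swap_bits p q w) = ones W w.
  move=> uW pqW; transitivity (ones [seq f r | r <- W] w).
    by rewrite /ones count_map; apply: eq_count => r; rewrite /swap_bits /relabel /= addbF.
  apply/permP; apply: uniq_perm => //; first by rewrite map_inj_uniq//; exact: inv_inj.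
  move=> r; apply/mapP/idP => [[r' r'W ->]|rW].
    rewrite /f; case: eqP => [E|_]; first by rewrite -pqW -E.
    by case: eqP => [E|//]; rewrite pqW -E.
  exists (f r); last by rewrite fK.
  rewrite /f; case: eqP => [E|_]; first by rewrite -pqW -E.
  by case: eqP => [E|//]; rewrite pqW -E.
case: p q pq1 pq2 pi qi f fK onesf => [t1 x] [t2 y] /= <- pq2 pi qi f fK onesf.
rewrite /walk; case: i pi qi => n pi qi; [congr Posz|congr (- Posz _)].
  rewrite onesf//; first exact: (uniq_walk_support t n).1.
  apply/mapP/mapP => -[r]; rewrite mem_iota => rn [-> E].
    have y0 : 0 <= y by rewrite -pq2 E.
    by exists `|y|%N; rewrite ?mem_iota; [|congr (_, _)]; move: qi => /=; lia.
  have x0 : 0 <= x by rewrite pq2 E.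
  by exists `|x|%N; rewrite ?mem_iota; [|congr (_, _)]; move: pi => /=; lia.
rewrite onesf//; first exact: (uniq_walk_support t n.+1).2.
apply/mapP/mapP => -[r]; rewrite mem_iota => rn [-> E].
  have [k yk] : exists k, y = Negz k.
    have : y < 0 by rewrite ltNge -pq2 E.
    by case: (y) => // k _; exists k.
  by exists k; rewrite ?mem_iota ?yk//; move: qi; rewrite yk /=; lia.
have [k xk] : exists k, x = Negz k.
  have : x < 0 by rewrite ltNge pq2 E.
  by case: (x) => // k _; exists k.
by exists k; rewrite ?mem_iota ?xk//; move: pi; rewrite xk /=; lia.
Qed.

Lemma translate_swap n p q w (r : index) (M N : nat) :
  (`|p.2| < N)%N -> (`|q.2| < N)%N -> (`|r.2| <= M)%N ->
  (M + N <= `|n.1|)%N -> (M + N <= `|n.2|)%N ->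
  translate n (swap_bits p q w) r = translate n w r.
Proof.
case: r => t x /= pN qN rM n1 n2; rewrite /translate /swap_bits /relabel /= !addbF.
by do 2?[case: eqP => [E|_]; first by case: (t) E => E;
  [move: pN qN; rewrite -E /=; lia|move: pN qN; rewrite -E /=; lia]].
Qed.

(** * A random walk seldom passes near a distant point *)

Section Escape.
Context {R : realType}.

Definition walk_hits t (c rho x y : R) : set (bits index) :=
  \bigcup_(j : int) [set w |
    `|y - j%:~R * c| <= rho /\ `|x - (walk t j w)%:~R * c| <= rho].

Lemma measurable_walk_hits t c rho x y : measurable (walk_hits t c rho x y).
Proof.
apply: countable_bigcupT_measurable => // j.
have mP (P : Prop) : measurable [set _ : bits index | P].
  have [p|p] := pselect P.
    by rewrite (_ : mkset _ = setT)//; apply/seteqP; split.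
  by rewrite (_ : mkset _ = set0)//; apply/seteqP; split.
rewrite (_ : mkset _ = \bigcup_(k : int) ([set w | walk t j w = k] `&`
  [set _ | `|y - j%:~R * c| <= rho /\ `|x - k%:~R * c| <= rho])).
  apply: countable_bigcupT_measurable => // k.
  by apply: measurableI => //; exact: measurable_walk.
by apply/seteqP; split=> w /=; [exists (walk t j w)|move=> [k _ [/= ->]]].
Qed.

(** Only boundedly many pairs of a time and a value put the rescaled graph within [rho] of [(x, y)].
    A pair with a large time has small probability by anticoncentration; one with a small time also
    has a small value and cannot be near a distant point. *)
Lemma walk_escape t (c rho eps : R) : 0 < c -> 0 < eps ->
  exists M : R, forall x y : R, M < Num.max `|x| `|y| ->
    (@coin R index (walk_hits t c rho x y) <= eps%:E)%E.
Proof.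
move=> c0 e0.
have [rho0|rho0] := ltP rho 0.
  exists 0 => x y _; rewrite (_ : walk_hits _ _ _ _ _ = set0) ?measure0 ?lee_fin ?ltW//.
  apply/seteqP; split=> // w [j _ [/= h _]].
  by have := le_lt_trans h rho0; rewrite ltNge normr_ge0.
(* Of the two extra units, one absorbs the rounding by [truncn] and the other the rounding by
   [floor] at the left end of the interval. *)
pose n := (Num.truncn (2 * rho / c)).+2.
have ball_int (x : R) (j : int) : `|x - j%:~R * c| <= rho ->
    exists2 k : nat, (k < n)%N & j = Num.floor ((x - rho) / c) + k%:Z.
  rewrite ler_norml => /andP[h1 h2].
  have /andP[f1 f2] := floor_itv ((x - rho) / c).
  set f := Num.floor _ in f1 f2 *.
  have fj : f <= j.
    rewrite -(ler_int R) (le_trans f1)// ler_pdivrMr//; lra.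
  exists `|j - f|%N; last by lia.
  have : (j - f)%:~R < n%:R :> R.
    rewrite intrB /n -natr1.
    have g1 : j%:~R <= (x + rho) / c by rewrite ler_pdivlMr//; lra.
    have g2 : (x - rho) / c < f%:~R + 1 by rewrite intrD in f2.
    have g3 := truncnS_gt (2 * rho / c).
    have g4 : (x + rho) / c = (x - rho) / c + 2 * rho / c by field; rewrite gt_eqF.
    lra.
  rewrite -[n%:R]/(n%:Z%:~R) ltr_int; lia.
(* The share of each of the [n * n] pairs in the union bound. *)
pose e1 := eps / (n%:R * n%:R).
have n0 : 0 < n%:R :> R by rewrite ltr0n.
have e10 : 0 < e1 by rewrite divr_gt0// mulr_gt0.
have [N HN] := coin_walk_small e10.
exists (2 * rho + N%:R * c + N%:R * c) => x y Mxy.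
pose j0 := Num.floor ((y - rho) / c); pose k0 := Num.floor ((x - rho) / c).
pose E k l : set (bits index) := [set w | walk t (j0 + k%:Z) w = k0 + l%:Z] `&`
  [set _ | `|y - (j0 + k%:Z)%:~R * c| <= rho /\ `|x - (k0 + l%:Z)%:~R * c| <= rho].
have mP (P : Prop) : measurable [set _ : bits index | P].
  have [p|p] := pselect P.
    by rewrite (_ : mkset _ = setT)//; apply/seteqP; split.
  by rewrite (_ : mkset _ = set0)//; apply/seteqP; split.
have mE k l : measurable (E k l).
  by apply: measurableI => //; exact: measurable_walk.
have cE k l : (@coin R index (E k l) <= e1%:E)%E.
  have [Nj|jN] := leP N%:Z `|j0 + k%:Z|.
    apply: le_trans (HN t (j0 + k%:Z) (k0 + l%:Z) Nj).
    apply: le_measure; rewrite ?inE//; first exact: measurable_walk.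
    exact: subIsetl.
  (* The remaining times are below [N] in absolute value, and so are the values of the walk; both
     coordinates would then be at most [rho + N * c]. *)
  rewrite (_ : E k l = set0) ?measure0 ?lee_fin ?ltW//.
  apply/seteqP; split=> // w [/= Ew [h1 h2]].
  have wn := walk_norm t (j0 + k%:Z) w; rewrite Ew in wn.
  have hk : `|(k0 + l%:Z)%:~R| <= N%:R :> R.
    rewrite -intr_norm -[N%:R]/(N%:Z%:~R) ler_int; lia.
  have hj : `|(j0 + k%:Z)%:~R| <= N%:R :> R.
    rewrite -intr_norm -[N%:R]/(N%:Z%:~R) ler_int; lia.
  have bnd (u i : R) : `|u - i * c| <= rho -> `|i| <= N%:R -> `|u| <= rho + N%:R * c.
    move=> u1 u2; rewrite -[u](subrK (i * c)) (le_trans (ler_normD _ _))// lerD//.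
    by rewrite normrM (ger0_norm (ltW c0)) ler_wpM2r// ltW.
  have := bnd _ _ h1 hj; have := bnd _ _ h2 hk.
  have Nc : 0 <= N%:R * c by rewrite mulr_ge0// ltW.
  by move: Mxy; rewrite lt_max => /orP[]; lra.
apply: (@le_trans _ _ (@coin R index
    (\big[setU/set0]_(k < n) \big[setU/set0]_(l < n) E k l))).
  apply: le_measure; rewrite ?inE.
  - exact: measurable_walk_hits.
  - apply: bigsetU_measurable => k _; apply: bigsetU_measurable => l _; exact: mE.
  move=> w [j _ [/= h1 h2]].
  have [k kn jk] := ball_int _ _ h1; have [l ln wl] := ball_int _ _ h2.
  rewrite -(bigcup_mkord n (fun k => \big[setU/set0]_(l < n) E k l)).
  exists k => //; rewrite -(bigcup_mkord n (E k)); exists l => //.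
  by split=> /=; rewrite /j0 -jk// /k0 -wl.
have sum_le : (\sum_(k < n) \sum_(l < n) @coin R index (E k l) <= eps%:E)%E.
  apply: (@le_trans _ _ (\sum_(k < n) \sum_(l < n) e1%:E)%E).
    by apply: lee_sum => k _; apply: lee_sum => l _; exact: cE.
  under eq_bigr do rewrite sumEFin.
  rewrite sumEFin lee_fin !sumr_const !card_ord -mulrnA -mulr_natr natrM /e1.
  by rewrite divfK// gt_eqF// mulr_gt0.
apply: le_trans sum_le; apply: le_trans.
  apply: (Boole_inequality (@coin R index)
    (A := fun k => \big[setU/set0]_(l < n) E k l)) => k _.
  by apply: bigsetU_measurable => l _; exact: mE.
by apply: lee_sum => k _; apply: (Boole_inequality _ (A := E k)).
Qed.

End Escape.

(** * A second moment bound *)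

Section BoundedMeasurable.
Context d (T : measurableType d) (R : realType).
Implicit Types (f g : T -> R).

Definition bounded_measurable f : Prop :=
  measurable_fun setT f /\ exists M, forall x, `|f x| <= M.

Lemma bounded_measurable_cst c : bounded_measurable (cst c).
Proof. by split=> //; exists `|c|. Qed.

Lemma bounded_measurableD f g :
  bounded_measurable f -> bounded_measurable g ->
  bounded_measurable (fun x => f x + g x).
Proof.
move=> [mf [M hM]] [mg [N hN]]; split; first exact: measurable_funD.
by exists (M + N) => x; rewrite (le_trans (ler_normD _ _))// lerD.
Qed.

Lemma bounded_measurableM f g :
  bounded_measurable f -> bounded_measurable g ->
  bounded_measurable (fun x => f x * g x).
Proof.
move=> [mf [M hM]] [mg [N hN]]; split; first exact: measurable_funM.
by exists (M * N) => x; rewrite normrM ler_pM.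
Qed.

Lemma bounded_measurable_indic (A : set T) :
  measurable A -> bounded_measurable (\1_A : T -> R).
Proof.
move=> mA; split=> //; exists 1 => x; rewrite indicE.
by case: (_ \in _); rewrite ?normr1 ?normr0.
Qed.

Lemma bounded_measurable_sum n (f : nat -> T -> R) :
  (forall k, bounded_measurable (f k)) ->
  bounded_measurable (fun x => \sum_(k < n) f k x).
Proof.
move=> bf; elim: n => [|n IH].
  by under eq_fun do rewrite big_ord0; exact: bounded_measurable_cst.
by under eq_fun do rewrite big_ord_recr /=; exact: bounded_measurableD.
Qed.

Variables (m : {measure set T -> \bar R}) (B : set T).
Hypotheses (mB : measurable B) (Bfin : (m B < +oo)%E).

Lemma bounded_measurable_integrable f : bounded_measurable f ->
  m.-integrable B (EFin \o f).
Proof.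
move=> [mf [M hM]]; apply: measurable_bounded_integrable => //.
  exact: measurable_funTS.
exists M; split; first by rewrite num_real.
by move=> N MN x _ /=; rewrite (le_trans (hM x))// ltW.
Qed.

Local Notation mass E := (fine (m E)).
Local Notation I f := (\int[m]_(x in B) f x).

Lemma Rintegral_indic (A : set T) : measurable A ->
  I (\1_A : T -> R) = mass (A `&` B).
Proof. by move=> mA; rewrite /Rintegral integral_indic. Qed.

Lemma Rintegral_sum n (f : nat -> T -> R) :
  (forall k, bounded_measurable (f k)) ->
  I (fun x => \sum_(k < n) f k x) = \sum_(k < n) I (f k).
Proof.
move=> bf; elim: n => [|n IH].
  rewrite big_ord0; under eq_Rintegral do rewrite big_ord0.
  by rewrite Rintegral_cst// mul0r.
rewrite big_ord_recr /= -IH -RintegralD//.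
- by apply: eq_Rintegral => x _; rewrite big_ord_recr.
- exact/bounded_measurable_integrable/bounded_measurable_sum.
- exact: bounded_measurable_integrable.
Qed.

Variables (A : nat -> set T).
Hypotheses (mA : forall k, measurable (A k))
  (A_half : forall k, mass (A k `&` B) = 2^-1 * mass B)
  (A_indep : forall k l, k != l -> mass ((A k `&` A l) `&` B) = 4^-1 * mass B).

Let r k x : R := \1_(A k) x - 2^-1.

Let br k : bounded_measurable (r k).
Proof.
apply: bounded_measurableD; first exact: bounded_measurable_indic.
exact: (bounded_measurable_cst (- 2^-1)).
Qed.

Let orth k l : k != l -> I (fun x => r k x * r l x) = 0.
Proof.
move=> kl.
have E x : r k x * r l x = \1_(A k `&` A l) x +
    ((- 2^-1) * (\1_(A k) x + \1_(A l) x) + 4^-1).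
  by rewrite /r indicI /=; field.
under eq_Rintegral do rewrite E.
have b1 := bounded_measurable_indic (mA k); have b2 := bounded_measurable_indic (mA l).
have b3 := bounded_measurable_indic (measurableI _ _ (mA k) (mA l)).
have b12 := bounded_measurableD b1 b2.
have b12' := bounded_measurableM (bounded_measurable_cst (- 2^-1)) b12.
have b4 := bounded_measurable_cst (4^-1 : R).
rewrite RintegralD//; last 2 first.
  exact: bounded_measurable_integrable b3.
  exact: bounded_measurable_integrable (bounded_measurableD b12' b4).
rewrite RintegralD//; last 2 first.
  exact: bounded_measurable_integrable b12'.
  exact: bounded_measurable_integrable b4.
rewrite RintegralZl//; last exact: bounded_measurable_integrable b12.
rewrite RintegralD//; last 2 first.
  exact: bounded_measurable_integrable b1.
  exact: bounded_measurable_integrable b2.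
rewrite Rintegral_cst// !Rintegral_indic//; last exact: measurableI.
by rewrite A_indep// !A_half; field.
Qed.

Let sqr k x : r k x * r k x = 4^-1.
Proof. by rewrite /r indicE; case: (_ \in _) => /=; field. Qed.

Lemma second_moment n :
  I (fun x => (\sum_(k < n) r k x) ^+ 2) = n%:R / 4 * mass B.
Proof.
elim: n => [|n IH].
  under eq_Rintegral do rewrite big_ord0 expr0n /=.
  by rewrite Rintegral_cst// !mul0r.
have bs := bounded_measurable_sum n br.
have E x : (\sum_(k < n.+1) r k x) ^+ 2 = (\sum_(k < n) r k x) ^+ 2 +
    (2 * (\sum_(k < n) r k x * r n x) + 4^-1).
  by rewrite big_ord_recr /= sqrrD -[r n x ^+ 2]/(r n x * r n x) sqr -mulr_suml; ring.
under eq_Rintegral do rewrite E.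
have b1 : bounded_measurable (fun x => (\sum_(k < n) r k x) ^+ 2).
  exact: bounded_measurableM.
have brr k : bounded_measurable (fun x => r k x * r n x).
  exact: bounded_measurableM.
have b2 := bounded_measurable_sum n brr.
have b2' := bounded_measurableM (bounded_measurable_cst 2) b2.
have b4 := bounded_measurable_cst (4^-1 : R).
rewrite RintegralD//; last 2 first.
  exact: bounded_measurable_integrable b1.
  exact: bounded_measurable_integrable (bounded_measurableD b2' b4).
rewrite RintegralD//; last 2 first.
  exact: bounded_measurable_integrable b2'.
  exact: bounded_measurable_integrable b4.
rewrite RintegralZl//; last exact: bounded_measurable_integrable b2.
rewrite IH (Rintegral_sum n brr) big1 => [|k _]; last first.
  by apply: orth; rewrite neq_ltn ltn_ord.
by rewrite Rintegral_cst// -natr1; field.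
Qed.

(** The centred indicators are orthogonal, so the sum of [n ^ 2] of them has size of order [n] in
    L2, whatever part [G] of [B] it is integrated over. Divided by the number of sets, the deviation
    is of order [1 / n]. *)
Lemma average_deviation (G : set T) n : measurable G -> G `<=` B -> (0 < n)%N ->
  `|\sum_(k < n ^ 2) (mass (G `&` A k) - 2^-1 * mass G)| <= n%:R * mass B.
Proof.
move=> mG GB n0; have n0R : 0 < n%:R :> R by rewrite ltr0n.
have bG := bounded_measurable_indic mG.
have bGr k := bounded_measurableM bG (br k).
have bS := bounded_measurable_sum (n ^ 2) br.
pose S x := \sum_(k < n ^ 2) r k x.
have sumE : \sum_(k < n ^ 2) (mass (G `&` A k) - 2^-1 * mass G) =
    I (fun x => \1_G x * S x).
  under [RHS]eq_Rintegral do rewrite /S mulr_sumr.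
  rewrite (Rintegral_sum (n ^ 2) bGr); apply: eq_bigr => k _.
  have E x : \1_G x * r k x = \1_(G `&` A k) x - 2^-1 * \1_G x :> R.
    by rewrite /r indicI /=; ring.
  under eq_Rintegral do rewrite E.
  have bGA := bounded_measurable_indic (measurableI _ _ mG (mA k)).
  have bcG := bounded_measurableM (bounded_measurable_cst 2^-1) bG.
  rewrite RintegralB//; last 2 first.
    exact: bounded_measurable_integrable bGA.
    exact: bounded_measurable_integrable bcG.
  rewrite RintegralZl//; last exact: bounded_measurable_integrable bG.
  rewrite !Rintegral_indic//; last exact: measurableI.
  by rewrite [in RHS](setIidl GB) [in RHS](setIidl (subset_trans (@subIsetl _ _ _) GB)).
have bound c : `|c| <= 1 -> I (fun x => c * (\1_G x * S x)) <= n%:R * mass B.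
  move=> c1.
  have bcGS := bounded_measurableM (bounded_measurable_cst c) (bounded_measurableM bG bS).
  have bSS : bounded_measurable (fun x => S x ^+ 2) by exact: bounded_measurableM.
  have bnSS := bounded_measurableM (bounded_measurable_cst n%:R^-1) bSS.
  have bn := bounded_measurable_cst (n%:R : R).
  (* In place of the Cauchy-Schwarz inequality, the pointwise bound [|s| <= s ^ 2 / n + n / 4],
     which comes from a square. *)
  apply: (@le_trans _ _ (I (fun x => n%:R^-1 * S x ^+ 2 + n%:R * 2^-1))).
    apply: le_Rintegral => //.
    - exact: bounded_measurable_integrable bcGS.
    - apply: bounded_measurable_integrable; apply: bounded_measurableD => //.
      exact: bounded_measurable_cst.
    move=> x _; set s := S x.
    have h1 : c * (\1_G x * s) <= `|s|.
      rewrite (le_trans (ler_norm _))// normrM normrM mulrA ler_piMl//.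
      rewrite indicE; case: (_ \in _); rewrite ?normr1 ?normr0 ?mulr1 ?mulr0//.
    apply: le_trans h1 _.
    have h2 : 0 <= (`|s| / n%:R - 2^-1) ^+ 2 * n%:R.
      by rewrite mulr_ge0// ?sqr_ge0 ?ltW.
    have h3 : (`|s| / n%:R - 2^-1) ^+ 2 * n%:R =
        n%:R^-1 * s ^+ 2 - `|s| + n%:R / 4.
      by rewrite -(real_normK (num_real s)); field; rewrite gt_eqF.
    rewrite h3 in h2; lra.
  rewrite RintegralD//; last 2 first.
    exact: bounded_measurable_integrable bnSS.
    exact: bounded_measurable_integrable (bounded_measurable_cst _).
  rewrite RintegralZl//; last exact: bounded_measurable_integrable bSS.
  rewrite second_moment Rintegral_cst// natrX.
  have mB0 : 0 <= mass B by rewrite fine_ge0.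
  have -> : n%:R^-1 * (n%:R ^+ 2 / 4 * mass B) + n%:R / 2 * mass B =
    n%:R * mass B * (3 / 4) by field; rewrite gt_eqF.
  by rewrite ler_piMr// ?mulr_ge0// ?ltW//; lra.
rewrite sumE; have bGS := bounded_measurableM bG bS.
have iGS := bounded_measurable_integrable bGS.
rewrite ler_norml; apply/andP; split.
  rewrite lerNl; have := bound (- 1); rewrite normrN normr1 RintegralZl//.
  by rewrite mulN1r; apply.
have := bound 1; rewrite normr1 RintegralZl// mul1r; exact.
Qed.

End BoundedMeasurable.

(** * Asymptotic invariance under exchanges of bits *)

Section Vanishing.
Context {R : realType}.
Implicit Types (u : R * R -> R).

Definition vanishing u : Prop :=
  forall e, 0 < e -> \forall v \near plane_infty R, `|u v| <= e.

Lemma vanishing_le u u' : (forall v, `|u v| <= u' v) -> vanishing u' -> vanishing u.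
Proof.
move=> h vu e /vu; apply: filterS => v; apply: le_trans.
by rewrite (le_trans (h v))// ler_norm.
Qed.

Lemma vanishing_ext u u' : u =1 u' -> vanishing u -> vanishing u'.
Proof. by move=> h vu e /vu; apply: filterS => v; rewrite h. Qed.

Lemma vanishing0 : vanishing (fun=> 0).
Proof. by move=> e e0; near=> v; rewrite normr0 ltW. Unshelve. all: by end_near. Qed.

Lemma vanishingD u u' : vanishing u -> vanishing u' -> vanishing (fun v => u v + u' v).
Proof.
move=> vu vu' e e0; have e2 : 0 < e / 2 by rewrite divr_gt0.
apply: filterS2 (vu _ e2) (vu' _ e2) => v h1 h2.
by rewrite (le_trans (ler_normD _ _))// (splitr e) lerD.
Qed.

Lemma vanishingZ c u : vanishing u -> vanishing (fun v => c * u v).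
Proof.
move=> vu e e0; have c1 : 0 < `|c| + 1 by rewrite ltr_wpDl.
have e2 : 0 < e / (`|c| + 1) by rewrite divr_gt0.
apply: filterS (vu _ e2) => v; rewrite ler_pdivlMr// => h.
rewrite normrM mulrC (le_trans _ h)// ler_wpM2l// lerDl//.
Qed.

Lemma vanishingB u u' : vanishing u -> vanishing u' -> vanishing (fun v => u v - u' v).
Proof.
move=> vu /(vanishingZ (-1)) vu'; have := vanishingD vu vu'.
by apply: vanishing_ext => v; rewrite mulN1r.
Qed.

Lemma vanishing_sum n (f : nat -> R * R -> R) :
  (forall k, vanishing (f k)) -> vanishing (fun v => \sum_(k < n) f k v).
Proof.
move=> vf; elim: n => [|n IH].
  by apply: vanishing_ext vanishing0 => v; rewrite big_ord0.
by apply: vanishing_ext (vanishingD IH (vf n)) => v; rewrite big_ord_recr.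
Qed.

Lemma vanishing_approx u :
  (forall e, 0 < e -> exists2 u', vanishing u' & forall v, `|u v - u' v| <= e) ->
  vanishing u.
Proof.
move=> h e e0; have e2 : 0 < e / 2 by rewrite divr_gt0.
have [u' vu' uu'] := h _ e2; apply: filterS (vu' _ e2) => v hv.
rewrite -[u v](subrK (u' v)) (le_trans (ler_normD _ _))// (splitr e) lerD//.
Qed.

End Vanishing.

Section Mass.
Context d (T : measurableType d) (R : realType) (m : {measure set T -> \bar R}).
Implicit Types (A B C : set T).

Definition mass A : R := fine (m A).

Definition finite_mass A : Prop := measurable A /\ (m A < +oo)%E.

Lemma finite_massS A B : measurable A -> finite_mass B -> A `<=` B -> finite_mass A.
Proof.
move=> mA [mB fB] AB; split=> //; apply: le_lt_trans fB.
by apply: le_measure; rewrite ?inE.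
Qed.

Lemma finite_mass_num A : finite_mass A -> m A \is a fin_num.
Proof. by move=> [_ fA]; rewrite ge0_fin_numE. Qed.

Lemma mass_ge0 A : 0 <= mass A.
Proof. by rewrite fine_ge0. Qed.

Lemma mass_le A B : measurable A -> finite_mass B -> A `<=` B -> mass A <= mass B.
Proof.
move=> mA fB AB; have fA := finite_massS mA fB AB.
rewrite fine_le ?finite_mass_num//; apply: le_measure; rewrite ?inE//; exact: fB.1.
Qed.

Lemma massU A B : finite_mass A -> finite_mass B -> A `&` B = set0 ->
  mass (A `|` B) = mass A + mass B.
Proof.
move=> fA fB AB; rewrite /mass measureU ?fineD ?finite_mass_num//.
  exact: fA.1.
exact: fB.1.
Qed.

Lemma mass_split A B : finite_mass A -> measurable B ->
  mass A = mass (A `&` B) + mass (A `&` ~` B).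
Proof.
move=> fA mB; rewrite -massU.
- by rewrite -setIUr setUv setIT.
- by apply: (finite_massS _ fA) => //; apply: measurableI => //; exact: fA.1.
- apply: (finite_massS _ fA) => //; apply: measurableI; first exact: fA.1.
  exact: measurableC.
- by rewrite setIACA setICr setI0.
Qed.

Lemma mass_leU A B : finite_mass A -> finite_mass B ->
  mass (A `|` B) <= mass A + mass B.
Proof.
move=> fA fB; have mAB : measurable (A `|` B).
  by apply: measurableU; [exact: fA.1|exact: fB.1].
rewrite -[leRHS]fineD ?finite_mass_num//.
have mle : (m (A `|` B) <= m A + m B)%E by apply: measureU2; [exact: fA.1|exact: fB.1].
have fAB : m (A `|` B) \is a fin_num.
  rewrite ge0_fin_numE// (le_lt_trans mle)// lte_add_pinfty//; [exact: fA.2|exact: fB.2].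
by rewrite fine_le// fin_numD !finite_mass_num.
Qed.

Lemma mass_near A B C : finite_mass A -> finite_mass B -> finite_mass C ->
  A `<=` B `|` C -> B `<=` A `|` C -> `|mass A - mass B| <= mass C.
Proof.
move=> fA fB fC AB BA.
have half A' B' : finite_mass A' -> finite_mass B' -> A' `<=` B' `|` C ->
    mass A' - mass B' <= mass C.
  move=> fA' fB' h; rewrite (mass_split fA' fB'.1) lerBlDr [leRHS]addrC.
  apply: lerD.
    by apply: mass_le => //; apply: measurableI; [exact: fA'.1|exact: fB'.1].
  apply: mass_le => //.
    by apply: measurableI; [exact: fA'.1|apply: measurableC; exact: fB'.1].
  by move=> x [/h[]].
rewrite ler_norml lerNl opprB; apply/andP; split; exact: half.
Qed.

End Mass.

(** * States whose tile at [v] has a small index *)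

Section BadSet.
Context {R : realType} (a b : R).
Hypotheses (a0 : 0 < a) (b0 : 0 < b).
Local Notation m := (state_measure R).
Local Notation Delta := (fundamental_domain a b).
Local Notation reindex := (reindex a b).

(** The bad states for an exchange of bits: the cell reached by the flow has a small row or column
    number, so that the exchange could be noticed there. *)
Definition near_axes (N : nat) (v : R * R) : set (state R) :=
  \bigcup_(n in [set n : int * int | (`|n.1| <= N)%N \/ (`|n.2| <= N)%N])
    (flow v @^-1` (reindex n @^-1` Delta)).

Lemma measurable_near_axes N v : measurable (near_axes N v).
Proof.
rewrite /near_axes bigcup_mkcond; apply: countable_bigcupT_measurable => // n.
case: ifP => // _; apply: preimage_measurable; first exact: measurable_flow.
apply: preimage_measurable; first exact: measurable_reindex.
exact: measurable_domain.
Qed.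

Definition slab (r : R) : set (state R) := setT `*` rectangle (- r) (- r) (r + r) (r + r).

Lemma measurable_slab r : measurable (slab r).
Proof. by apply: measurableX => //; exact: measurable_rectangle. Qed.

Lemma finite_mass_slab r : 0 <= r -> finite_mass m (slab r).
Proof.
move=> r0; split; first exact: measurable_slab.
have rr : 0 <= r + r by rewrite addr_ge0.
rewrite [ltLHS](state_measure_rectangle (- r) (- r) measurableT rr rr).
by rewrite probability_setT mul1e ltry.
Qed.

(** If one index of the cell is small, the corner of the cell is governed by the walk along the
    other index alone, whose graph must pass near [v]. In [rho], [r] accounts for the position of
    the origin, [a + b] for the extent of a cell, and the last term for the small index and for the
    walk at that index. *)
Lemma near_axes_hits N r v : 0 <= r ->
  let rho := r + (a + b) + N%:R * (a + b) in
  near_axes N v `&` slab r `<=`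
    (walk_hits false b rho (- v.1) v.2 `|` walk_hits true a rho v.2 v.1) `*`
      rectangle (- r) (- r) (r + r) (r + r).
Proof.
move=> r0 rho [w [x y]] [[[i j] ij /= Dn] [_ rect]]; split=> //=.
have := rect; rewrite /rectangle /= !in_itv/= => -[/andP[x1 x2] /andP[y1 y2]].
have := domain_bound b0 Dn; rewrite /reindex /flow /skew /corner /=.
move=> [/andP[h1 h2] /andP[h3 h4]].
have small (k : int) (c : R) : (`|k| <= N)%N -> 0 < c -> c <= a + b ->
    - (N%:R * (a + b)) <= k%:~R * c <= N%:R * (a + b).
  move=> kN c0 cab; rewrite -ler_norml normrM (gtr0_norm c0).
  apply: ler_pM cab => //; first exact: ltW.
  by rewrite -intr_norm -abszE -pmulrn ler_nat.
have aab : a <= a + b by rewrite lerDl ltW.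
have bab : b <= a + b by rewrite lerDr ltW.
have wN t k : (`|k| <= N)%N -> (`|walk t k w| <= N)%N.
  by move=> kN; rewrite (leq_trans _ kN)// -lez_nat !abszE walk_norm.
move: ij => /= [iN|jN].
  left; exists j => //=; rewrite !ler_norml.
  have /andP[? ?] := small _ _ iN a0 aab.
  have /andP[? ?] := small _ _ (wN true _ iN) a0 aab.
  by rewrite /rho; split; apply/andP; split; lra.
right; exists i => //=; rewrite !ler_norml.
have /andP[? ?] := small _ _ jN b0 bab.
have /andP[? ?] := small _ _ (wN false _ jN) b0 bab.
by rewrite /rho; split; apply/andP; split; lra.
Qed.

Lemma near_axes_vanishing N r : 0 <= r ->
  vanishing (fun v => mass m (near_axes N v `&` slab r)).
Proof.
move=> r0 e e0; pose rho := r + (a + b) + N%:R * (a + b).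
have rr : 0 <= r + r by rewrite addr_ge0.
(* The mass of the slab, plus 1 so that it may be divided by even when [r] is 0. *)
pose q := (r + r) * (r + r) + 1.
have q0 : 0 < q by rewrite ltr_wpDl// mulr_ge0// addr_ge0.
have e2 : 0 < e / (2 * q) by rewrite divr_gt0// mulr_gt0.
have [M1 HM1] := walk_escape false rho b0 e2.
have [M2 HM2] := walk_escape true rho a0 e2.
exists (Num.max M1 M2) => // v; rewrite /= prod_normE gt_max => /andP[v1 v2].
rewrite ger0_norm ?mass_ge0//.
set H1 := walk_hits false b rho (- v.1) v.2; set H2 := walk_hits true a rho v.2 v.1.
have mH1 : measurable H1 by exact: measurable_walk_hits.
have mH2 : measurable H2 by exact: measurable_walk_hits.
have P1 : (@coin R index H1 <= (e / (2 * q))%:E)%E by apply: HM1; rewrite normrN.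
have P2 : (@coin R index H2 <= (e / (2 * q))%:E)%E by apply: HM2; rewrite maxC.
pose S := rectangle (- r) (- r) (r + r) (r + r).
have mS : measurable S by exact: measurable_rectangle.
have box_le (H : set (bits index)) : measurable H ->
    (@coin R index H <= (e / (2 * q))%:E)%E -> mass m (H `*` S) <= e / 2.
  move=> mH PH; have fH : @coin R index H \is a fin_num by exact: coin_fin_num.
  rewrite /mass [X in fine X](state_measure_rectangle (- r) (- r) mH rr rr) fineM//=.
  move: PH; rewrite -(fineK fH) lee_fin => PH.
  have -> : e / 2 = e / (2 * q) * q by field; rewrite gt_eqF.
  apply: ler_pM; [exact: (mass_ge0 (@coin R index))|by rewrite mulr_ge0|exact: PH|by rewrite /q lerDl].
have fS : finite_mass m (slab r) by exact: finite_mass_slab.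
have fH (H : set (bits index)) : measurable H -> finite_mass m (H `*` S).
  move=> mH; apply: (finite_massS _ fS); first exact: measurableX.
  by move=> z [].
have := near_axes_hits r0; rewrite -/rho => /(_ N v) sub.
apply: (@le_trans _ _ (mass m ((H1 `*` S) `|` (H2 `*` S)))).
  apply: mass_le.
  - apply: measurableI; first exact: measurable_near_axes.
    exact: measurable_slab.
  - apply: (finite_massS _ fS); first by apply: measurableU; exact: measurableX.
    by move=> z [[]|[]].
  by move=> z /sub [[h|h] hS]; [left|right].
rewrite (splitr e) (le_trans (mass_leU (fH _ mH1) (fH _ mH2)))//.
by apply: lerD; exact: box_le.
Qed.

End BadSet.

(** * Exchanges of bits seen from a distant tile *)

Section Locality.
Context {R : realType} (a b : R).
Hypotheses (a0 : 0 < a) (b0 : 0 < b).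
Local Notation m := (state_measure R).
Local Notation Delta := (fundamental_domain a b).
Local Notation reindex := (reindex a b).
Local Notation saturation := (saturation a b).

Definition local_set (M : nat) (B : set (state R)) : Prop :=
  forall w w' s, (forall r : index, (`|r.2| <= M)%N -> w r = w' r) ->
    B (w, s) -> B (w', s).

Lemma local_set_le M N B : (M <= N)%N -> local_set M B -> local_set N B.
Proof.
move=> MN lB w w' s h; apply: lB => r rM; apply: h; exact: leq_trans MN.
Qed.

Lemma local_setI M B C : local_set M B -> local_set M C -> local_set M (B `&` C).
Proof. by move=> lB lC w w' s h [/(lB _ _ _ h) ? /(lC _ _ _ h) ?]. Qed.

Lemma local_domain : local_set 0 Delta.
Proof.
move=> w w' s h [kind [pk hk]]; exists kind.
have ww' t : w (t, 0) = w' (t, 0) by apply: h.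
have walk1 t : walk t 1 w = walk t 1 w'.
  by rewrite -(add0r 1) !walkS !walk0 ww'.
move: pk hk; rewrite /present /= !ww' => pk; split=> //; move: hk.
by case: (kind); rewrite /tile_corner ?corner0//= !walk0 ?add0r walk1.
Qed.

Lemma swap_local M N p q n v (B : set (state R)) z : local_set M B ->
  same_side p q -> (`|p.2| < N)%N -> (`|q.2| < N)%N ->
  (M + N <= `|n.1|)%N -> (M + N <= `|n.2|)%N ->
  B (reindex n (flow v z)) -> B (reindex n (flow v (swap_state p q z))).
Proof.
move=> lB pq pN qN n1 n2; case: z => w s.
rewrite /reindex /flow /swap_state /skew /= addr0.
have -> : corner a b n (swap_bits p q w) = corner a b n w.
  by rewrite /corner !walk_swap//; lia.
apply: lB => r rM; symmetry; exact: translate_swap pN qN rM n1 n2.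
Qed.

Lemma swap_stateK p q z : swap_state p q (swap_state p q z) = z :> state R.
Proof.
case: z => w s; rewrite /swap_state /skew /= !addr0; congr (_, _).
apply/funext => r; rewrite /swap_bits /relabel /= !addbF.
case: (eqVneq r p) => [->|rp].
  by case: (eqVneq q p) => [->//|]; rewrite eqxx.
case: (eqVneq r q) => [->|rq]; first by rewrite eqxx.
by rewrite (negbTE rp) (negbTE rq).
Qed.

(** Away from [near_axes] the cell reached at [v] keeps its number, its corner and its surrounding
    bits, so membership in a saturated local set is unaffected. *)
Lemma swap_saturation M N p q v (B : set (state R)) z : local_set M B ->
  same_side p q -> (`|p.2| < N)%N -> (`|q.2| < N)%N ->
  ~ near_axes a b (M + N) v z ->
  saturation B (flow v z) <-> saturation B (flow v (swap_state p q z)).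
Proof.
move=> lB pq pN qN far.
have [n Dn] := domain_cover a0 b0 (flow v z).
have [n1 n2] : (M + N <= `|n.1|)%N /\ (M + N <= `|n.2|)%N.
  split; rewrite leqNgt; apply/negP => h; apply: far; exists n => //=.
    by left; exact: ltnW.
  by right; exact: ltnW.
have lD : local_set M Delta by apply: local_set_le local_domain.
have move_ C z' : local_set M C ->
    C (reindex n (flow v z')) -> C (reindex n (flow v (swap_state p q z'))).
  by move=> lC; exact: swap_local lC pq pN qN n1 n2.
split=> -[k _ [Bk Dk]].
  by exists n => //; apply: move_; [exact: local_setI|split=> //;
    rewrite -(domain_unique a0 b0 Dk Dn)].
(* The converse: after the exchange the cell reached still has number [n], and exchanging a second
   time restores the state. *)
have kn : k = n := domain_unique a0 b0 Dk (move_ _ _ lD Dn).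
have h : (B `&` Delta) (reindex n (flow v (swap_state p q z))) by rewrite -kn.
exists n => //; have := move_ _ _ (local_setI lB lD) h.
by rewrite swap_stateK.
Qed.

Lemma mass_swap p q (E : set (state R)) : measurable E ->
  mass m (swap_state p q @^-1` E) = mass m E.
Proof. by move=> mE; exact: (congr1 fine (state_measure_swap p q mE)). Qed.

Lemma mass_reindex n (E : set (state R)) : measurable E ->
  mass m (reindex n @^-1` E) = mass m E.
Proof. by move=> mE; exact: (congr1 fine (state_measure_reindex a b n mE)). Qed.

Lemma mass_flow v (E : set (state R)) : measurable E ->
  mass m (flow v @^-1` E) = mass m E.
Proof. by move=> mE; exact: (congr1 fine (state_measure_flow v mE)). Qed.

(** The exchange preserves mass, so it may be applied to the second event as a whole; the two events
    then differ only inside [near_axes]. *)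
Lemma exchange_vanishing M (B E : set (state R)) p q r : measurable B ->
  local_set M B -> same_side p q -> 0 <= r -> measurable E -> E `<=` slab r ->
  vanishing (fun v => mass m (swap_state p q @^-1` E `&` flow v @^-1` saturation B)
    - mass m (E `&` flow v @^-1` saturation B)).
Proof.
move=> mB lB pq r0 mE Er.
pose N := (maxn `|p.2| `|q.2|).+1.
have pN : (`|p.2| < N)%N by rewrite ltnS leq_maxl.
have qN : (`|q.2| < N)%N by rewrite ltnS leq_maxr.
apply: vanishing_le (near_axes_vanishing a0 b0 (M + N) r0) => v.
have mF v' : measurable (flow v' @^-1` saturation B : set (state R)).
  apply: preimage_measurable; first exact: measurable_flow.
  exact: (saturation_invariant _ _ mB).1.
have mswap : measurable_fun setT (@swap_state R p q) := measurable_swap_state p q.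
have mEF : measurable (E `&` flow v @^-1` saturation B) by exact: measurableI.
rewrite -[X in _ - X](mass_swap p q mEF).
have mEs : measurable (swap_state p q @^-1` E) by exact: preimage_measurable.
have fin X : measurable X -> X `<=` slab r -> finite_mass m X.
  move=> mX; exact: finite_massS (finite_mass_slab r0).
have Es : swap_state p q @^-1` E `<=` slab r.
  by move=> [w s] /Er [_ /=]; rewrite addr0.
apply: mass_near.
- by apply: fin; [exact: measurableI|move=> z [/Es]].
- apply: fin; first exact: preimage_measurable.
  by move=> z [/= Ez _]; exact: Es.
- apply: fin; last by move=> z [].
  apply: measurableI; [exact: measurable_near_axes|exact: measurable_slab].
- move=> z [Ez Fz]; have [bad|far] := pselect (near_axes a b (M + N) v z).
    by right; split=> //; exact: Es.
  by left; split=> //; apply/(swap_saturation lB pq pN qN far).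
- move=> z [/= Ez Fz]; have [bad|far] := pselect (near_axes a b (M + N) v z).
    by right; split=> //; exact: Es.
  by left; split=> //; apply/(swap_saturation lB pq pN qN far).
Qed.

End Locality.

(** * Equidistribution *)

(* Unfolding these measures during unification does not terminate in practice. *)
Opaque state_measure plane_measure coin.

Section Equidistribution.
Context {R : realType} (a b : R).
Hypotheses (a0 : 0 < a) (b0 : 0 < b).
Local Notation m := (state_measure R).
Local Notation reindex := (reindex a b).

Variable F : set (state R).
Hypotheses (mF : measurable F) (iF : forall n, reindex n @^-1` F = F).
Hypothesis exchange : forall p q r (E : set (state R)), same_side p q -> 0 <= r ->
  measurable E -> E `<=` slab r ->
  vanishing (fun v => mass m (swap_state p q @^-1` E `&` flow v @^-1` F)
    - mass m (E `&` flow v @^-1` F)).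
Hypothesis dense : forall x delta : R, 0 < delta ->
  exists i j : int, `|x - (i%:~R * a + j%:~R * b)| <= delta.

Definition hit (E : set (state R)) (v : R * R) : R := mass m (E `&` flow v @^-1` F).

Definition bounded_plane_set (S : set (R * R)) : Prop :=
  measurable S /\ exists2 r, 0 <= r & S `<=` rectangle (- r) (- r) (r + r) (r + r).

Lemma measurable_flowF v : measurable (flow v @^-1` F : set (state R)).
Proof. by apply: preimage_measurable => //; exact: measurable_flow. Qed.

Lemma box_slab (C : set (bits index)) S : measurable C -> bounded_plane_set S ->
  exists2 r, 0 <= r & measurable (C `*` S) /\ C `*` S `<=` slab r.
Proof.
move=> mC [mS [r r0 Sr]]; exists r => //; split; first exact: measurableX.
by move=> [w s] [/= _ /Sr].
Qed.

Lemma finite_mass_box (C : set (bits index)) S : measurable C ->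
  bounded_plane_set S -> finite_mass m (C `*` S).
Proof.
move=> mC bS; have [r r0 [mCS CSr]] := box_slab mC bS.
exact: finite_massS mCS (finite_mass_slab r0) CSr.
Qed.

Lemma hit_le E v : finite_mass m E -> `|hit E v| <= mass m E.
Proof.
move=> fE; have h0 : 0 <= hit E v by exact: mass_ge0.
rewrite (ger0_norm h0); apply: mass_le; [|exact: fE|exact: subIsetl].
by apply: measurableI; [exact: fE.1|exact: measurable_flowF].
Qed.

Lemma hit_finite E v : finite_mass m E -> finite_mass m (E `&` flow v @^-1` F).
Proof.
move=> fE; apply: (finite_massS _ fE); last exact: subIsetl.
by apply: measurableI; [exact: fE.1|exact: measurable_flowF].
Qed.

Lemma hitU E E' v : finite_mass m E -> finite_mass m E' -> E `&` E' = set0 ->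
  hit (E `|` E') v = hit E v + hit E' v.
Proof.
move=> fE fE' EE'; have h1 := hit_finite v fE; have h2 := hit_finite v fE'.
by rewrite /hit setIUl; apply: massU h1 h2 _; rewrite setIACA setIid EE' set0I.
Qed.

Lemma hit_reindex n E v : finite_mass m E -> hit (reindex n @^-1` E) v = hit E v.
Proof.
move=> fE; have [mEF _] := hit_finite v fE.
rewrite /hit -[RHS](mass_reindex a b n mEF); congr (mass m _).
apply/seteqP; split=> z [/= Ez Fz]; split=> //.
  by rewrite /= -reindex_flow -[F _]/((reindex n @^-1` F) (flow v z)) iF.
by move: Fz; rewrite /= -reindex_flow -[F _]/((reindex n @^-1` F) (flow v z)) iF.
Qed.

(** Candidates for an exchange with [p]: same walk, same side of 0, and at distance at least [M]
    from 0. *)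
Definition fresh_index (p : index) (M k : nat) : index :=
  (p.1, if 0 <= p.2 then Posz (M + k) else Negz (M + k)).

Lemma fresh_index_side p M k : same_side p (fresh_index p M k).
Proof.
by split=> //; rewrite /fresh_index /=; case: p => t [] n.
Qed.

Lemma fresh_index_inj p M : injective (fresh_index p M).
Proof.
by move=> k l; rewrite /fresh_index; case: ifP => _ [] /addnI.
Qed.

Lemma mass_cylinder (W : seq index) e S : uniq W -> bounded_plane_set S ->
  mass m (cylinder W e `*` S) = 2^-1 ^+ size W * mass m (setT `*` S).
Proof.
move=> uW bS; have mS := bS.1.
have E1 : mass m (cylinder W e `*` S) =
    fine (@coin R index (cylinder W e) * plane_measure R S)%E.
  exact: (congr1 fine (state_measure_box (measurable_cylinder W e) mS)).
have E2 : m (setT `*` S) = plane_measure R S.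
  by apply: etrans (state_measure_box measurableT mS) _; rewrite probability_setT mul1e.
have fS : plane_measure R S \is a fin_num.
  by rewrite -E2; exact: (finite_mass_num (finite_mass_box measurableT bS)).
have E3 : mass m (setT `*` S) = fine (plane_measure R S) := congr1 fine E2.
by rewrite E1 E3 (coin_cylinder R e uW) fineM.
Qed.

(** Bit [p] becomes asymptotically independent of the preimage of [F]. Exchanging it with each of
    [n ^ 2] fresh bits changes the hit negligibly as [v] grows, and the average over the fresh bits
    is within [mass B / n] of one half of the hit without the constraint, for every [v]. *)
Lemma hit_cylinder_cons p W e S : uniq (p :: W) -> bounded_plane_set S ->
  vanishing (fun v => hit (cylinder (p :: W) e `*` S) v
    - 2^-1 * hit (cylinder W e `*` S) v).
Proof.
move=> upW bS; apply: vanishing_approx => eps eps0.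
pose M := (\max_(r <- p :: W) `|r.2|%N).+1.
have Mlt r : r \in p :: W -> (`|r.2| < M)%N.
  by move=> rW; rewrite ltnS; exact: (@leq_bigmax_seq _ _ xpredT (fun r : index => `|r.2|%N)).
pose q := fresh_index p M.
have qW k : q k \notin p :: W.
  apply/negP => /Mlt; rewrite /q /fresh_index; case: ifP => _ /=; lia.
pose B : set (state R) := setT `*` S.
have fB : finite_mass m B by exact: finite_mass_box.
pose A k : set (state R) := [set z | z.1 (q k) = e p].
have AE k : A k = cylinder [:: q k] (fun=> e p) `*` setT.
  apply/seteqP; split=> -[w s] /=.
    by move=> h; split=> // r; rewrite inE => /eqP ->.
  by move=> [h _]; rewrite /A /= h ?inE.
have mA k : measurable (A k).
  by rewrite AE; apply: measurableX => //; exact: measurable_cylinder.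
have A_half k : mass m (A k `&` B) = 2^-1 * mass m B.
  rewrite AE -setXI setIT setTI mass_cylinder ?expr1//.
have A_indep k l : k != l -> mass m ((A k `&` A l) `&` B) = 4^-1 * mass m B.
  move=> kl; have -> : (A k `&` A l) `&` B = cylinder [:: q k; q l] (fun=> e p) `*` S.
    apply/seteqP; split=> -[w s]; rewrite /A /B /=.
      by move=> [[h1 h2] [_ h3]]; split=> // r; rewrite !inE => /orP[]/eqP->.
    by move=> [h h3]; split=> //; split; apply: h; rewrite !inE eqxx ?orbT.
  rewrite mass_cylinder// /= ?expr2; first by congr (_ * _); field.
  by rewrite inE (inj_eq (@fresh_index_inj p M)) kl.
have [n n0 Bn] : exists2 n, (0 < n)%N & mass m B / n%:R <= eps.
  exists (Num.truncn (mass m B / eps)).+1 => //.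
  rewrite ler_pdivrMr ?ltr0n// mulrC -ler_pdivrMr// ltW//; exact: truncnS_gt.
have n0R : 0 < n%:R :> R by rewrite ltr0n.
have scale (s x : R) : `|s| <= n%:R * x -> n%:R ^- 2 * `|s| <= x / n%:R.
  move=> h; rewrite mulrC ler_pdivrMr ?exprn_gt0// (le_trans h)//.
  by rewrite expr2 mulrA divfK ?gt_eqF// mulrC.
(* The exchange moves the constraint on bit [p] to the fresh bit [q k] and leaves those on [W]
   alone. *)
pose G k : set (state R) := (cylinder W e `&` [set w : bits index | w (q k) = e p]) `*` S.
have GE k : swap_state p (q k) @^-1` (cylinder (p :: W) e `*` S) = G k.
  apply/seteqP; split=> -[w s];
    rewrite /swap_state /skew /= addr0 /swap_bits /relabel.
    move=> [h Ss]; split=> //; split=> [r' r'W|].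
      have := h r'; rewrite inE r'W orbT addbF => /(_ isT).
      case: eqP => [E|_]; first by move: upW; rewrite /= -E r'W.
      by case: eqP => [E|//]; have := qW k; rewrite inE -E r'W orbT.
    by have := h p (mem_head _ _); rewrite eqxx addbF.
  move=> [[h hq] Ss]; split=> // r'; rewrite inE addbF; case: eqVneq => [->//|r'p /= r'W].
  case: eqP => [E|_]; last exact: h.
  by have := qW k; rewrite inE -E r'W orbT.
(* Subtracting this vanishing function leaves the average over [k] of [hit (G k) v] minus half the
   hit of the cylinder over [W], to which [average_deviation] applies. *)
exists (fun v => n%:R ^- 2 * \sum_(k < n ^ 2)
    (-1 * (hit (G k) v - hit (cylinder (p :: W) e `*` S) v))).
  apply: vanishingZ; apply: (@vanishing_sum _ (n ^ 2)
    (fun k v => -1 * (hit (G k) v - hit (cylinder (p :: W) e `*` S) v))) => k.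
  apply: vanishingZ.
  have [r r0 [mC Cr]] := box_slab (measurable_cylinder (p :: W) e) bS.
  have := exchange (fresh_index_side p M k) r0 mC Cr; rewrite -/(q k) GE.
  exact.
move=> v; set C1 := hit (cylinder (p :: W) e `*` S) v.
set C0 := hit (cylinder W e `*` S) v.
pose G0 := cylinder W e `*` S `&` flow v @^-1` F.
have fC : finite_mass m (cylinder W e `*` S).
  by apply: finite_mass_box => //; exact: measurable_cylinder.
have mG0 : measurable G0 by exact: (hit_finite v fC).1.
have := average_deviation fB.1 fB.2 mA A_half A_indep mG0.
move=> /(_ n) dev; have {}dev := dev _ n0.
have G0B : G0 `<=` B by move=> [w s] [[_ Ss] _].
have {}dev := dev G0B.
have GA k : G0 `&` A k = G k `&` flow v @^-1` F.
  apply/seteqP; split=> -[w s]; rewrite /G0 /A /G /=.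
    by move=> [[[h1 h2] h3] h4].
  by move=> [[[h1 h2] h3] h4].
have E : \sum_(k < n ^ 2) (fine (m (G0 `&` A k)) - 2^-1 * fine (m G0)) =
    \sum_(k < n ^ 2) (hit (G k) v - 2^-1 * C0).
  by apply: eq_bigr => k _; rewrite GA.
rewrite E in dev.
have nn0 : (n ^ 2)%:R = n%:R ^+ 2 :> R by rewrite natrX.
have -> : C1 - 2^-1 * C0 - n%:R ^- 2 * \sum_(k < n ^ 2) (-1 * (hit (G k) v - C1)) =
    n%:R ^- 2 * \sum_(k < n ^ 2) (hit (G k) v - 2^-1 * C0).
  rewrite -mulr_sumr !big_split /= !sumr_const !card_ord -[_ *+ _]mulr_natr.
  by rewrite -[(- (_ * _)) *+ _]mulr_natr nn0; field; rewrite gt_eqF.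
rewrite normrM ger0_norm; last by rewrite invr_ge0 exprn_ge0// ltW.
exact: le_trans (scale _ _ dev) Bn.
Qed.

Lemma hit_cylinder W e S : uniq W -> bounded_plane_set S ->
  vanishing (fun v => hit (cylinder W e `*` S) v
    - 2^-1 ^+ size W * hit (setT `*` S) v).
Proof.
move=> uW bS; elim: W uW => [_|p W IH upW].
  apply: vanishing_ext vanishing0 => v; rewrite expr0 mul1r.
  by rewrite (_ : cylinder [::] e = setT) ?subrr//; apply/seteqP; split.
have uW : uniq W by case/andP: upW.
have := vanishingD (hit_cylinder_cons e upW bS) (vanishingZ 2^-1 (IH uW)).
apply: vanishing_ext => v; rewrite [size _]/= exprS.
move: (hit (cylinder (p :: W) e `*` S) v) (hit (cylinder W e `*` S) v) => x y.
by move: (hit (setT `*` S) v) (2^-1 ^+ size W) => z t; ring.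
Qed.

Definition shifted (h : R * R) (S : set (R * R)) : set (R * R) := [set s | S (s - h)].

Lemma shifted_bounded h S : bounded_plane_set S -> bounded_plane_set (shifted h S).
Proof.
move=> [mS [r r0 Sr]]; split.
  have := @measurable_translation R (- h); move=> /(_ measurableT S mS).
  by rewrite setTI.
exists (r + `|h.1| + `|h.2|); first by rewrite !addr_ge0.
move=> [x y] /Sr; rewrite /rectangle /= !in_itv/= => -[/andP[? ?] /andP[? ?]].
have := ler_norm h.1; have := ler_norm h.2; have := ler_norm (- h.1).
have := ler_norm (- h.2); have := normr_ge0 h.1; have := normr_ge0 h.2.
by rewrite !normrN => *; split; apply/andP; split; lra.
Qed.

Definition equivalent (S S' : set (R * R)) : Prop :=
  vanishing (fun v => hit (setT `*` S) v - hit (setT `*` S') v).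

Lemma equivalent_sym S S' : equivalent S S' -> equivalent S' S.
Proof.
by move=> /(vanishingZ (-1)); apply: vanishing_ext => v; rewrite mulN1r opprB.
Qed.

Lemma equivalent_trans S S' S'' :
  equivalent S S' -> equivalent S' S'' -> equivalent S S''.
Proof.
by move=> h /(vanishingD h); apply: vanishing_ext => v; rewrite addrA subrK.
Qed.

Lemma shifted_add h k S : shifted h (shifted k S) = shifted (h + k) S.
Proof. by apply/seteqP; split=> s; rewrite /shifted /= opprD addrA. Qed.

Lemma shifted0 S : shifted 0 S = S.
Proof. by apply/seteqP; split=> s; rewrite /shifted /= subr0. Qed.

(* Reading [reindex n] on the event that one prescribed bit equals [c], for
   [n = (1, 0)] or [(0, 1)]. *)
Lemma equivalent_step (n : int * int) (p p' : index) (c : bool) h S :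
  (forall w, translate n w p' = w p) ->
  (forall w : bits index, w p = c -> corner a b n w = h) ->
  bounded_plane_set S -> equivalent S (shifted h S).
Proof.
move=> tp ch bS; have bS' := shifted_bounded h bS.
have h1 := hit_cylinder (fun=> c) (isT : uniq [:: p']) bS.
have h2 := hit_cylinder (fun=> c) (isT : uniq [:: p]) bS'.
have SE : reindex n @^-1` (cylinder [:: p'] (fun=> c) `*` S) =
    cylinder [:: p] (fun=> c) `*` shifted h S.
  apply/seteqP; split=> -[w s]; rewrite /reindex /skew /shifted /=.
    move=> [hp hs]; have wp : w p = c by rewrite -tp hp ?inE.
    by split; [move=> r; rewrite inE => /eqP->|rewrite -(ch _ wp)].
  move=> [hp hs]; have wp : w p = c by rewrite hp ?inE.
  by rewrite (ch _ wp); split=> // r; rewrite inE => /eqP->; rewrite tp.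
have fC : finite_mass m (cylinder [:: p'] (fun=> c) `*` S).
  exact: (finite_mass_box (measurable_cylinder _ _) bS).
have E v : hit (cylinder [:: p'] (fun=> c) `*` S) v =
    hit (cylinder [:: p] (fun=> c) `*` shifted h S) v.
  by rewrite -(hit_reindex n v fC) SE.
have alg (x y z : R) : 2 * ((x - 2^-1 ^+ 1 * z) - (x - 2^-1 ^+ 1 * y)) = y - z.
  by rewrite expr1; field.
have := vanishingZ 2 (vanishingB h2 h1); apply: vanishing_ext => v.
rewrite E; exact: alg.
Qed.

Lemma walk1 t w : walk t 1 w = (w (t, 0) : nat)%:Z.
Proof. by have := walkS t 0 w; rewrite add0r walk0 add0r. Qed.

Lemma equivalent_basic (c : bool) S : bounded_plane_set S ->
  equivalent S (shifted (a, c%:R * a) S) /\ equivalent S (shifted (- (c%:R * b), b) S).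
Proof.
move=> bS; split.
  (* After renumbering by one tile, the old bit 0 is found at index -1. *)
  apply: (@equivalent_step (1, 0) (true, 0) (true, -1) c) => //.
    by move=> w; rewrite /translate /relabel /= addbF addNr.
  move=> w wc; rewrite /corner /= walk1 !walk0 wc.
  by rewrite mulr0z !mul0r subr0 add0r mulr1z mul1r.
apply: (@equivalent_step (0, 1) (false, 0) (false, -1) c) => //.
  by move=> w; rewrite /translate /relabel /= addbF addNr.
move=> w wc; rewrite /corner /= walk1 !walk0 wc.
by rewrite mulr0z !mul0r add0r mulr1z mul1r addr0.
Qed.

Definition period (h : R * R) : Prop :=
  forall S, bounded_plane_set S -> equivalent S (shifted h S).

Lemma periodD h k : period h -> period k -> period (h + k).
Proof.
move=> ph pk S bS; apply: equivalent_trans (pk _ bS) _.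
by rewrite -shifted_add; apply: ph; exact: shifted_bounded.
Qed.

Lemma periodN h : period h -> period (- h).
Proof.
move=> ph S bS; apply: equivalent_sym.
rewrite -[X in equivalent _ X](shifted0 S) -(subrr h) -shifted_add.
by apply: ph; exact: shifted_bounded.
Qed.

Lemma period_int (i : int) h : period h -> period (i%:~R * h.1, i%:~R * h.2).
Proof.
move=> ph; have pn (n : nat) : period (n%:R * h.1, n%:R * h.2).
  elim: n => [|n IH].
    rewrite !mul0r => S bS; rewrite -[(0, 0)]/(0 : R * R) shifted0.
    by apply: vanishing_ext vanishing0 => v; rewrite subrr.
  have -> : (n.+1%:R * h.1, n.+1%:R * h.2) = (n%:R * h.1, n%:R * h.2) + h.
    by case: h {ph IH} => x y; congr (_, _) => /=; rewrite -natr1; ring.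
  exact: periodD.
case: i => n; first exact: pn.
have -> : ((Negz n)%:~R * h.1, (Negz n)%:~R * h.2) =
    - (n.+1%:R * h.1, n.+1%:R * h.2) :> R * R.
  by rewrite NegzE mulrNz !mulNr.
by apply: periodN; exact: pn.
Qed.

(** The two values of a bit give periods that differ by [(0, a)] for a step along a row and by
    [(b, 0)] for a step to the next row; with [(a, 0)] and [(0, b)] these generate the group. *)
Lemma period_lattice (i j k l : int) :
  period (i%:~R * a + j%:~R * b, k%:~R * a + l%:~R * b).
Proof.
have p1 : period (a, 0).
  by move=> S bS; have := (equivalent_basic false bS).1; rewrite mul0r.
have p2 : period (0, a).
  have -> : (0, a) = (a, a) - (a, 0) :> R * R by congr (_, _) => /=; ring.
  apply: periodD; last exact: (periodN p1).
  by move=> S bS; have := (equivalent_basic true bS).1; rewrite mul1r.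
have p3 : period (0, b).
  by move=> S bS; have := (equivalent_basic false bS).2; rewrite mul0r oppr0.
have p4 : period (b, 0).
  have -> : (b, 0) = (0, b) - (- b, b) :> R * R by congr (_, _) => /=; ring.
  apply: (periodD p3); apply: periodN.
  by move=> S bS; have := (equivalent_basic true bS).2; rewrite mul1r.
have q1 := period_int i p1; have q2 := period_int k p2.
have q3 := period_int l p3; have q4 := period_int j p4.
have := periodD (periodD q1 q4) (periodD q2 q3).
suff -> : (i%:~R * (a, 0 : R).1, i%:~R * (a, 0 : R).2) +
    (j%:~R * (b, 0 : R).1, j%:~R * (b, 0 : R).2) +
    ((k%:~R * (0 : R, a).1, k%:~R * (0 : R, a).2) +
     (l%:~R * (0 : R, b).1, l%:~R * (0 : R, b).2)) =
    (i%:~R * a + j%:~R * b, k%:~R * a + l%:~R * b) :> R * R by [].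
by congr (_, _) => /=; ring.
Qed.

End Equidistribution.

(** * From dense periods to Lebesgue measure on dyadic squares *)

Section Squares.
Context {R : realType} (a b : R).
Hypotheses (a0 : 0 < a) (b0 : 0 < b).
Local Notation m := (state_measure R).
Local Notation reindex := (reindex a b).

Variable F : set (state R).
Hypotheses (mF : measurable F) (iF : forall n, reindex n @^-1` F = F).
Hypothesis exchange : forall p q r (E : set (state R)), same_side p q -> 0 <= r ->
  measurable E -> E `<=` slab r ->
  vanishing (fun v => mass m (swap_state p q @^-1` E `&` flow v @^-1` F)
    - mass m (E `&` flow v @^-1` F)).
Hypothesis dense : forall x delta : R, 0 < delta ->
  exists i j : int, `|x - (i%:~R * a + j%:~R * b)| <= delta.

Local Notation box S := ([set: bits index] `*` S).

Lemma bounded_rectangle (x y u v : R) : bounded_plane_set (rectangle x y u v).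
Proof.
split; first exact: measurable_rectangle.
exists (`|x| + `|y| + `|u| + `|v| + 1); first by rewrite !addr_ge0.
move=> [s t]; rewrite /rectangle /= !in_itv/= => -[/andP[? ?] /andP[? ?]].
have := ler_norm x; have := ler_norm y; have := ler_norm u; have := ler_norm v.
have := ler_norm (- x); have := ler_norm (- y); rewrite !normrN.
have := normr_ge0 x; have := normr_ge0 y; have := normr_ge0 u; have := normr_ge0 v.
by move=> *; split; apply/andP; split; lra.
Qed.

Lemma mass_rectangle (x y u v : R) : 0 <= u -> 0 <= v ->
  mass m (box (rectangle x y u v)) = u * v.
Proof.
move=> u0 v0.
have := congr1 fine (state_measure_rectangle x y measurableT u0 v0).
by rewrite probability_setT mul1e.
Qed.

Lemma finite_mass_rectangle (x y u v : R) : finite_mass m (box (rectangle x y u v)).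
Proof. exact: (finite_mass_box measurableT (bounded_rectangle x y u v)). Qed.

Lemma shifted_rectangle (h : R * R) (x y u v : R) :
  shifted h (rectangle x y u v) = rectangle (x + h.1) (y + h.2) u v.
Proof.
apply/seteqP; split=> -[s t]; rewrite /shifted /rectangle /= !in_itv/=.
  by move=> [/andP[? ?] /andP[? ?]]; split; apply/andP; split; lra.
by move=> [/andP[? ?] /andP[? ?]]; split; apply/andP; split; lra.
Qed.

(** The symmetric difference lies in the frame between concentric squares of sides [u + 2 delta] and
    [u - 2 delta], of area [8 * u * delta]. The bound is uniform in [v]. *)
Lemma hit_squares_close (x y x' y' u delta : R) v :
  0 < delta -> delta + delta <= u -> `|x - x'| <= delta -> `|y - y'| <= delta ->
  `|hit F (box (rectangle x y u u)) v - hit F (box (rectangle x' y' u u)) v|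
    <= 8 * u * delta.
Proof.
move=> d0 du xx yy.
pose w := u + (delta + delta); pose w' := u - (delta + delta).
have wE : w = u + (delta + delta) by []. have w'E : w' = u - (delta + delta) by [].
pose big := rectangle (x' - delta) (y' - delta) w w.
pose small := rectangle (x' + delta) (y' + delta) w' w'.
have fb : finite_mass m (box big) by exact: finite_mass_rectangle.
have ms : measurable (box small : set (state R)).
  by apply: measurableX => //; exact: measurable_rectangle.
pose C := box big `&` ~` (box small).
have sb : box small `<=` box big.
  move=> [e [s t]] [_ /=]; rewrite /small /big /rectangle /= !in_itv/=.
  by move=> [/andP[? ?] /andP[? ?]]; split=> //; split; apply/andP; split; lra.
have fC : finite_mass m C.
  apply: (finite_massS _ fb); last exact: subIsetl.
  by apply: measurableI; [exact: fb.1|apply: measurableC; exact: ms].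
have massC : mass m C = 8 * u * delta.
  have := mass_split fb ms; rewrite (setIidr sb) -/C.
  by rewrite !mass_rectangle /w /w'; try lra; nra.
rewrite -massC; apply: mass_near.
- exact: (hit_finite mF v (finite_mass_rectangle _ _ _ _)).
- exact: (hit_finite mF v (finite_mass_rectangle _ _ _ _)).
- exact: fC.
- move: xx yy; rewrite !ler_norml => /andP[? ?] /andP[? ?].
  move=> [e [s t]] [[_ /= h] Fz].
  have [h'|h'] := pselect (rectangle x' y' u u (s, t)); first by left.
  right; move: h; rewrite /rectangle /= !in_itv/= => -[/andP[? ?] /andP[? ?]].
  split; first by split=> //; rewrite /big /rectangle /= !in_itv/=;
    split; apply/andP; split; lra.
  move=> [_]; rewrite /small /rectangle /= !in_itv/= => -[/andP[? ?] /andP[? ?]].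
  apply: h'; rewrite /rectangle /= !in_itv/=.
  by split; apply/andP; split; lra.
- move: xx yy; rewrite !ler_norml => /andP[? ?] /andP[? ?].
  move=> [e [s t]] [[_ /= h] Fz].
  have [h'|h'] := pselect (rectangle x y u u (s, t)); first by left.
  right; move: h; rewrite /rectangle /= !in_itv/= => -[/andP[? ?] /andP[? ?]].
  split; first by split=> //; rewrite /big /rectangle /= !in_itv/=;
    split; apply/andP; split; lra.
  move=> [_]; rewrite /small /rectangle /= !in_itv/= => -[/andP[? ?] /andP[? ?]].
  apply: h'; rewrite /rectangle /= !in_itv/=.
  by split; apply/andP; split; lra.
Qed.

Lemma equivalent_squares (x y x' y' u : R) : 0 < u ->
  equivalent F (rectangle x y u u) (rectangle x' y' u u).
Proof.
move=> u0; apply: vanishing_approx => eps eps0.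
(* The first bound keeps the inner square of the frame from having negative side, the second makes
   the area of the frame at most [eps]. *)
pose delta := Num.min (u / 2) (eps / (8 * u)).
have u8 : 0 < 8 * u by rewrite mulr_gt0.
have d0 : 0 < delta by rewrite lt_min !divr_gt0.
have du : delta + delta <= u.
  have : delta <= u / 2 by rewrite ge_min lexx.
  lra.
have de : 8 * u * delta <= eps.
  by rewrite mulrC -ler_pdivlMr// ge_min lexx orbT.
have [i [j ij]] := dense (x' - x) d0; have [k [l kl]] := dense (y' - y) d0.
pose h := (i%:~R * a + j%:~R * b, k%:~R * a + l%:~R * b).
have eqv := period_lattice a0 b0 mF iF exchange i j k l (bounded_rectangle x y u u).
rewrite shifted_rectangle /= in eqv.
eexists; first exact: eqv.
move=> v; apply: le_trans de.
have alg (s t r : R) : s - t - (s - r) = r - t by ring.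
rewrite alg; apply: hit_squares_close => //.
  by move: ij; congr (_ <= _); rewrite -normrN; congr (`|_|); ring.
by move: kl; congr (_ <= _); rewrite -normrN; congr (`|_|); ring.
Qed.

Lemma hit_split_x (x y u u' v : R) t : 0 <= u -> 0 <= u' ->
  hit F (box (rectangle x y (u + u') v)) t =
  hit F (box (rectangle x y u v)) t + hit F (box (rectangle (x + u) y u' v)) t.
Proof.
move=> u0 u'0.
have -> : box (rectangle x y (u + u') v) =
    box (rectangle x y u v) `|` box (rectangle (x + u) y u' v).
  apply/seteqP; split=> -[e [s r]]; rewrite /rectangle /= !in_itv/=.
    move=> [_ [/andP[? ?] ?]]; have [sx|sx] := ltP s (x + u); [left|right];
      by split=> //; split=> //; apply/andP; split; lra.
  by move=> [] [_ [/andP[? ?] ?]]; split=> //; split=> //; apply/andP; split; lra.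
apply: (hitU mF); [exact: finite_mass_rectangle|exact: finite_mass_rectangle|].
apply/seteqP; split=> -[e [s r]] //; rewrite /rectangle /= !in_itv/=.
by move=> [[_ [/andP[? ?] ?]] [_ [/andP[? ?] ?]]]; lra.
Qed.

Lemma hit_split_y (x y u v v' : R) t : 0 <= v -> 0 <= v' ->
  hit F (box (rectangle x y u (v + v'))) t =
  hit F (box (rectangle x y u v)) t + hit F (box (rectangle x (y + v) u v')) t.
Proof.
move=> v0 v'0.
have -> : box (rectangle x y u (v + v')) =
    box (rectangle x y u v) `|` box (rectangle x (y + v) u v').
  apply/seteqP; split=> -[e [s r]]; rewrite /rectangle /= !in_itv/=.
    move=> [_ [? /andP[? ?]]]; have [sx|sx] := ltP r (y + v); [left|right];
      by split=> //; split=> //; apply/andP; split; lra.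
  by move=> [] [_ [? /andP[? ?]]]; split=> //; split=> //; apply/andP; split; lra.
apply: (hitU mF); [exact: finite_mass_rectangle|exact: finite_mass_rectangle|].
apply/seteqP; split=> -[e [s r]] //; rewrite /rectangle /= !in_itv/=.
by move=> [[_ [? /andP[? ?]]] [_ [? /andP[? ?]]]]; lra.
Qed.

Lemma hit_square_double (x y x' y' u : R) : 0 < u ->
  vanishing (fun v => hit F (box (rectangle x y (u + u) (u + u))) v
    - 4 * hit F (box (rectangle x' y' u u)) v).
Proof.
move=> u0; have u0' := ltW u0.
have e1 := equivalent_squares x y x' y' u0.
have e2 := equivalent_squares (x + u) y x' y' u0.
have e3 := equivalent_squares x (y + u) x' y' u0.
have e4 := equivalent_squares (x + u) (y + u) x' y' u0.
have alg (p q r s t : R) : (p - t) + (q - t) + ((r - t) + (s - t)) =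
  p + q + (r + s) - 4 * t by ring.
have := vanishingD (vanishingD e1 e3) (vanishingD e2 e4).
apply: vanishing_ext => v; rewrite alg.
by rewrite (hit_split_x _ _ _ v u0' u0') !(hit_split_y _ _ _ v u0' u0').
Qed.

Definition dyadic_square (n : nat) (k l : int) : set (R * R) :=
  rectangle (k%:~R / 2 ^+ n) (l%:~R / 2 ^+ n) (2 ^- n) (2 ^- n).

(** Four equivalent squares of half the side fill a square, so each halving from the unit square
    divides the hit by 4 asymptotically. Dyadic sides suffice, since dyadic boxes generate the
    sigma-algebra. *)
Lemma hit_dyadic n (x y : R) :
  vanishing (fun v => hit F (box (rectangle x y (2 ^- n) (2 ^- n))) v
    - 4^-1 ^+ n * hit F (box (rectangle 0 0 1 1)) v).
Proof.
elim: n x y => [|n IH] x y.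
  have := equivalent_squares x y 0 0 ltr01.
  by apply: vanishing_ext => v; rewrite expr0 invr1 mul1r.
have p0 : 0 < 2 ^- n.+1 :> R by rewrite invr_gt0 exprn_gt0.
have dbl : 2 ^- n.+1 + 2 ^- n.+1 = 2 ^- n :> R.
  by rewrite exprS; field; rewrite expf_neq0.
have h1 := hit_square_double 0 0 x y p0; rewrite dbl in h1.
have alg (p q r t : R) : 4^-1 * ((p - t * q) - (p - 4 * r)) = r - (4^-1 * t) * q.
  by field.
have := vanishingZ 4^-1 (vanishingB (IH 0 0) h1).
by apply: vanishing_ext => v; rewrite alg -exprS.
Qed.

Lemma hit_basic (W : seq index) e n k l : uniq W ->
  vanishing (fun v => hit F (cylinder W e `*` dyadic_square n k l) v
    - mass m (cylinder W e `*` dyadic_square n k l) * hit F (box (rectangle 0 0 1 1)) v).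
Proof.
move=> uW; have bS : bounded_plane_set (dyadic_square n k l).
  exact: bounded_rectangle.
have h1 := hit_cylinder a0 b0 mF exchange e uW bS.
have h2 := hit_dyadic n (k%:~R / 2 ^+ n) (l%:~R / 2 ^+ n).
have p0 : 0 <= 2 ^- n :> R by rewrite invr_ge0 exprn_ge0.
have massE : mass m (cylinder W e `*` dyadic_square n k l) =
    2^-1 ^+ size W * 4^-1 ^+ n.
  rewrite (mass_cylinder e uW bS) mass_rectangle//; congr (_ * _).
  by rewrite -exprVn -exprMn; congr (_ ^+ _); field.
have alg (p q r s t : R) : (p - s * q) + s * (q - t * r) = p - s * t * r by ring.
have := vanishingD h1 (vanishingZ (2^-1 ^+ size W) h2).
by apply: vanishing_ext => v; rewrite alg massE.
Qed.

End Squares.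

(** * A pi-system of dyadic boxes generating the events *)

Section BasicSets.
Context {R : realType}.

Definition basic_sets : set (set (state R)) :=
  [set E | E = set0 \/ exists W e n k l, uniq W /\
     E = cylinder W e `*` dyadic_square n k l].

Definition dyadic_mem (n : nat) (k : int) (x : R) : bool :=
  k%:~R / 2 ^+ n <= x < k%:~R / 2 ^+ n + 2 ^- n.

Lemma dyadic_squareE n k l (s : R * R) :
  dyadic_square n k l s <-> dyadic_mem n k s.1 /\ dyadic_mem n l s.2.
Proof. by rewrite /dyadic_square /rectangle /dyadic_mem /= !in_itv/=. Qed.

Lemma dyadic_memE n k (x : R) : dyadic_mem n k x = (k%:~R <= x * 2 ^+ n < k%:~R + 1).
Proof.
have p0 : 0 < 2 ^+ n :> R by rewrite exprn_gt0.
rewrite /dyadic_mem ler_pdivrMr//; congr (_ && _).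
by rewrite -[X in _ < _ + X]mul1r -mulrDl ltr_pdivlMr.
Qed.

Lemma dyadic_mem_floor n (x : R) : dyadic_mem n (Num.floor (x * 2 ^+ n)) x.
Proof. by rewrite dyadic_memE -[1]/(1%:~R) -intrD; exact: floor_itv. Qed.

Lemma dyadic_mem_nested n n' k k' (x y : R) : (n <= n')%N ->
  dyadic_mem n' k' x -> dyadic_mem n' k' y -> dyadic_mem n k x -> dyadic_mem n k y.
Proof.
move=> nn'; rewrite !dyadic_memE -(subnK nn') exprD.
pose c : int := 2 ^+ (n' - n).
have cE : c%:~R = 2 ^+ (n' - n) :> R by rewrite rmorphXn.
have c0 : 0 < c%:~R :> R by rewrite cE exprn_gt0.
rewrite -cE => /andP[x1 x2] /andP[y1 y2] /andP[h1 h2].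
have E (z : R) : z * (c%:~R * 2 ^+ n) = (z * 2 ^+ n) * c%:~R by ring.
rewrite !E in x1 x2 y1 y2.
have k1 : k * c <= k'.
  rewrite -ltzD1 -(ltr_int R) intrD intrM; apply: le_lt_trans x2.
  by rewrite ler_pM2r.
have k2 : k' < (k + 1) * c.
  rewrite -(ltr_int R) intrM intrD; apply: le_lt_trans x1 _.
  by rewrite ltr_pM2r.
apply/andP; split.
  by rewrite -(ler_pM2r c0) (le_trans _ y1)// -intrM ler_int.
rewrite -(ltr_pM2r c0); apply: lt_le_trans y2 _.
by rewrite -[1]/(1%:~R) -!intrD -intrM ler_int lezD1.
Qed.

Lemma dyadic_square_nested n n' k k' l l' (s : R * R) : (n <= n')%N ->
  dyadic_square n k l s -> dyadic_square n' k' l' s ->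
  dyadic_square n' k' l' `<=` (dyadic_square n k l : set (R * R)).
Proof.
move=> nn' /dyadic_squareE[h1 h2] /dyadic_squareE[h3 h4] t /dyadic_squareE[h5 h6].
apply/dyadic_squareE; split; first exact: dyadic_mem_nested h3 h5 h1.
exact: dyadic_mem_nested h4 h6 h2.
Qed.

(** Two dyadic squares that meet are nested, so the smaller one is the intersection. *)
Lemma basic_sets_setI : setI_closed basic_sets.
Proof.
suff H W e n k l W' e' n' k' l' : (n <= n')%N -> uniq W -> uniq W' ->
    basic_sets ((cylinder W e `*` dyadic_square n k l) `&`
      (cylinder W' e' `*` dyadic_square n' k' l')).
  move=> A B [->|[W [e [n [k [l [uW ->]]]]]]]; first by rewrite set0I; left.
  move=> [->|[W' [e' [n' [k' [l' [uW' ->]]]]]]]; first by rewrite setI0; left.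
  by have [nn'|/ltnW nn'] := leqP n n'; [|rewrite setIC]; exact: H.
move=> nn' uW uW'; rewrite -setXI.
have [[s [Ds D's]]|nD] := pselect (exists s : R * R,
    dyadic_square n k l s /\ dyadic_square n' k' l' s); last first.
  left; apply/seteqP; split=> // -[w s] [_ [Ds D's]]; apply: nD.
  by exists s.
rewrite (setIidr (dyadic_square_nested nn' Ds D's)).
have : cylinders (cylinder W e `&` cylinder W' e').
  by apply: cylinders_setI; right; [exists W, e|exists W', e'].
case=> [->|[W2 [e2 [uW2 ->]]]]; first by left; rewrite set0X.
by right; exists W2, e2, n', k', l'.
Qed.

Lemma basic_sets_measurable : basic_sets `<=` measurable.
Proof.
move=> _ [->//|[W [e [n [k [l [uW ->]]]]]]].
apply: measurableX; first exact: measurable_cylinder.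
exact: measurable_rectangle.
Qed.

Let basic_type := g_sigma_algebraType basic_sets.

Let basic_bigcup (I : countType) (A : I -> set (state R)) :
  (forall i, <<s basic_sets >> (A i)) -> <<s basic_sets >> (\bigcup_i A i).
Proof.
move=> bA; have := @countable_bigcupT_measurable _ basic_type I A.
by apply => //; exact: bA.
Qed.

Let basic_bit p : <<s basic_sets >> [set z : state R | z.1 p].
Proof.
rewrite (_ : mkset _ = \bigcup_(kl : int * int)
    (cylinder [:: p] (fun=> true) `*` dyadic_square 0 kl.1 kl.2)).
  apply: basic_bigcup => kl; apply: sub_sigma_algebra; right.
  by exists [:: p], (fun=> true), 0%N, kl.1, kl.2.
apply/seteqP; split=> -[w s] /=.
  move=> wp; exists (Num.floor (s.1 * 2 ^+ 0), Num.floor (s.2 * 2 ^+ 0)) => //.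
  split; first by move=> q; rewrite inE => /eqP ->.
  by apply/dyadic_squareE; split; exact: dyadic_mem_floor.
by move=> [_ _ [h _]]; have := h p (mem_head _ _).
Qed.

Let dyadic_inner (x y : R) : x < y -> exists n (k : int),
  dyadic_mem n k y /\ x < k%:~R / 2 ^+ n.
Proof.
move=> xy; pose n := (Num.truncn ((y - x)^-1)).+1.
have yx : 0 < y - x by rewrite subr_gt0.
have nE : 2 ^- n < y - x.
  rewrite invf_plt ?posrE ?exprn_gt0//.
  apply: lt_trans (truncnS_gt _) _; rewrite -natrX ltr_nat; exact: ltn_expl.
exists n, (Num.floor (y * 2 ^+ n)); have h := dyadic_mem_floor n y; split=> //.
move: h => /andP[_ h]; lra.
Qed.

Let basic_coord (f : R * R -> R) (x : R) : f = fst \/ f = snd ->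
  <<s basic_sets >> [set z : state R | x < f z.2].
Proof.
(* An open half-plane is the union of the dyadic squares that it contains; the other indices
   contribute the empty set. *)
move=> ff; rewrite (_ : mkset _ = \bigcup_(i : nat * int * int)
    (if `[< dyadic_square i.1.1 i.1.2 i.2 `<=` [set s | x < f s] >] then
       cylinder [::] (fun=> true) `*` dyadic_square i.1.1 i.1.2 i.2 else set0)).
  apply: basic_bigcup => -[[n k] l]; case: ifP => _; apply: sub_sigma_algebra.
    by right; exists [::], (fun=> true), n, k, l.
  by left.
apply/seteqP; split=> -[w s] /=; last first.
  move=> [[[n k] l] _]; case: ifP => // /asboolP /= sub [_ h]; exact: sub.
move=> xs; have [n [k [kn xk]]] := dyadic_inner xs.
case: ff => ff; rewrite {}ff in xs kn *.
  exists (n, k, Num.floor (s.2 * 2 ^+ n)) => //=.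
  rewrite ifT; last first.
    by apply/asboolP => t /dyadic_squareE [/andP[h _] _] /=; exact: lt_le_trans h.
  by split=> //; apply/dyadic_squareE; split=> //; exact: dyadic_mem_floor.
exists (n, Num.floor (s.1 * 2 ^+ n), k) => //=.
rewrite ifT; last first.
  by apply/asboolP => t /dyadic_squareE [_ /andP[h _]] /=; exact: lt_le_trans h.
by split=> //; apply/dyadic_squareE; split=> //; exact: dyadic_mem_floor.
Qed.

Lemma measurable_basic_sets : @measurable _ (state R) = <<s basic_sets >>.
Proof.
apply/seteqP; split; last first.
  apply: smallest_sub; first exact: sigma_algebra_measurable.
  exact: basic_sets_measurable.
(* The inclusion is read as measurability of the identity from the space with the generated
   sigma-algebra, which can be checked on each coordinate. *)
have mid : measurable_fun setT (id : basic_type -> state R).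
  apply/measurable_fun_pairP; split.
    by apply: measurable_fun_bits => p; rewrite setTI; exact: basic_bit.
  apply/measurable_fun_pairP; split.
    apply: (measurability _ (RGenOInfty.measurableE R)) => _ [_ [x ->] <-].
    rewrite setTI (_ : _ @^-1` _ = [set z : state R | x < fst z.2]).
      by apply: basic_coord; left.
    by apply/seteqP; split=> z /=; rewrite in_itv/= andbT.
  apply: (measurability _ (RGenOInfty.measurableE R)) => _ [_ [x ->] <-].
  rewrite setTI (_ : _ @^-1` _ = [set z : state R | x < snd z.2]).
    by apply: basic_coord; right.
  by apply/seteqP; split=> z /=; rewrite in_itv/= andbT.
by move=> A mA; have := mid measurableT A mA; rewrite setTI.
Qed.

End BasicSets.

Section MassSeries.
Context d (T : measurableType d) (R : realType) (m : {measure set T -> \bar R}).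

Lemma mass_bigsetU (A : (set T)^nat) n : (forall k, finite_mass m (A k)) ->
  trivIset setT A -> finite_mass m (\big[setU/set0]_(k < n) A k) /\
  mass m (\big[setU/set0]_(k < n) A k) = \sum_(k < n) mass m (A k).
Proof.
move=> fA tA; elim: n => [|n [IH1 IH2]].
  by rewrite !big_ord0 /finite_mass /mass measure0; split.
rewrite !big_ord_recr /= -IH2; split; last first.
  apply: massU => //; apply/seteqP; split=> // x.
  rewrite -(bigcup_mkord n A) => -[[k /= kn Ak] An].
  have kn' : k = n by apply: tA => //; exists x.
  by rewrite kn' ltnn in kn.
split; first by apply: measurableU; [exact: IH1.1|exact: (fA n).1].
apply: le_lt_trans (measureU2 _ IH1.1 (fA n).1) _.
by rewrite lte_add_pinfty//; [exact: IH1.2|exact: (fA n).2].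
Qed.

Lemma mass_tail (A : (set T)^nat) (eps : R) : 0 < eps ->
  (forall k, measurable (A k)) -> trivIset setT A ->
  finite_mass m (\bigcup_k A k) ->
  exists n, mass m (\bigcup_k A k `\` \big[setU/set0]_(k < n) A k) <= eps.
Proof.
move=> e0 mA tA fU.
have fA k : finite_mass m (A k).
  by apply: (finite_massS (mA k) fU); exact: bigcup_sup.
have cv := @measure_semi_sigma_additive _ _ _ m A mA tA fU.1.
have cf : fine (\sum_(0 <= i < n) m (A i))%E @[n --> \oo] --> mass m (\bigcup_k A k).
  by apply: fine_cvg; rewrite /mass fineK//; exact: finite_mass_num.
move: cf => /cvgrPdist_le /(_ _ e0) [n _ /(_ n (leqnn n))].
rewrite /= => h; exists n.
have [f1 f2] := mass_bigsetU n fA tA.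
have sub : \big[setU/set0]_(k < n) A k `<=` \bigcup_k A k.
  by rewrite -bigcup_mkord => x [k _ Ak]; exists k.
have := mass_split fU f1.1; rewrite (setIidr sub) -setDE => E.
have E2 : fine (\sum_(0 <= i < n) m (A i))%E = mass m (\big[setU/set0]_(k < n) A k).
  rewrite f2 big_mkord sum_fine// => i _; exact: finite_mass_num.
rewrite E2 in h; rewrite /mass in E h *.
apply: le_trans (le_trans (ler_norm _) h); rewrite E.
lra.
Qed.

End MassSeries.

(** * Mixing against one invariant event *)

Section SetMixing.
Context {R : realType} (a b : R).
Hypotheses (a0 : 0 < a) (b0 : 0 < b).
Local Notation m := (state_measure R).
Local Notation reindex := (reindex a b).
Local Notation Delta := (fundamental_domain a b).
Local Notation saturation := (saturation a b).
Local Notation unit_box := ([set: bits index] `*` rectangle (0 : R) 0 1 1).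
Hypothesis dense : forall x delta : R, 0 < delta ->
  exists i j : int, `|x - (i%:~R * a + j%:~R * b)| <= delta.

Section FixedEvent.
Variable F : set (state R).
Hypotheses (mF : measurable F) (iF : forall n, reindex n @^-1` F = F).
Hypothesis exchange : forall p q r (E : set (state R)), same_side p q -> 0 <= r ->
  measurable E -> E `<=` slab r ->
  vanishing (fun v => mass m (swap_state p q @^-1` E `&` flow v @^-1` F)
    - mass m (E `&` flow v @^-1` F)).

(** Uniform distribution up to a density: the factor [hit F unit_box v] stays unknown here, and only
    [event_mixing] eliminates it. *)
Let good (E : set (state R)) : Prop :=
  vanishing (fun v => hit F E v - mass m E * hit F unit_box v).

Let finite_unit : finite_mass m unit_box.
Proof. exact: finite_mass_rectangle. Qed.

Let hit_unit v : `|hit F unit_box v| <= 1.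
Proof.
have := hit_le mF v finite_unit; rewrite mass_rectangle// ?mulr1//.
Qed.

(** A hit never exceeds the mass, so the tail of the union is negligible uniformly in [v]. *)
Lemma good_bigcup (A : (set (state R))^nat) : (forall k, measurable (A k)) ->
  trivIset setT A -> finite_mass m (\bigcup_k A k) ->
  (forall k, good (A k)) -> good (\bigcup_k A k).
Proof.
move=> mA tA fU gA; apply: vanishing_approx => eps eps0.
have e2 : 0 < eps / 2 by rewrite divr_gt0.
have [n hn] := mass_tail e2 mA tA fU.
have fA k : finite_mass m (A k).
  by apply: (finite_massS (mA k) fU); exact: bigcup_sup.
set B := \big[setU/set0]_(k < n) A k in hn.
have [fB massB] := mass_bigsetU n fA tA.
have sub : B `<=` \bigcup_k A k.
  by rewrite /B -bigcup_mkord => x [k _ Ak]; exists k.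
pose C := \bigcup_k A k `\` B.
have mC : measurable C by apply: measurableD; [exact: fU.1|exact: fB.1].
have fC : finite_mass m C by apply: (finite_massS mC fU); exact: subDsetl.
have UE : \bigcup_k A k = B `|` C by rewrite /C setDUK.
have BC : B `&` C = set0 by rewrite /C setDIK.
exists (fun v => \sum_(k < n) (hit F (A k) v - mass m (A k) * hit F unit_box v)).
  exact: (@vanishing_sum _ n (fun k v => hit F (A k) v - mass m (A k) * hit F unit_box v)).
move=> v.
have hitB : hit F B v = \sum_(k < n) hit F (A k) v.
  have fAF k : finite_mass m (A k `&` flow v @^-1` F) := hit_finite mF v (fA k).
  have tAF : trivIset setT (fun k => A k `&` flow v @^-1` F).
    by move=> k l _ _ [x [[Ak _] [Al _]]]; apply: tA => //; exists x.
  rewrite -(mass_bigsetU n fAF tAF).2 /hit; congr (mass m _).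
  rewrite /B -(bigcup_mkord n A) -(bigcup_mkord n (fun k => A k `&` flow v @^-1` F)).
  by rewrite setI_bigcupl.
have hitE : hit F (\bigcup_k A k) v = hit F B v + hit F C v.
  by rewrite UE; exact: (hitU mF v fB fC BC).
have massE : mass m (\bigcup_k A k) = mass m B + mass m C.
  by rewrite {1}UE; exact: (massU fB fC BC).
rewrite hitE massE hitB massB sumrB -mulr_suml.
have alg (x y z t u : R) : x + y - (z + t) * u - (x - z * u) = y - t * u by ring.
have prod_le (x y : R) : 0 <= x -> `|y| <= 1 -> `|x * y| <= x.
  by move=> x0 y1; rewrite normrM (ger0_norm x0) ler_piMr.
have h1 := le_trans (hit_le mF v fC) hn.
have h2 := le_trans (prod_le _ _ (mass_ge0 m C) (hit_unit v)) hn.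
rewrite alg (splitr eps); apply: le_trans (ler_normB _ _) _.
exact: (lerD h1 h2).
Qed.

Lemma good_setD E E' : finite_mass m E -> measurable E' -> E' `<=` E ->
  good E -> good E' -> good (E `\` E').
Proof.
move=> fE mE' E'E gE gE'; have fE' := finite_massS mE' fE E'E.
have fD : finite_mass m (E `\` E').
  apply: (finite_massS _ fE); last exact: subDsetl.
  by apply: measurableD; [exact: fE.1|].
have UE : E = E' `|` (E `\` E') by rewrite setDUK.
have DE : E' `&` (E `\` E') = set0 by rewrite setDIK.
have massE : mass m E = mass m E' + mass m (E `\` E').
  by rewrite {1}UE; exact: (massU fE' fD DE).
have hitE v : hit F E v = hit F E' v + hit F (E `\` E') v.
  by rewrite {1}UE; exact: (hitU mF v fE' fD DE).
apply: vanishing_ext (vanishingB gE gE') => v; rewrite hitE massE.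
move: (hit F E' v) (hit F (E `\` E') v) (mass m E') (mass m (E `\` E')) (hit F _ v).
by move=> x y z t u; ring.
Qed.

Let good_basic E : basic_sets E -> good E.
Proof.
move=> [->|[W [e [n [k [l [uW ->]]]]]]]; last first.
  exact: (hit_basic a0 b0 mF iF exchange dense).
apply: vanishing_ext vanishing0 => v.
by rewrite /hit set0I /mass measure0 mul0r subrr.
Qed.

Let cell_box (k l : int) : set (state R) :=
  cylinder [::] (fun=> true) `*` dyadic_square 0 k l.

Let finite_cell_box k l : finite_mass m (cell_box k l).
Proof.
apply: finite_mass_box; first exact: measurable_cylinder.
exact: bounded_rectangle.
Qed.

Let basic_cell_box k l : basic_sets (cell_box k l).
Proof. by right; exists [::], (fun=> true), 0%N, k, l. Qed.

(** The state space has infinite mass; inside one unit box complements keep finite mass and Dynkin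
    induction applies. *)
Let good_in_cell k l E : measurable E -> good (E `&` cell_box k l).
Proof.
move=> mE.
have fk := finite_cell_box k l.
have mk : measurable (cell_box k l) := fk.1.
apply: (@dynkin_induction _ _ basic_sets (fun E => good (E `&` cell_box k l))).
- exact: measurable_basic_sets.
- exact: basic_sets_setI.
- by rewrite setTI; exact: good_basic.
- by move=> A bA; apply: good_basic; apply: basic_sets_setI.
- move=> A mA gA.
  have -> : ~` A `&` cell_box k l = cell_box k l `\` (A `&` cell_box k l).
    by rewrite setDIr setDv setU0 setDE setIC.
  apply: (good_setD fk _ _ _ gA); last exact: (good_basic (basic_cell_box k l)).
    exact: measurableI mA mk.
  exact: subIsetr.
- move=> A mA tA gA; rewrite setI_bigcupl; apply: (good_bigcup _ _ _ gA).
  + by move=> n; exact: measurableI (mA n) mk.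
  + by move=> i j _ _ [x [[Ai _] [Aj _]]]; apply: tA => //; exists x.
  + rewrite -setI_bigcupl; apply: (finite_massS _ fk); last exact: subIsetr.
    by apply: measurableI mk; exact: bigcupT_measurable.
by rewrite -measurable_basic_sets.
Qed.

Lemma good_finite E : finite_mass m E -> good E.
Proof.
move=> fE.
pose A n : set (state R) :=
  if pickle_inv n is Some kl then E `&` cell_box kl.1 kl.2 else set0.
have EA : E = \bigcup_n A n.
  apply/seteqP; split=> [[w s] Es|z [n _]]; last first.
    by rewrite /A; case: (pickle_inv n) => // kl [].
  exists (pickle (Num.floor (s.1 * 2 ^+ 0), Num.floor (s.2 * 2 ^+ 0))); first by [].
  rewrite /A pickleK_inv; split; first exact: Es.
  split; first by move=> q; rewrite inE.
  by apply/dyadic_squareE; split; exact: dyadic_mem_floor.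
have mA n : measurable (A n).
  rewrite /A; case: (pickle_inv n) => // kl.
  by apply: measurableI; [exact: fE.1|exact: (finite_cell_box _ _).1].
rewrite EA; apply: (good_bigcup mA); last 2 first.
- by rewrite -EA; exact: fE.
- move=> n; rewrite /A; case: (pickle_inv n) => [kl|].
    by apply: good_in_cell; exact: fE.1.
  by apply: good_basic; left.
move=> i j _ _ [[w s] []]; rewrite /A.
case ei : (pickle_inv i) => [[k l]|//]; case ej : (pickle_inv j) => [[k' l']|//].
move=> [_ [_ /dyadic_squareE[/= h1 h2]]] [_ [_ /dyadic_squareE[/= h3 h4]]].
have uniqk k1 k2 (x : R) : dyadic_mem 0 k1 x -> dyadic_mem 0 k2 x -> k1 = k2.
  rewrite !dyadic_memE -[1]/(1%:~R) -!intrD => /andP[u1 u2] /andP[u3 u4].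
  have := le_lt_trans u1 u4; have := le_lt_trans u3 u2; rewrite !ltr_int !ltzD1.
  by move=> k21 k12; apply/eqP; rewrite eq_le k12 k21.
have := @pickle_invK (int * int)%type i; have := @pickle_invK (int * int)%type j.
by rewrite ei ej /= (uniqk _ _ _ h1 h3) (uniqk _ _ _ h2 h4) => <-.
Qed.

(** Exact for every [v]: flowing back by [v] replaces [Delta] by another fundamental domain, and an
    invariant event has the same mass in both. *)
Lemma hit_domain v : hit F Delta v = mass m (F `&` Delta).
Proof.
have mD := @measurable_domain R a b.
have mDF : measurable (Delta `&` flow v @^-1` F).
  by apply: measurableI => //; exact: measurable_flowF.
rewrite /hit -(mass_flow (- v) mDF).
have -> : flow (- v) @^-1` (Delta `&` flow v @^-1` F) = F `&` flow (- v) @^-1` Delta.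
  apply/seteqP; split=> -[w s]; rewrite /flow /skew /=.
    by move=> [h1 h2]; split=> //; move: h2; rewrite addrNK.
  by move=> [h1 h2]; split=> //; rewrite addrNK.
exact: (congr1 fine (invariant_measure_translate a0 b0 (- v) (conj mF iF))).
Qed.

Let finite_domain : finite_mass m Delta.
Proof.
split; first exact: measurable_domain.
have := domain_measure_fin a0 b0; rewrite ge0_fin_numE//.
Qed.

Let mass_domain_gt0 : 0 < mass m Delta.
Proof.
have := domain_measure_gt0 a0 b0.
by rewrite -(fineK (domain_measure_fin a0 b0)) lte_fin.
Qed.

Lemma event_mixing E : measurable E ->
  vanishing (fun v => mass m (E `&` Delta `&` flow v @^-1` F)
    - mass m (E `&` Delta) * (mass m (F `&` Delta) / mass m Delta)).
Proof.
move=> mE.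
have fE : finite_mass m (E `&` Delta).
  apply: (finite_massS _ finite_domain); last exact: subIsetr.
  by apply: measurableI => //; exact: measurable_domain.
have g1 := good_finite fE; have g2 := good_finite finite_domain.
(* Combined in this proportion, the two estimates cancel the unknown hit of the unit box. *)
have := vanishingB g1 (vanishingZ (mass m (E `&` Delta) / mass m Delta) g2).
apply: vanishing_ext => v; rewrite hit_domain -/(hit F (E `&` Delta) v).
move: mass_domain_gt0.
move: (hit F (E `&` Delta) v) (mass m (E `&` Delta)) (mass m Delta) (hit F _ v).
by move=> x y z t z0; move: (mass m (F `&` Delta)) => u; field; rewrite gt_eqF.
Qed.

End FixedEvent.

End SetMixing.

(** Dirichlet's pigeonhole argument yields a combination of [a] and [b] of size at most [delta],
    nonzero by irrationality; its multiples are then [delta]-dense. *)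
Lemma lattice_dense (R : realType) (a b : R) : 0 < a -> 0 < b -> irrational (a / b) ->
  forall x delta : R, 0 < delta ->
  exists i j : int, `|x - (i%:~R * a + j%:~R * b)| <= delta.
Proof.
move=> a0 b0 irr x delta d0.
have [i [j [g0 gd]]] : exists i j : int, 0 < i%:~R * a + j%:~R * b /\
    i%:~R * a + j%:~R * b <= delta.
  (* Two of the multiples 0, ..., [N] of [a / b] have fractional parts in the same bin of length
     [1 / N]; their difference gives a combination of size at most [b / N <= delta]. *)
  pose N := (Num.truncn (b / delta)).+1.
  have N0 : 0 < N%:R :> R by rewrite ltr0n.
  have bN : b / N%:R <= delta.
    rewrite ler_pdivrMr// mulrC -ler_pdivrMr// ltW//; exact: truncnS_gt.
  pose u (n : nat) := n%:R * a / b - (Num.floor (n%:R * a / b))%:~R.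
  have u01 n : 0 <= u n < 1.
    have /andP[h1 h2] := floor_itv (n%:R * a / b).
    by rewrite intrD in h2; apply/andP; split; rewrite /u; lra.
  pose c n := Num.truncn (u n * N%:R).
  have cP n : (c n)%:R <= u n * N%:R < (c n).+1%:R.
    by apply: truncn_itv; apply: mulr_ge0; [case/andP: (u01 n)|exact: ltW].
  have cN n : (c n < N)%N.
    rewrite -(ltr_nat R); have /andP[h _] := cP n; apply: le_lt_trans h _.
    by rewrite -[ltRHS]mul1r ltr_pM2r//; case/andP: (u01 n).
  pose f (n : 'I_N.+1) : 'I_N := Ordinal (cN n).
  have [n [k [nk fnk]]] : exists n k : 'I_N.+1, n != k /\ f n = f k.
    apply: contrapT => h; have inj : injective f.
      move=> n k fnk; apply/eqP/negPn/negP => nk; apply: h; by exists n, k.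
    by have := leq_card f inj; rewrite !card_ord ltnn.
  have cnk : c n = c k by have := congr1 val fnk.
  pose p : int := n%:Z - k%:Z.
  pose q : int := Num.floor (k%:R * a / b) - Num.floor (n%:R * a / b).
  pose g := p%:~R * a + q%:~R * b.
  have gE : g = (u n - u k) * b.
    by rewrite /g /u /p /q !intrB; field; rewrite gt_eqF.
  have gneq : g != 0.
    apply/eqP => g0; apply: irr.
    have p0 : p%:~R != 0 :> R.
      rewrite intr_eq0 /p subr_eq0; apply: contraNneq nk => h.
      by apply/eqP/val_inj; exact: (congr1 absz h).
    exists ((- q)%:~R / p%:~R) => //; rewrite rmorphM /= fmorphV /= !ratr_int.
    have : p%:~R * a = (- q)%:~R * b.
      by move: g0; rewrite /g => /eqP; rewrite addr_eq0 => /eqP ->; rewrite mulrNz mulNr.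
    move=> h; have -> : a = (- q)%:~R * b / p%:~R by rewrite -h; field.
    by field; rewrite p0 gt_eqF.
  have gN : `|g| <= delta.
    apply: le_trans bN; rewrite gE normrM (gtr0_norm b0) mulrC ler_pM2l//.
    have /andP[h1 h2] := cP n; have /andP[h3 h4] := cP k; rewrite cnk in h1 h2.
    rewrite -natr1 in h2 h4.
    have E : (u n - u k) * N%:R = u n * N%:R - u k * N%:R by ring.
    rewrite -(ler_pM2r N0) mulVf ?gt_eqF// -[X in _ * X](gtr0_norm N0) -normrM E.
    by rewrite ler_norml; apply/andP; split; lra.
  have [gpos|gneg] := ltP 0 g.
    by exists p, q; split=> //; apply: le_trans gN; exact: ler_norm.
  exists (- p), (- q); rewrite !mulrNz !mulNr -opprD -/g oppr_gt0 lt_neqAle gneq gneg.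
  by split=> //; apply: le_trans gN; rewrite -normrN ler_norm.
pose g := i%:~R * a + j%:~R * b; pose n := Num.floor (x / g).
exists (n * i), (n * j).
have -> : (n * i)%:~R * a + (n * j)%:~R * b = n%:~R * g by rewrite !intrM /g; ring.
have /andP[h1 h2] := floor_itv (x / g); rewrite -/n intrD in h1 h2.
rewrite ler_pdivlMr// in h1; rewrite ltr_pdivrMr// in h2.
rewrite /g in h1 h2 *.
by rewrite ler_norml; apply/andP; split; lra.
Qed.

Lemma bigsetU_setIl (T : Type) (A : (set T)^nat) (B : set T) n :
  \big[setU/set0]_(k < n) (A k `&` B) = \big[setU/set0]_(k < n) A k `&` B.
Proof.
by elim: n => [|n IH]; rewrite ?big_ord0 ?set0I// !big_ord_recr /= setIUl IH.
Qed.

(** * Mixing for all invariant events *)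

Section SaturationMixing.
Context {R : realType} (a b : R).
Hypotheses (a0 : 0 < a) (b0 : 0 < b).
Local Notation m := (state_measure R).
Local Notation reindex := (reindex a b).
Local Notation Delta := (fundamental_domain a b).
Local Notation saturation := (saturation a b).
Hypothesis dense : forall x delta : R, 0 < delta ->
  exists i j : int, `|x - (i%:~R * a + j%:~R * b)| <= delta.

Lemma finite_mass_domain : finite_mass m Delta.
Proof.
split; first exact: measurable_domain.
by have := domain_measure_fin a0 b0; rewrite ge0_fin_numE.
Qed.

Lemma mass_domain_gt0 : 0 < mass m Delta.
Proof.
have := domain_measure_gt0 a0 b0.
by rewrite -(fineK (domain_measure_fin a0 b0)) lte_fin.
Qed.

Lemma local_basic_set B : basic_sets B -> exists M, local_set M (B : set (state R)).
Proof.
move=> [->|[W [e [n [k [l [uW ->]]]]]]]; first by exists 0%N.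
exists (\max_(r <- W) `|r.2|%N) => w w' s h [/= Ww Ss]; split=> //= r rW.
rewrite -h ?Ww//; exact: (@leq_bigmax_seq _ _ xpredT (fun r : index => `|r.2|%N)).
Qed.

Definition mixing_defect (E F : set (state R)) (v : R * R) : R :=
  mass m (E `&` Delta `&` flow v @^-1` F)
    - mass m (E `&` Delta) * (mass m (F `&` Delta) / mass m Delta).

Let finite_part E : measurable E -> finite_mass m (E `&` Delta).
Proof.
move=> mE; apply: (finite_massS _ finite_mass_domain); last exact: subIsetr.
exact: measurableI mE finite_mass_domain.1.
Qed.

Let finite_flow_part E F v : measurable E -> measurable F ->
  finite_mass m (E `&` Delta `&` flow v @^-1` F).
Proof.
move=> mE mF; apply: (finite_massS _ (finite_part mE)); last exact: subIsetl.
exact: measurableI (finite_part mE).1 (measurable_flowF mF v).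
Qed.

Lemma mixing_defectT E v : mixing_defect E setT v = 0.
Proof.
have D0 := mass_domain_gt0; rewrite /mixing_defect preimage_setT setIT setTI.
move: (mass m (E `&` Delta)) (mass m Delta) D0 => x y y0.
by rewrite divff ?mulr1 ?subrr// gt_eqF.
Qed.

Lemma mixing_defectU E F F' v : measurable E -> measurable F -> measurable F' ->
  F `&` F' = set0 ->
  mixing_defect E (F `|` F') v = mixing_defect E F v + mixing_defect E F' v.
Proof.
move=> mE mF mF' FF'; rewrite /mixing_defect.
have -> : mass m ((F `|` F') `&` Delta) = mass m (F `&` Delta) + mass m (F' `&` Delta).
  rewrite setIUl; apply: (massU (finite_part mF) (finite_part mF')).
  by rewrite setIACA setIid FF' set0I.
have -> : mass m (E `&` Delta `&` flow v @^-1` (F `|` F')) =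
    mass m (E `&` Delta `&` flow v @^-1` F) + mass m (E `&` Delta `&` flow v @^-1` F').
  rewrite preimage_setU setIUr.
  apply: (massU (finite_flow_part v mE mF) (finite_flow_part v mE mF')).
  by rewrite setIACA setIid -preimage_setI FF' preimage_set0 setI0.
move: (mass m (F `&` Delta)) (mass m (F' `&` Delta)) (mass m (E `&` Delta)) (mass m Delta).
move: (mass m (E `&` Delta `&` flow v @^-1` F)) (mass m (E `&` Delta `&` flow v @^-1` F')).
by move=> x y z t u s; rewrite mulrDl; ring.
Qed.

(** By [hit_domain], invariance of [F] bounds the correlation term by the mass of [F] in the domain,
    uniformly in [v]; the product term obeys the same bound. *)
Lemma mixing_defect_le E F v : measurable E -> invariant_events a b F ->
  `|mixing_defect E F v| <= mass m (F `&` Delta).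
Proof.
move=> mE [mF iF]; have D0 := mass_domain_gt0.
have h1 : mass m (E `&` Delta `&` flow v @^-1` F) <= mass m (F `&` Delta).
  rewrite -(hit_domain a0 b0 mF iF v) /hit; apply: mass_le.
  - exact: (finite_flow_part v mE mF).1.
  - exact: (hit_finite mF v finite_mass_domain).
  - by move=> z [[_ ?] ?].
have h2 : mass m (E `&` Delta) <= mass m Delta.
  by apply: mass_le; [exact: (finite_part mE).1|exact: finite_mass_domain|exact: subIsetr].
rewrite /mixing_defect; move: h1 h2.
have := mass_ge0 m (E `&` Delta `&` flow v @^-1` F).
have := mass_ge0 m (E `&` Delta); have := mass_ge0 m (F `&` Delta).
move: (mass m (E `&` Delta `&` flow v @^-1` F)) (mass m (E `&` Delta)) D0.
move: (mass m (F `&` Delta)) (mass m Delta) => f d x e d0 f0 e0 x0 xf ed.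
have h : 0 <= e * (f / d) <= f.
  apply/andP; split; first by rewrite mulr_ge0// divr_ge0// ltW.
  by rewrite mulrA ler_pdivrMr// mulrC ler_wpM2l.
by case/andP: h => ? ?; rewrite ler_norml; apply/andP; split; lra.
Qed.

Lemma mixing_defect_bigsetU E (F : (set (state R))^nat) n v : measurable E ->
  (forall k, measurable (F k)) -> trivIset setT F ->
  mixing_defect E (\big[setU/set0]_(k < n) F k) v = \sum_(k < n) mixing_defect E (F k) v.
Proof.
move=> mE mF tF; elim: n => [|n IH].
  rewrite !big_ord0 /mixing_defect preimage_set0 setI0 set0I /mass measure0.
  by rewrite mul0r mulr0 subrr.
rewrite !big_ord_recr /= mixing_defectU// ?IH//.
  exact: bigsetU_measurable.
apply/seteqP; split=> // x; rewrite -(bigcup_mkord n F) => -[[k /= kn Fk] Fn].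
have kn' : k = n by apply: tF => //; exists x.
by rewrite kn' ltnn in kn.
Qed.

(** Exchanging bits only helps when the event near [v] depends on finitely many bits, which holds
    for saturations of basic sets. The induction runs over [B], since saturation respects the Dynkin
    operations and every invariant event is its own saturation. *)
Lemma saturation_mixing (B : set (state R)) : measurable B ->
  forall E, measurable E -> vanishing (mixing_defect E (saturation B)).
Proof.
move=> mB; apply: (@dynkin_induction _ _ basic_sets
  (fun B => forall E, measurable E -> vanishing (mixing_defect E (saturation B)))).
- exact: measurable_basic_sets.
- exact: basic_sets_setI.
- move=> E mE; apply: vanishing_ext vanishing0 => v.
  rewrite (saturation_id a0 b0 (fun n => preimage_setT _)).
  by rewrite mixing_defectT.
- move=> A bA E mE; have mA := basic_sets_measurable bA.
  have [M lA] := local_basic_set bA.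
  have [mF iF] := saturation_invariant a b mA.
  apply: (event_mixing a0 b0 dense mF iF _ mE).
  by move=> p q r E' pq r0 mE' E'r; exact: (exchange_vanishing a0 b0 mA lA pq r0 mE' E'r).
- move=> A mA vA E mE; apply: vanishing_ext (vanishingZ (-1) (vA E mE)) => v.
  have [mF iF] := saturation_invariant a b mA.
  have mF' : measurable (~` saturation A) := measurableC mF.
  rewrite (saturationC a0 b0); apply/eqP; rewrite mulN1r eq_sym -addr_eq0 addrC.
  rewrite -(mixing_defectU v mE mF mF' (setICr _)) setUv.
  by rewrite mixing_defectT.
- move=> A mA tA vA E mE; rewrite saturation_bigcup.
  have invA k : invariant_events a b (saturation (A k)) := saturation_invariant a b (mA k).
  have mS k : measurable (saturation (A k)) := (invA k).1.
  have tS : trivIset setT (fun k => saturation (A k)).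
    move=> i j _ _ [x]; rewrite -(saturationI a0 b0) => -[n _ [[Ai Aj] _]].
    by apply: tA => //; exists (reindex n x).
  have mU : measurable (\bigcup_k saturation (A k)) by exact: bigcupT_measurable.
  apply: vanishing_approx => eps eps0.
  have fD := finite_part mU; rewrite setI_bigcupl in fD.
  have [] := @mass_tail _ _ _ m (fun k => saturation (A k) `&` Delta) eps eps0 _ _ fD.
  + by move=> k; exact: (finite_part (mS k)).1.
  + by move=> i j _ _ [x [[Ai _] [Aj _]]]; apply: tS => //; exists x.
  move=> n hn; set Fn := \big[setU/set0]_(k < n) saturation (A k).
  have mFn : measurable Fn by apply: bigsetU_measurable => k _; exact: mS.
  exists (fun v => \sum_(k < n) mixing_defect E (saturation (A k)) v).
    apply: (@vanishing_sum _ n (fun k v => mixing_defect E (saturation (A k)) v)) => k.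
    exact: vA.
  move=> v; rewrite -(mixing_defect_bigsetU n v mE mS tS) -/Fn.
  (* The tail of the union is itself invariant, so [mixing_defect_le] makes its defect small for all
     [v] at once. *)
  pose C := \bigcup_k saturation (A k) `\` Fn.
  have mC : measurable C := measurableD mU mFn.
  have iC : invariant_events a b C.
    split=> // k.
    have UI : reindex k @^-1` (\bigcup_k saturation (A k)) = \bigcup_k saturation (A k).
      by rewrite preimage_bigcup; apply: eq_bigcupr => i _; exact: (invA i).2.
    have FI : reindex k @^-1` Fn = Fn.
      rewrite /Fn -(bigcup_mkord n (fun k => saturation (A k))) preimage_bigcup.
      by apply: eq_bigcupr => i _; exact: (invA i).2.
    by rewrite /C setDE preimage_setI -preimage_setC UI FI.
  have sub : Fn `<=` \bigcup_k saturation (A k).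
    by rewrite /Fn -(bigcup_mkord n (fun k => saturation (A k))) => x [k _ h]; exists k.
  have UE : \bigcup_k saturation (A k) = Fn `|` C by rewrite /C setDUK.
  rewrite {1}UE (mixing_defectU v mE mFn mC); last by rewrite /C setDIK.
  rewrite addrAC subrr add0r; apply: le_trans (mixing_defect_le v mE iC) _.
  apply: le_trans hn; rewrite le_eqVlt; apply/orP; left; apply/eqP; congr (mass m _).
  apply: (etrans _ (congr1 (setD _) (esym (bigsetU_setIl (fun k => saturation (A k)) Delta n)))).
  rewrite -/Fn /C -setI_bigcupl; apply/seteqP; split=> x.
    by move=> [[h1 h2] h3]; split=> // -[].
  by move=> [[h1 h3] h2]; split=> //; split=> // h4; apply: h2.
by rewrite -measurable_basic_sets.
Qed.

End SaturationMixing.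

(** * The tilings *)

Section Plane.
Context {R : realType}.
Implicit Types (p q : placed_tile R) (s x : R * R).

Lemma measurable_open_plane (U : set (R * R)) : open U -> measurable U.
Proof.
move=> oU.
have -> : U = \bigcup_(t : nat * int * int) ([set s | dyadic_square t.1.1 t.1.2 t.2 s] `&`
    [set _ | dyadic_square t.1.1 t.1.2 t.2 `<=` U]).
  apply/seteqP; split=> [s Us|s [t _ [h]]]; last exact.
  have /nbhs_ballP[e /= e0 eU] : nbhs s U by apply: open_nbhs_nbhs.
  pose n := (Num.truncn e^-1).+1.
  have ne : 2 ^- n < e :> R.
    rewrite -[ltRHS]invrK ltf_pV2 ?posrE ?invr_gt0 ?exprn_gt0//.
    apply: (lt_trans (truncnS_gt e^-1)); rewrite -/n -natrX ltr_nat.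
    exact: ltn_expl.
  exists (n, Num.floor (s.1 * 2 ^+ n), Num.floor (s.2 * 2 ^+ n)) => //; split=> /=.
    by apply/dyadic_squareE; split; exact: dyadic_mem_floor.
  have near (y z : R) : dyadic_mem n (Num.floor (y * 2 ^+ n)) z -> ball y e z.
    have /andP[h1 h2] := dyadic_mem_floor n y; move=> /andP[h3 h4].
    by rewrite -ball_normE /= ltr_norml; apply/andP; split; lra.
  by move=> t /dyadic_squareE[h1 h2]; apply: eU; split; exact: near.
apply: countable_bigcupT_measurable => // t; apply: measurableI.
  exact: measurable_rectangle.
have [h|h] := pselect (dyadic_square t.1.1 t.1.2 t.2 `<=` U).
  by rewrite (_ : mkset _ = setT)//; apply/seteqP; split.
by rewrite (_ : mkset _ = set0)//; apply/seteqP; split.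
Qed.

(** A point on an edge leaves the rectangle when pushed outwards by half the radius of a ball around
    it. *)
Lemma region_edge p x : region p x ->
  [\/ x.1 = p.2.1, x.1 = p.2.1 + width p.1, x.2 = p.2.2 | x.2 = p.2.2 + height p.1] ->
  boundary (region p) x.
Proof.
move=> px edge; split; first exact: subset_closure.
rewrite /interior /= => /nbhs_ballP[e /= e0 ep].
have e2 : 0 < e / 2 by rewrite divr_gt0.
have in_ball (u v : R) : `|u| <= e / 2 -> `|v| <= e / 2 -> region p (x.1 + u, x.2 + v).
  move=> hu hv; apply: ep; split; rewrite -ball_normE /= opprD addNKr normrN;
    by apply: le_lt_trans hu _ || apply: le_lt_trans hv _; lra.
have h0 : `|0 : R| <= e / 2 by rewrite normr0 ltW.
have hp : `|e / 2| <= e / 2 by rewrite ger0_norm// ltW.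
have hn : `|- (e / 2) : R| <= e / 2 by rewrite normrN ger0_norm// ltW.
case: edge => E.
- by have [/= /andP[]] := in_ball _ _ hn h0; lra.
- by have [/= /andP[]] := in_ball _ _ hp h0; lra.
- by have [/= _ /andP[]] := in_ball _ _ h0 hn; lra.
- by have [/= _ /andP[]] := in_ball _ _ h0 hp; lra.
Qed.

End Plane.

(** * The tiling attached to a state *)

Section Tilings.
Context {R : realType} (A B : tile R).
Hypotheses (wA_hB : width A = height B) (wB_hA : width B = height A).
Local Notation a := (width A).
Local Notation b := (height A).

Definition tile_of (kind : bool) : tile R := if kind then B else A.

Definition tiling (z : state R) : configuration R :=
  [set p | exists kind n, present kind n z.1 /\
     p = (tile_of kind, tile_corner a b kind n z.1 - z.2)].

Lemma width_tile_of kind : width (tile_of kind) = tile_width a b kind.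
Proof. by case: kind. Qed.

Lemma height_tile_of kind : height (tile_of kind) = tile_height a b kind.
Proof. by case: kind => /=; rewrite ?wA_hB. Qed.

Lemma tiling_flow v z : tiling (flow v z) = Defs.shift v (tiling z).
Proof.
apply/seteqP; split=> p.
  move=> [kind [n [pn ->]]]; exists (tile_of kind, tile_corner a b kind n z.1 - z.2).
    by exists kind, n.
  by congr pair; rewrite /= opprD addrA.
move=> [q [kind [n [pn ->]]] <-]; exists kind, n; split=> //.
by congr pair; rewrite /= opprD addrA.
Qed.

Lemma tiling_reindex n z : tiling (reindex a b n z) = tiling z.
Proof.
have E kind k : tile_corner a b kind k (reindex a b n z).1 - (reindex a b n z).2 =
    tile_corner a b kind (n + k) z.1 - z.2.
  by rewrite tile_corner_add /reindex /skew /= opprB addrCA addrA.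
apply/seteqP; split=> p [kind [k [pk ->]]].
  by exists kind, (n + k); rewrite present_add -E.
exists kind, (k - n); have kE : k = n + (k - n) by rewrite addrC subrK.
by rewrite E -kE; split=> //; rewrite kE present_add in pk.
Qed.

(** Invariance of the preimages under [reindex], required of events of the quotient, is
    [tiling_reindex]. *)
Lemma measurable_tiling :
  measurable_fun [set: tiling_system a b] (tiling : tiling_system a b -> configuration R).
Proof.
apply: (measurability (@hitting_events R : set (set (configuration R)))) => //.
move=> _ [_ [t [U [oU ->]] <-]]; rewrite setTI; apply/measurable_systemP; split.
  have -> : tiling @^-1` [set y | exists2 c, U c & y (t, c)] =
      \bigcup_(i : bool * (int * int)) (([set w | present i.1 i.2 w] `*` setT `&`
        [set z : state R | U (- (z.2 - tile_corner a b i.1 i.2 z.1))]) `&`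
        [set _ | tile_of i.1 = t]).
    apply/seteqP; split=> z.
      move=> [c Uc [kind [n [pn [tE cE]]]]]; exists (kind, n) => //.
      by split=> //; split=> //; rewrite /= opprB -cE.
    move=> [[kind n] _ [[[/= pn _] Un] tE]]; exists (- (z.2 - tile_corner a b kind n z.1)) => //.
    by exists kind, n; rewrite tE opprB.
  apply: countable_bigcupT_measurable => // -[kind n] /=; apply: measurableI.
    apply: measurableI.
      by apply: measurableX => //; exact: measurable_present.
    apply: (@measurable_relative_position _ _ [set s | U (- s)]).
      exact: measurable_tile_corner.
    have mopp : measurable_fun [set: R * R] (fun s : R * R => - s).
      apply: measurable_fun_pair; apply: measurable_funN.
        exact: measurable_fst.
      exact: measurable_snd.
    by rewrite -[X in measurable X]setTI; apply: mopp => //; exact: measurable_open_plane.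
  have [h|h] := pselect (tile_of kind = t).
    by rewrite (_ : mkset _ = setT)//; apply/seteqP; split.
  by rewrite (_ : mkset _ = set0)//; apply/seteqP; split.
by move=> n; apply/seteqP; split=> z; rewrite /preimage /= tiling_reindex.
Qed.

Lemma tiling_is_tiling z : tiling_space [set A; B] (tiling z).
Proof.
have a0 := width_gt0 A; have b0 := height_gt0 A.
split.
- by move=> _ [[] [n [_ ->]]]; [right|left].
- apply/seteqP; split=> // q _.
  have [n [kind [pn]]] := cell_cover a0 b0 z.1 (q + z.2).
  move=> [/= /andP[h1 h2] /andP[h3 h4]].
  exists (tile_of kind, tile_corner a b kind n z.1 - z.2); first by exists kind, n.
  rewrite /region /= width_tile_of height_tile_of.
  by split; apply/andP; split; lra.
move=> _ _ [k [n [pn ->]]] [k' [n' [pn' ->]]] ne x [px qx].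
have : (k, n) <> (k', n') by case=> ek en; apply: ne; rewrite ek en.
move=> /(tiles_separated a0 b0 pn pn').
rewrite /separated -!width_tile_of -!height_tile_of.
move: (px) (qx); rewrite {1 2}/region /=.
move=> [/andP[h1 h2] /andP[h3 h4]] [/andP[h5 h6] /andP[h7 h8]].
by case=> [|[|[]]] s; split; apply: region_edge => //=;
  do ?[apply: Or41; lra|apply: Or42; lra|apply: Or43; lra|apply: Or44; lra].
Qed.

End Tilings.

(** * The measure preserving action *)

Lemma mnormalizeE d (T : measurableType d) (R : realType)
    (mu : {measure set T -> \bar R}) (P : probability T R) E :
  (0 < mu setT < +oo)%E -> mnormalize mu P E = (mu E * (fine (mu setT))^-1%:E)%E.
Proof. by move=> /andP[m0 moo]; rewrite /mnormalize gt_eqF//= lt_eqF. Qed.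

Lemma pushforward_mrestrE d d' (T : measurableType d) (T' : measurableType d')
    (R : realType) (mu : {measure set T -> \bar R}) D (mD : measurable D)
    (f : T -> T') (mf : measurable_fun setT f) E :
  measure_function_pushforward__canonical__measure_function_Measure (mrestr mu mD) mf E =
  mu (f @^-1` E `&` D).
Proof. by []. Qed.

Section System.
Context {R : realType} (a b : R).
Local Notation m := (state_measure R).
Local Notation Delta := (fundamental_domain a b).
Local Notation X := (tiling_system a b).

Let measurable_to_system : measurable_fun setT (id : state R -> X).
Proof. by move=> _ E /measurable_systemP[mE _]; rewrite setTI. Qed.

Definition domain_measure : {measure set X -> \bar R} :=
  measure_function_pushforward__canonical__measure_function_Measure
    (mrestr m (measurable_domain a b)) measurable_to_system.

(** The Dirac mass is the default of [mnormalize] for a total mass that is zero or infinite, which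
    [system_measureE] rules out. *)
Definition system_measure : probability X R :=
  mnormalize domain_measure (\d_ (point : X)).

(** A section of the quotient: it turns measurability on the coarser space of invariant events into
    measurability on states. The default 0 of [xget] is never taken, because every orbit meets
    [Delta]. *)
Definition representative (z : X) : state R :=
  reindex a b (xget 0 [set n | Delta (reindex a b n z)]) z.

Definition system_flow (v : R * R) (z : X) : X := flow v z.

Lemma invariant_flow E n v z : invariant_events a b E ->
  E (flow v (reindex a b n z)) = E (flow v z).
Proof. by move=> [_ iE]; rewrite -[in RHS](iE n) /preimage /= reindex_flow. Qed.

Hypotheses (a0 : 0 < a) (b0 : 0 < b).

Lemma system_measureE E : measurable E ->
  system_measure E = (mass m (E `&` Delta) / mass m Delta)%:E.
Proof.
move=> mE; have D0 := domain_measure_gt0 a0 b0; have Dfin := domain_measure_fin a0 b0.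
have /measurable_systemP[mE' _] := mE.
have fE : m (E `&` Delta) \is a fin_num.
  have fD := finite_mass_domain a0 b0.
  have fI : finite_mass m (E `&` Delta).
    by apply: (finite_massS (measurableI _ _ mE' (measurable_domain a b)) fD); exact: subIsetr.
  exact: (finite_mass_num fI).
have DT : domain_measure setT = m Delta by rewrite /domain_measure pushforward_mrestrE preimage_setT setTI.
have DE : domain_measure E = m (E `&` Delta) by exact: (pushforward_mrestrE m (measurable_domain a b) measurable_to_system E).
have h : (0 < domain_measure setT < +oo)%E.
  by rewrite DT; apply/andP; split; [exact: D0|rewrite ltey_eq Dfin].
apply: etrans (mnormalizeE (\d_ (point : X)) E h) _.
rewrite DT DE; apply: etrans (esym (EFinM _ _)).
by rewrite /mass (fineK fE).
Qed.

Lemma measurable_representative : measurable_fun setT representative.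
Proof.
move=> _ B mB; rewrite setTI; apply/measurable_systemP.
have -> : representative @^-1` B = saturation a b B.
  apply/seteqP; split=> z.
    rewrite /representative /preimage /=; case: xgetP => [n _ Dn|no] Bz.
      by exists n.
    by have [n Dn] := domain_cover a0 b0 z; case: (no n).
  move=> [n _ [Bn Dn]]; rewrite /representative /preimage /=; case: xgetP => [k _ Dk|no].
    by rewrite (domain_unique a0 b0 Dk Dn).
  by case: (no n).
exact: saturation_invariant.
Qed.

(* Invariant events do not distinguish a state from its representative. *)
Lemma measurable_system_flow :
  measurable_fun [set: (R * R) * X] (fun p => system_flow p.1 p.2).
Proof.
move=> _ E /measurable_systemP[mE iE]; rewrite setTI.
pose f (p : (R * R) * state R) : state R := (p.2.1, p.2.2 + p.1).
pose g (p : (R * R) * X) : (R * R) * state R := (p.1, representative p.2).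
have mf : measurable_fun setT f.
  have m1 : measurable_fun [set: (R * R) * state R] (fst : _ -> R * R) := measurable_fst.
  have m2 : measurable_fun [set: (R * R) * state R] (fun p => p.2.2).
    exact: (measurableT_comp measurable_snd measurable_snd).
  apply: measurable_fun_pair.
    exact: (measurableT_comp measurable_fst measurable_snd).
  apply: measurable_fun_pair; apply: measurable_funD;
    do ?[exact: (measurableT_comp measurable_fst)|exact: (measurableT_comp measurable_snd)].
have mg : measurable_fun setT g.
  apply: measurable_fun_pair; first exact: measurable_fst.
  exact: (measurableT_comp measurable_representative measurable_snd).
have -> : (fun p : (R * R) * X => system_flow p.1 p.2) @^-1` E = (f \o g) @^-1` E.
  by apply/funext => -[v z]; exact: (esym (@invariant_flow E _ v z (conj mE iE))).
by rewrite -[X in measurable X]setTI; exact: (measurableT_comp mf mg).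
Qed.

Lemma system_measure_flow v E : measurable E ->
  system_measure (system_flow v @^-1` E) = system_measure E.
Proof.
move=> mE.
have mFE : measurable (system_flow v @^-1` E).
  have /measurable_systemP[mE' iE] := mE; apply/measurable_systemP; split.
    by apply: preimage_measurable => //; exact: measurable_flow.
  by move=> n; apply/funext => z; exact: (@invariant_flow E n v z (conj mE' iE)).
rewrite (system_measureE mFE) (system_measureE mE).
suff -> : mass m (system_flow v @^-1` E `&` Delta) = mass m (E `&` Delta) by [].
have /measurable_systemP iE := mE; have [mE' _] := iE.
apply: etrans (congr1 fine (invariant_measure_translate a0 b0 (- v) iE)).
have mEv : measurable ((flow v @^-1` E : set (state R)) `&` Delta).
  by apply: measurableI (measurable_domain a b); have /measurable_systemP[] := mFE.
apply: etrans (esym (mass_flow (- v) mEv)) _.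
suff -> : flow (- v) @^-1` (flow v @^-1` E `&` Delta) = E `&` flow (- v) @^-1` Delta by [].
by apply/funext => z; rewrite /flow /skew /preimage /setI /mkset /= subrK -surjective_pairing.
Qed.

Lemma system_measure_preserving : measure_preserving_action system_measure system_flow.
Proof.
split.
- by move=> [w s]; rewrite /system_flow /flow /skew /= addr0.
- by move=> v w [x s]; rewrite /system_flow /flow /skew /= addrA addrAC.
- exact: measurable_system_flow.
- by move=> v E mE; exact: system_measure_flow.
Qed.

End System.

(** * Mixing on events implies mixing on square integrable functions *)

Section StepFunctions.
Context d (X : measurableType d) (R : realType).
Implicit Types (f g : X -> R).

Definition step_function f : Prop :=
  exists n (c : nat -> R) (E : (set X)^nat), (forall k, measurable (E k)) /\
    f = fun x => \sum_(k < n) c k * \1_(E k) x.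

Lemma step_bounded_measurable f : step_function f -> bounded_measurable f.
Proof.
move=> [n [c [E [mE ->]]]].
apply: (@bounded_measurable_sum _ _ _ n (fun k x => c k * \1_(E k) x)) => k.
apply: bounded_measurableM; first exact: bounded_measurable_cst.
exact: bounded_measurable_indic.
Qed.

(** A grid of mesh [1 / n.+1] in the values of [f], offset so that the natural numbers [k] below
    [2 * n.+1 ^ 2] cover the values from [- n.+1] to [n.+1]. Outside this range [step_approx] is
    0. *)
Definition level f (n k : nat) : set X :=
  [set x | k%:R <= n.+1%:R * f x + (n.+1 ^ 2)%:R < k.+1%:R].

Definition step_approx f n (x : X) : R :=
  \sum_(k < 2 * n.+1 ^ 2) ((k%:R - (n.+1 ^ 2)%:R) / n.+1%:R) * \1_(level f n k) x.

Lemma measurable_level f n k : measurable_fun setT f -> measurable (level f n k).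
Proof.
move=> mf; have mg : measurable_fun setT (fun x => n.+1%:R * f x + (n.+1 ^ 2)%:R).
  by apply: measurable_funD => //; exact: measurable_funM.
have := mg measurableT `[k%:R, k.+1%:R[%classic (measurable_itv _).
by rewrite setTI; congr measurable; apply/seteqP; split=> x; rewrite /level /= in_itv.
Qed.

Lemma step_approx_step f n : measurable_fun setT f -> step_function (step_approx f n).
Proof.
move=> mf; exists (2 * n.+1 ^ 2)%N, (fun k => (k%:R - (n.+1 ^ 2)%:R) / n.+1%:R), (level f n).
by split=> // k; exact: measurable_level.
Qed.

Lemma level_unique f n k l x : level f n k x -> level f n l x -> k = l.
Proof.
rewrite /level /= => /andP[h1 h2] /andP[h3 h4].
have := le_lt_trans h1 h4; have := le_lt_trans h3 h2; rewrite !ltr_nat !ltnS => lk kl.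
by apply/eqP; rewrite eqn_leq lk kl.
Qed.

Lemma step_approxE f n x :
  step_approx f n x = 0 \/ `|f x - step_approx f n x| <= n.+1%:R^-1.
Proof.
have N0 : 0 < n.+1%:R :> R by rewrite ltr0n.
have [[k Lk]|nL] := pselect (exists k : 'I_(2 * n.+1 ^ 2), level f n k x); last first.
  left; rewrite /step_approx big1// => k _; rewrite indicE memNset ?mulr0// => Lk.
  by apply: nL; exists k.
right; rewrite /step_approx (bigD1 k)//= big1 ?addr0; last first.
  move=> l lk; rewrite indicE memNset ?mulr0// => Ll; move/eqP: lk; apply.
  exact/val_inj/(level_unique Ll Lk).
rewrite indicE mem_set// mulr1; move: Lk; rewrite /level /= -[k.+1%:R]natr1 => /andP[h1 h2].
have -> : f x - (k%:R - (n.+1 ^ 2)%:R) / n.+1%:R =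
    (n.+1%:R * f x + (n.+1 ^ 2)%:R - k%:R) / n.+1%:R.
  by field; rewrite gt_eqF.
rewrite normrM ger0_norm ?subr_ge0// gtr0_norm ?invr_gt0// ler_piMl//.
by rewrite lerBlDl ltW.
Qed.

Lemma step_approx_near f n x : `|f x| < n.+1%:R ->
  `|f x - step_approx f n x| <= n.+1%:R^-1.
Proof.
rewrite ltr_norml => /andP[f1 f2].
have N0 : 0 < n.+1%:R :> R by rewrite ltr0n.
pose y := n.+1%:R * f x + (n.+1 ^ 2)%:R.
have NN : (n.+1 ^ 2)%:R = n.+1%:R * n.+1%:R :> R by rewrite -mulnn natrM.
have y0 : 0 <= y by rewrite /y NN -mulrDr mulr_ge0 ?ltW//; lra.
have y2 : y < (2 * n.+1 ^ 2)%:R.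
  rewrite natrM /y NN -mulrDr [ltRHS]mulrCA ltr_pM2l//; lra.
have /andP[h1 h2] := truncn_itv y0.
have kK : (Num.truncn y < 2 * n.+1 ^ 2)%N.
  by rewrite -(ltr_nat R); exact: le_lt_trans y2.
(* In the range of the grid, the value 0 arises only from the level [k = n.+1 ^ 2], where [f] itself
   is smaller than the mesh. *)
have [s0|//] := step_approxE f n x.
rewrite s0 subr0; have := s0; rewrite /step_approx (bigD1 (Ordinal kK))//= big1 ?addr0; last first.
  move=> l lk; rewrite indicE memNset ?mulr0// => Ll; move/eqP: lk; apply.
  by apply: val_inj; apply: (level_unique Ll); apply/andP.
rewrite indicE mem_set ?mulr1; last by apply/andP.
move=> /eqP; rewrite mulf_eq0 invr_eq0 (gt_eqF N0) orbF subr_eq0 => /eqP kE.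
rewrite -[(Num.truncn y).+1%:R]natr1 kE /y in h2; rewrite kE /y in h1.
rewrite ger0_norm; last first.
  by rewrite -(pmulr_rge0 _ N0); lra.
rewrite -[leRHS]mul1r ler_pdivlMr// mulrC; lra.
Qed.

Lemma step_approx_cvg f x : step_approx f n x @[n --> \oo] --> f x.
Proof.
apply/cvgrPdist_le => e e0; near=> n.
have h : (Num.truncn (`|f x| + e^-1) <= n)%N by near: n; exact: nbhs_infty_ge.
have hn : `|f x| + e^-1 < n.+1%:R.
  by apply: lt_le_trans (truncnS_gt _) _; rewrite ler_nat ltnS.
have ei : 0 < e^-1 by rewrite invr_gt0.
apply: le_trans (step_approx_near _) _; first by have := normr_ge0 (f x); lra.
rewrite -[leRHS]invrK lef_pV2 ?posrE ?ltr0n//; have := normr_ge0 (f x); lra.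
Unshelve. all: by end_near. Qed.

(** The integrable majorant for dominated convergence: the approximation is 0, or its error is at
    most the mesh and hence at most 1. *)
Lemma step_approx_error f n x : (f x - step_approx f n x) ^+ 2 <= 1 + f x ^+ 2.
Proof.
have [->|h] := step_approxE f n x; first by rewrite subr0 lerDr.
rewrite -real_normK ?num_real// (le_trans (_ : _ <= 1)) ?lerDl ?sqr_ge0//.
rewrite expr_le1// (le_trans h)// invf_le1 ?ltr0n// ler1n//.
Qed.

End StepFunctions.

Section SquareIntegrable.
Context d (X : measurableType d) (R : realType) (mu : probability X R).
Implicit Types (f g : X -> R).
Local Notation I f := (\int[mu]_x f x).
Local Notation integrable f := (mu.-integrable setT (EFin \o f)).

Definition square_integrable f : Prop :=
  measurable_fun setT f /\ integrable (fun x => f x ^+ 2).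

Lemma integrable_dominated f g : measurable_fun setT f -> integrable g ->
  (forall x, `|f x| <= g x) -> integrable f.
Proof.
move=> mf ig h; apply: (le_integrable measurableT _ _ ig).
  exact/measurable_EFinP.
by move=> x _ /=; rewrite lee_fin (le_trans (h x))// ler_norm.
Qed.

Lemma integrableDr f g : integrable f -> integrable g -> integrable (fun x => f x + g x).
Proof. by move=> hf hg; exact: (integrableD measurableT hf hg). Qed.

Lemma integrableZr c f : integrable f -> integrable (fun x => c * f x).
Proof. by move=> hf; exact: (integrableZl measurableT c hf). Qed.

Lemma integrable_measurable f : integrable f -> measurable_fun setT f.
Proof. by move=> /integrableP[/measurable_EFinP]. Qed.

Let mass_lty : (mu setT < +oo)%E. Proof. by rewrite probability_setT ltry. Qed.

Lemma integrable_cst c : integrable (fun=> c).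
Proof.
exact: (bounded_measurable_integrable measurableT mass_lty (bounded_measurable_cst X c)).
Qed.

Lemma square_integrable_bounded f : bounded_measurable f -> square_integrable f.
Proof.
move=> bf; split; first exact: bf.1.
apply: (bounded_measurable_integrable measurableT mass_lty).
exact: bounded_measurableM.
Qed.

Lemma square_integrableD f g : square_integrable f -> square_integrable g ->
  square_integrable (fun x => f x + g x).
Proof.
move=> [mf f2] [mg g2]; split; first exact: measurable_funD.
apply: (@integrable_dominated _ (fun x => 2 * (f x ^+ 2) + 2 * (g x ^+ 2))).
- by apply: measurable_funX; exact: measurable_funD.
- by apply: integrableDr; exact: integrableZr.
move=> x; rewrite ger0_norm ?sqr_ge0//; have := sqr_ge0 (f x - g x).
move: (f x) (g x) => y z; nra.
Qed.

Lemma square_integrableZ c f : square_integrable f -> square_integrable (fun x => c * f x).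
Proof.
move=> [mf f2]; split; first exact: measurable_funM.
have -> : (fun x => (c * f x) ^+ 2) = (fun x => c ^+ 2 * f x ^+ 2).
  by apply/funext => x; rewrite exprMn.
exact: integrableZr.
Qed.

Lemma square_integrableB f g : square_integrable f -> square_integrable g ->
  square_integrable (fun x => f x - g x).
Proof.
move=> hf hg; have := square_integrableD hf (square_integrableZ (-1) hg).
by congr square_integrable; apply/funext => x; rewrite mulN1r.
Qed.

Lemma integrable_prod f g : square_integrable f -> square_integrable g ->
  integrable (fun x => f x * g x).
Proof.
move=> [mf f2] [mg g2].
apply: (@integrable_dominated _ (fun x => f x ^+ 2 + g x ^+ 2)).
- exact: measurable_funM.
- exact: integrableDr.
move=> x; have := sqr_ge0 (f x - g x); have := sqr_ge0 (f x + g x).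
by move: (f x) (g x) => y z; rewrite ler_norml => *; apply/andP; split; nra.
Qed.

Lemma square_integrable_integrable f : square_integrable f -> integrable f.
Proof.
move=> hf; have h1 := square_integrable_bounded (bounded_measurable_cst X 1).
have := integrable_prod hf h1.
by congr mu.-integrable; apply/funext => x /=; rewrite mulr1.
Qed.

Lemma Rintegral_sqr_ge0 f : 0 <= I (fun x => f x ^+ 2).
Proof. by apply: Rintegral_ge0 => x _; exact: sqr_ge0. Qed.

(* AM-GM: [|f g| <= e^-1 f^2 + e g^2] *)
Lemma Rintegral_prod_small f g e : square_integrable f -> square_integrable g ->
  0 < e -> I (fun x => f x ^+ 2) <= e ^+ 2 ->
  `|I (fun x => f x * g x)| <= e * (1 + I (fun x => g x ^+ 2)).
Proof.
move=> hf hg e0 fe; have ifg := integrable_prod hf hg.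
have i1 := integrableZr e^-1 hf.2; have i2 := integrableZr e hg.2.
apply: le_trans (le_normr_Rintegral measurableT ifg) _.
apply: (@le_trans _ _ (I (fun x => e^-1 * f x ^+ 2 + e * g x ^+ 2))).
  apply: le_Rintegral => //; [|exact: integrableDr|].
    apply: (integrable_dominated _ (integrableDr hf.2 hg.2)).
      by apply: measurableT_comp => //; exact: integrable_measurable.
    move=> x; rewrite normr_id; have := sqr_ge0 (f x - g x); have := sqr_ge0 (f x + g x).
    by move: (f x) (g x) => y z; rewrite ler_norml => *; apply/andP; split; nra.
  move=> x _; rewrite normrM -[f x ^+ 2]real_normK ?num_real//.
  rewrite -[g x ^+ 2]real_normK ?num_real//.
  move: `|f x| `|g x| (normr_ge0 (f x)) (normr_ge0 (g x)) => y z y0 z0.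
  have h := sqr_ge0 (y - e * z).
  have E : e^-1 * y ^+ 2 + e * z ^+ 2 - y * z = e^-1 * ((y - e * z) ^+ 2 + e * (y * z)).
    by field; rewrite gt_eqF.
  rewrite -subr_ge0 E mulr_ge0 ?invr_ge0 ?(ltW e0)//.
  by rewrite addr_ge0// mulr_ge0 ?(ltW e0)// mulr_ge0.
rewrite RintegralD// RintegralZl ?RintegralZl//; [|exact: hg.2|exact: hf.2].
have h : e^-1 * I (fun x => f x ^+ 2) <= e.
  by rewrite ler_pdivrMl// -expr2.
by rewrite mulrDr mulr1 lerD2r.
Qed.

Lemma Rintegral_small f e : square_integrable f -> 0 < e ->
  I (fun x => f x ^+ 2) <= e ^+ 2 -> `|I f| <= 2 * e.
Proof.
move=> hf e0 fe; have h1 := square_integrable_bounded (bounded_measurable_cst X 1).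
have := Rintegral_prod_small hf h1 e0 fe.
have -> : I (fun x => f x * cst 1 x) = I f by apply: eq_Rintegral => x _; rewrite mulr1.
have -> : I (fun x => (cst 1 x : R) ^+ 2) = 1.
  rewrite (@eq_Rintegral _ _ _ mu setT (cst 1)); last by move=> x _; rewrite expr1n.
  by rewrite Rintegral_cst// mul1r; exact: (congr1 fine (probability_setT mu)).
by rewrite mulrC.
Qed.

Lemma step_approximation f e : square_integrable f -> 0 < e ->
  exists2 s, step_function s & I (fun x => (f x - s x) ^+ 2) <= e.
Proof.
move=> [mf f2] e0.
have ms n : measurable_fun setT (step_approx f n).
  exact: (step_bounded_measurable (step_approx_step n mf)).1.
have md n : measurable_fun setT (fun x => (f x - step_approx f n x) ^+ 2).
  by apply: measurable_funX; apply: measurable_funB.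
have ig : integrable (fun x => 1 + f x ^+ 2) by apply: integrableDr => //; exact: integrable_cst.
pose F n x : \bar R := ((f x - step_approx f n x) ^+ 2)%:E.
have mF n : measurable_fun setT (F n) by apply/measurable_EFinP; exact: md.
have F0 : {ae mu, forall x, setT x -> F ^~ x @ \oo --> (0%E : \bar R)}.
  apply: aeW => x _; apply/fine_cvgP; split; first by near=> n.
  have c1 : (fun n => f x - step_approx f n x) @ \oo --> (0 : R).
    by rewrite -(subrr (f x)); apply: cvgB; [exact: cvg_cst|exact: step_approx_cvg].
  have c2 := cvgM c1 c1; rewrite mulr0 in c2.
  by under eq_cvg => n do rewrite /F /= expr2; exact: c2.
have Fg : {ae mu, forall x n, setT x -> (`|F n x| <= (1 + f x ^+ 2)%:E)%E}.
  apply: aeW => x n _; rewrite /F /= lee_fin ger0_norm ?sqr_ge0//.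
  exact: step_approx_error.
have [_ _] := @dominated_convergence _ _ _ mu setT measurableT F (cst 0%E) _ mF
  (measurable_cst _) F0 ig Fg.
rewrite integral0 => /fine_cvgP[_] /cvgrPdist_le /(_ _ e0) [n _ /(_ n (leqnn n))].
rewrite /= sub0r normrN => h.
exists (step_approx f n); first exact: step_approx_step.
by apply: le_trans h; exact: ler_norm.
Unshelve. all: by end_near. Qed.

End SquareIntegrable.

Section SetMixing.
Context d (X : measurableType d) (R : realType) (mu : probability X R).
Variable T : R * R -> X -> X.
Implicit Types (f g : X -> R).
Local Notation I f := (\int[mu]_x f x).
Local Notation integrable f := (mu.-integrable setT (EFin \o f)).
Local Notation square_integrable := (square_integrable mu).
Hypotheses (mT : forall v, measurable_fun setT (T v))
  (T_preserving : forall v E, measurable E -> mu (T v @^-1` E) = mu E).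
Hypothesis set_mixing : forall E F : set X, measurable E -> measurable F ->
  vanishing (fun v => fine (mu (E `&` T v @^-1` F)) - fine (mu E) * fine (mu F)).

Let integral_action v (f : X -> \bar R) : measurable_fun setT f ->
  (forall x, 0 <= f x)%E -> (\int[mu]_x f (T v x) = \int[mu]_x f x)%E.
Proof.
move=> mf f0.
have := @ge0_integral_pushforward _ _ _ _ _ _ (mT v) mu setT f measurableT mf (fun x _ => f0 x).
rewrite preimage_setT => <-; apply: eq_measure_integral => A mA _.
exact: (T_preserving v mA).
Qed.

Lemma integrable_action v f : integrable f -> integrable (f \o T v).
Proof.
move=> /integrableP[mf fi]; apply/integrableP; split.
  exact: (measurableT_comp mf (mT v)).
rewrite (integral_action v (f := fun x => `|(EFin \o f) x|%E))//.
exact: measurableT_comp.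
Qed.

Lemma Rintegral_action v f : integrable f -> I (f \o T v) = I f.
Proof.
move=> fi; rewrite /Rintegral; congr fine.
have mf : measurable_fun setT (EFin \o f) by case/integrableP: fi.
have := @integral_pushforward _ _ _ _ _ _ (mT v) mu setT (EFin \o f) mf _ measurableT.
rewrite preimage_setT => <-; last exact: integrable_action.
by apply: eq_measure_integral => A mA _; exact: (T_preserving v mA).
Qed.

Lemma square_integrable_action v f : square_integrable f -> square_integrable (f \o T v).
Proof.
by move=> [mf f2]; split; [exact: measurableT_comp|exact: (integrable_action v f2)].
Qed.

Definition correlation f g v : R := I (fun x => f x * g (T v x)) - I f * I g.

Lemma correlationDl f f' g v : square_integrable f -> square_integrable f' ->
  square_integrable g ->
  correlation (fun x => f x + f' x) g v = correlation f g v + correlation f' g v.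
Proof.
move=> hf hf' hg; have hgT := square_integrable_action v hg.
rewrite /correlation (RintegralD measurableT (square_integrable_integrable hf)
  (square_integrable_integrable hf')).
under eq_Rintegral do rewrite mulrDl.
rewrite (RintegralD measurableT (integrable_prod hf hgT) (integrable_prod hf' hgT)).
rewrite /comp; ring.
Qed.

Lemma correlationDr f g g' v : square_integrable f -> square_integrable g ->
  square_integrable g' ->
  correlation f (fun x => g x + g' x) v = correlation f g v + correlation f g' v.
Proof.
move=> hf hg hg'; have hgT := square_integrable_action v hg.
have hgT' := square_integrable_action v hg'.
rewrite /correlation (RintegralD measurableT (square_integrable_integrable hg)
  (square_integrable_integrable hg')).
under eq_Rintegral do rewrite mulrDr.
rewrite (RintegralD measurableT (integrable_prod hf hgT) (integrable_prod hf hgT')).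
rewrite /comp; ring.
Qed.

Lemma correlationZl c f g v : square_integrable f -> square_integrable g ->
  correlation (fun x => c * f x) g v = c * correlation f g v.
Proof.
move=> hf hg; have hgT := square_integrable_action v hg.
rewrite /correlation (RintegralZl c measurableT (square_integrable_integrable hf)).
under eq_Rintegral do rewrite -mulrA.
rewrite (RintegralZl c measurableT (integrable_prod hf hgT)).
rewrite /comp; ring.
Qed.

Lemma correlationZr c f g v : square_integrable f -> square_integrable g ->
  correlation f (fun x => c * g x) v = c * correlation f g v.
Proof.
move=> hf hg; have hgT := square_integrable_action v hg.
rewrite /correlation (RintegralZl c measurableT (square_integrable_integrable hg)).
under eq_Rintegral do rewrite mulrCA.
rewrite (RintegralZl c measurableT (integrable_prod hf hgT)).
rewrite /comp; ring.
Qed.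

(** Continuity of the correlation in L2, in either argument and uniformly in [v]. The constant 3
    collects 1 from the integral of the product and 2 from the product of the means. *)
Lemma correlation_small f g v e : square_integrable f -> square_integrable g -> 0 < e ->
  I (fun x => f x ^+ 2) <= e ^+ 2 ->
  `|correlation f g v| <= 3 * e * (1 + I (fun x => g x ^+ 2)) /\
  `|correlation g f v| <= 3 * e * (1 + I (fun x => g x ^+ 2)).
Proof.
move=> hf hg e0 fe.
have hfT := square_integrable_action v hf; have hgT := square_integrable_action v hg.
have IfT : I (fun x => f (T v x) ^+ 2) = I (fun x => f x ^+ 2) := Rintegral_action v hf.2.
have IgT : I (fun x => g (T v x) ^+ 2) = I (fun x => g x ^+ 2) := Rintegral_action v hg.2.
have p1 := Rintegral_prod_small hf hgT e0 fe; rewrite /= IgT in p1.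
have p2 : I (fun x => f (T v x) ^+ 2) <= e ^+ 2 by rewrite IfT.
have {}p2 := Rintegral_prod_small hfT hg e0 p2.
have -> : correlation g f v = I (fun x => (f \o T v) x * g x) - I f * I g.
  rewrite /correlation mulrC; congr (_ - _).
  by apply: eq_Rintegral => x _; rewrite mulrC.
have f1 := Rintegral_small hf e0 fe.
have g1 : `|I g| <= 1 + I (fun x => g x ^+ 2).
  have i1 : integrable (fun x => 1 + g x ^+ 2).
    by apply: integrableDr; [exact: integrable_cst|exact: hg.2].
  have ig := square_integrable_integrable hg.
  apply: le_trans (le_normr_Rintegral measurableT ig) _.
  have -> : 1 + I (fun x => g x ^+ 2) = I (fun x => 1 + g x ^+ 2).
    rewrite (RintegralD measurableT (integrable_cst mu 1) hg.2).
    rewrite Rintegral_cst// mul1r; congr (_ + _).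
    exact: (esym (congr1 fine (probability_setT mu))).
  apply: (le_Rintegral measurableT _ i1).
    apply: (integrable_dominated _ i1).
      by apply: measurableT_comp => //; exact: hg.1.
    move=> x; rewrite normr_id.
    by have := sqr_ge0 (g x - 1); have := sqr_ge0 (g x + 1); move: (g x) => y;
      rewrite ler_norml => *; apply/andP; split; nra.
  move=> x _; have := sqr_ge0 (g x - 1); have := sqr_ge0 (g x + 1); move: (g x) => y.
  by rewrite ler_norml => *; apply/andP; split; nra.
have fg : `|I f * I g| <= 2 * e * (1 + I (fun x => g x ^+ 2)).
  by rewrite normrM ler_pM.
have bound x : `|x| <= e * (1 + I (fun x => g x ^+ 2)) ->
    `|x - I f * I g| <= 3 * e * (1 + I (fun x => g x ^+ 2)).
  move=> hx; apply: le_trans (ler_normB _ _) _; apply: le_trans (lerD hx fg) _.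
  by rewrite le_eqVlt; apply/orP; left; apply/eqP; ring.
by split; exact: bound.
Qed.

Lemma square_integrable_step s : step_function s -> square_integrable s.
Proof. by move=> /step_bounded_measurable; exact: square_integrable_bounded. Qed.

Lemma square_integrable_indic E : measurable E -> square_integrable (\1_E).
Proof. by move=> mE; apply/square_integrable_bounded/bounded_measurable_indic. Qed.

Lemma correlation_indic E F v : measurable E -> measurable F ->
  correlation (\1_E) (\1_F) v =
  fine (mu (E `&` T v @^-1` F)) - fine (mu E) * fine (mu F).
Proof.
move=> mE mF; have mTF : measurable (T v @^-1` F).
  by rewrite -[X in measurable X]setTI; exact: mT.
rewrite /correlation.
have -> : (fun x => \1_E x * \1_F (T v x)) = (\1_(E `&` T v @^-1` F) : X -> R).
  by apply/funext => x; rewrite indicI /= !indicE.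
rewrite !Rintegral_indic ?setIT//; exact: measurableI.
Qed.

Lemma vanishing_correlation_step s t : step_function s -> step_function t ->
  vanishing (correlation s t).
Proof.
have sum_step n (c : nat -> R) (E : (set X)^nat) : (forall k, measurable (E k)) ->
    step_function (fun x => \sum_(k < n) c k * \1_(E k) x) by move=> mE; exists n, c, E.
have zero_step : step_function (cst 0 : X -> R).
  exists 0%N, (fun=> 0), (fun=> set0); split=> //.
  by apply/funext => x; rewrite big_ord0.
move=> [n [c [E [mE ->]]]] [p [e [F [mF ->]]]].
have vEF k : vanishing (correlation (fun x => \sum_(k < n) c k * \1_(E k) x) (\1_(F k))).
  elim: n => [|n IH].
    apply: vanishing_ext vanishing0 => v; rewrite /correlation.
    under eq_Rintegral do rewrite big_ord0 mul0r.
    under [X in _ = _ - X * _]eq_Rintegral do rewrite big_ord0.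
    by rewrite !Rintegral_cst// !mul0r subrr.
  have vn : vanishing (correlation (\1_(E n)) (\1_(F k))).
    by apply: vanishing_ext (set_mixing (mE n) (mF k)) => v; rewrite correlation_indic.
  apply: vanishing_ext (vanishingD IH (vanishingZ (c n) vn)) => v.
  rewrite -correlationZl; try exact: square_integrable_indic.
  rewrite -correlationDl; first last.
  - exact: square_integrable_indic.
  - exact/square_integrableZ/square_integrable_indic.
  - exact/square_integrable_step/sum_step.
  by congr (correlation _ _ v); apply/funext => x; rewrite big_ord_recr.
elim: p => [|p IH].
  apply: vanishing_ext vanishing0 => v; rewrite /correlation.
  under eq_Rintegral do rewrite big_ord0 mulr0.
  under [X in _ = _ - _ * X]eq_Rintegral do rewrite big_ord0.
  by rewrite !Rintegral_cst// !mul0r mulr0 subrr.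
apply: vanishing_ext (vanishingD IH (vanishingZ (e p) (vEF p))) => v.
have sE := square_integrable_step (sum_step n c E mE).
rewrite -(correlationZr _ _ sE (square_integrable_indic (mF p))).
rewrite -(correlationDr v sE (square_integrable_step (sum_step p e F mF))
  (square_integrableZ (e p) (square_integrable_indic (mF p)))).
by congr (correlation _ _ v); apply/funext => x; rewrite big_ord_recr.
Qed.

Let sqrt_step e C : 0 < e -> 0 <= C ->
  exists2 r : R, 0 < r & 3 * r * (1 + C) <= e.
Proof.
move=> e0 C0; have C1 : 0 < 3 * (1 + C) by rewrite mulr_gt0// ltr_pwDl.
exists (e / (3 * (1 + C))); first by rewrite divr_gt0.
by rewrite mulrAC mulrC divfK// gt_eqF.
Qed.

(** Step functions are dense in L2 and [correlation_small] is uniform in [v], so the two arguments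
    can be replaced by step functions one after the other. *)
Lemma vanishing_correlation f g : square_integrable f -> square_integrable g ->
  vanishing (correlation f g).
Proof.
move=> hf hg.
have half s : step_function s -> vanishing (correlation s g).
  move=> ss; have hs := square_integrable_step ss.
  apply: vanishing_approx => e e0.
  have [r r0 re] := sqrt_step e0 (Rintegral_sqr_ge0 mu s).
  have [t st ht] := step_approximation hg (exprn_gt0 2 r0).
  have h := square_integrable_step st.
  exists (correlation s t); first exact: vanishing_correlation_step.
  move=> v; have hgt := square_integrableB hg h.
  have -> : correlation s g v = correlation s t v + correlation s (fun x => g x - t x) v.
    rewrite -correlationDr//; congr (correlation _ _ v).
    by apply/funext => x; rewrite addrC subrK.
  rewrite addrAC subrr add0r; apply: le_trans re.
  exact: (correlation_small v hgt hs r0 ht).2.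
apply: vanishing_approx => e e0.
have [r r0 re] := sqrt_step e0 (Rintegral_sqr_ge0 mu g).
have [s ss hs] := step_approximation hf (exprn_gt0 2 r0).
have h := square_integrable_step ss.
exists (correlation s g); first exact: half.
move=> v; have hfs := square_integrableB hf h.
have -> : correlation f g v = correlation s g v + correlation (fun x => f x - s x) g v.
  rewrite -correlationDl//; congr (correlation _ _ v).
  by apply/funext => x; rewrite addrC subrK.
rewrite addrAC subrr add0r; apply: le_trans re.
exact: (correlation_small v hfs hg r0 hs).1.
Qed.

Lemma set_mixing_mixing : mixing mu T.
Proof.
move=> f g hf hg.
have sq (h : X -> R) : h \in Lfun mu 2%:E -> square_integrable h.
  move=> hh; split; last exact: Lfun2_integrable_sqr.
  by move: hh; rewrite inE => /andP[]; rewrite inE.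
apply/cvgrPdist_le => e e0.
have := vanishing_correlation (sq f hf) (sq g hg) e0.
by apply: filterS => v; rewrite /correlation distrC.
Qed.

End SetMixing.

Section SystemMixing.
Context {R : realType} (a b : R).
Hypotheses (a0 : 0 < a) (b0 : 0 < b).
Hypothesis dense : forall x delta : R, 0 < delta ->
  exists i j : int, `|x - (i%:~R * a + j%:~R * b)| <= delta.
Local Notation m := (state_measure R).
Local Notation Delta := (fundamental_domain a b).
Local Notation X := (tiling_system a b).
Local Notation mu := (system_measure a b).

Lemma system_set_mixing (E F : set X) : measurable E -> measurable F ->
  vanishing (fun v => fine (mu (E `&` @system_flow _ a b v @^-1` F)) - fine (mu E) * fine (mu F)).
Proof.
move=> mE mF.
have mFv v : measurable (@system_flow _ a b v @^-1` F).
  have /measurable_systemP[mF' iF] := mF; apply/measurable_systemP; split.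
    by apply: preimage_measurable mF'; exact: measurable_flow.
  by move=> n; apply/funext => z; exact: (@invariant_flow _ a b F n v z (conj mF' iF)).
have /measurable_systemP[mE' _] := mE; have /measurable_systemP[mF' iF] := mF.
have D0 := mass_domain_gt0 a0 b0.
have := saturation_mixing a0 b0 dense mF' mE'; rewrite (saturation_id a0 b0 iF).
move=> /(vanishingZ (mass m Delta)^-1); apply: vanishing_ext => v.
rewrite (system_measureE a0 b0 (measurableI _ _ mE (mFv v))).
rewrite (system_measureE a0 b0 mE) (system_measureE a0 b0 mF) /fine /mixing_defect setIAC.
move: (mass m (_ `&` _ `&` _)) (mass m (E `&` Delta)) (mass m (F `&` Delta)) (mass m Delta) D0.
by move=> x y z t t0; field; rewrite gt_eqF.
Qed.

Lemma system_mixing : mixing mu (@system_flow _ a b).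
Proof.
have [_ _ mf mp] := system_measure_preserving a0 b0.
apply: set_mixing_mixing => [v|v E mE|E F mE mF].
- exact: (measurableT_comp mf (measurable_pair1 v)).
- exact: mp.
- exact: system_set_mixing.
Qed.

End SystemMixing.

Theorem theorem5p1 (R : realType) (A B : tile R)
    (irr_width : irrational (width A / width B))
    (irr_height : irrational (height A / height B))
    (wA_hB : width A = height B) (wB_hA : width B = height A) :
  exists (d : measure_display) (X : measurableType d) (mu : probability X R)
    (T : R * R -> X -> X),
    [/\ measure_preserving_action mu T, mixing mu T &
        tileable mu T [set A; B]].
Proof.
have a0 := width_gt0 A; have b0 := height_gt0 A; rewrite wB_hA in irr_width.
exists _, (tiling_system (width A) (height A)), (system_measure (width A) (height A)),
  (@system_flow _ (width A) (height A)); split.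
- exact: system_measure_preserving.
- exact: (system_mixing a0 b0 (lattice_dense a0 b0 irr_width)).
exists setT, (tiling A B); split=> //.
- by rewrite setCT measure0.
- exact: measurable_tiling.
- by move=> z _; exact: tiling_is_tiling.
by apply: aeW => z v; split=> //; exact: tiling_flow.
Qed.
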